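(* There is a choice of thresholds $\eta_0(\delta,m)>0$ (for $\delta\in(0,1/2)$ and integers $m\ge1$) such that, with ''admissible'' defined relative to these thresholds, the following holds. Let $p$ be an admissible Hardy field function, let $(X,\Sigma,\mu)$ be a non-atomic $\sigma$-finite measure space and let $\tau$ be a measure-preserving $\mathbb{Z}$-action on $X$. Then the maximally truncated modulated Hilbert transform $$\mathcal{H}_p^*f:=\sup_{N\ge1}\Bigl|\sum_{n=N}^\infty\frac{e^{2\pi i p(n)}}{n}\,\tau^nf\Bigr|$$ is bounded on $L^r(X)$ for every $1<r<\infty$, and maps $L^1(X)$ boundedly to $L^{1,\infty}(X)$.
   Context: Here $\tau^nf$ denotes $f$ composed with the $n$-th iterate of the invertible measure-preserving transformation generating the action, and infinite series are limits of partial sums. Boundedness $L^1(X)\to L^{1,\infty}(X)$ means $\sup_{\lambda>0}\lambda\,\mu(\{\mathcal{H}_p^*f>\lambda\})\le C\|f\|_{L^1(X)}$ for a constant $C$ and all $f\in L^1(X)$. Hardy fields: consider real-valued functions of a real variable defined and continuous for all large $s$; two are equivalent if they coincide for all large $s$. The equivalence classes (germs) form a ring $B$. A Hardy field is a subfield of $B$ closed under differentiation, and $\mathcal{U}$ denotes the union of all Hardy fields. For $\delta\in(0,1/2)$, $M\ge1$ and an integer $m\ge1$, let $\mathcal{N}_{\delta,M,m}$ be the set of $p\in\mathcal{U}$ (with a representative defined and $m+2$ times continuously differentiable on $[1,\infty)$) for which there exist $\alpha\in[\delta,1-\delta]$ and $0<\eta\le\eta_0(\delta,m)$ such that $$\tfrac1M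 s^{m+\alpha-\eta-j}\le p^{(j)}(s)\le M s^{m+\alpha+\eta-j}\quad\text{for all } s\ge1,\ j=0,\dots,m+1,$$ $$\tfrac1M s^{\alpha-\eta-2}\le |p^{(m+2)}(s)|\le M s^{\alpha+\eta-2}\quad\text{for all } s\ge1.$$ Here $\eta_0(\delta,m)>0$ is a sufficiently small threshold depending only on $\delta$ and $m$ (the paper writes $\eta\ll_{\delta,m}1$). A function $p$ is called admissible if it belongs to some class $\mathcal{N}_{\delta,M,m}$. *)

(* Defs.v *)
From HB Require Import structures.
From mathcomp Require Import all_boot all_order all_algebra.
From mathcomp Require Import complex.
From mathcomp Require Import all_classical all_reals all_analysis.
From mathcomp Require Import measurable_realfun.

Set Implicit Arguments.
Unset Strict Implicit.
Unset Printing Implicit Defensive.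

Import Order.TTheory GRing.Theory Num.Theory.
Import numFieldNormedType.Exports.

Local Open Scope classical_set_scope.
Local Open Scope ring_scope.

(* A germ at +oo is represented by the total functions R -> R belonging to it
   (their values outside a neighbourhood of +oo are irrelevant), and a set of
   germs by a set of functions stable under germ_eq. *)

Definition germ_eq (R : realType) (f g : R -> R) : Prop :=
  \forall s \near +oo, f s = g s.

(* [cont_germ f]: f represents an element of the ring B. *)
Definition cont_germ (R : realType) (f : R -> R) : Prop :=
  \forall s \near +oo, {for s, continuous f}.

Record is_hardy_field (R : realType) (H : set (R -> R)) : Prop := {
  hardy_cont : forall f, H f -> cont_germ f;
  hardy_germ : forall f g, germ_eq f g -> H f -> H g;
  hardy_one : H (fun=> 1);
  hardy_sub : forall f g, H f -> H g -> H (fun s => f s - g s);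
  hardy_mul : forall f g, H f -> H g -> H (fun s => f s * g s);
  hardy_inv : forall f, H f -> ~ germ_eq f (fun=> 0) ->
    exists2 g, H g & germ_eq (fun s => f s * g s) (fun=> 1);
  hardy_derivable : forall f, H f -> \forall s \near +oo, derivable f s 1;
  hardy_derive : forall f, H f -> H (derive1 f)
}.

Definition hardy_union (R : realType) : set (R -> R) :=
  [set f | exists2 H : set (R -> R), is_hardy_field H & H f].

(* Differentiability of a function on a subset D of the line; at an end point
   of an interval this is one-sided differentiability. *)

Definition diff_quotient (R : realType) (f : R -> R) (s y : R) : R :=
  (y - s)^-1 * (f y - f s).

Definition derivable_within (R : realType) (D : set R) (f : R -> R) (s : R) :
    Prop :=
  cvg (diff_quotient f s y @[y --> within D s^']).

Definition derive_within (R : realType) (D : set R) (f : R -> R) (s : R) : R :=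
  lim (diff_quotient f s y @[y --> within D s^']).

Definition derive_within_n (R : realType) (D : set R) (j : nat) (f : R -> R) :
    R -> R :=
  iter j (derive_within D) f.

Definition Ck_within (R : realType) (D : set R) (k : nat) (f : R -> R) : Prop :=
  (forall j, (j < k)%N ->
     forall s, D s -> derivable_within D (derive_within_n D j f) s) /\
  (forall j, (j <= k)%N -> {within D, continuous (derive_within_n D j f)}).

Definition half_line (R : realType) : set R := `[1, +oo[.

Definition hardy_class (R : realType) (eta0 : R -> nat -> R)
    (delta M : R) (m : nat) (p : R -> R) : Prop :=
  [/\ hardy_union p,
      Ck_within (@half_line R) m.+2 p &
      exists alpha eta : R,
        [/\ delta <= alpha <= 1 - delta,
            0 < eta <= eta0 delta m,
            forall (j : nat) (s : R), (j <= m.+1)%N -> 1 <= s ->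
              M^-1 * s `^ (m%:R + alpha - eta - j%:R)
                <= derive_within_n (@half_line R) j p s
                <= M * s `^ (m%:R + alpha + eta - j%:R) &
            forall s : R, 1 <= s ->
              M^-1 * s `^ (alpha - eta - 2)
                <= `| derive_within_n (@half_line R) m.+2 p s |
                <= M * s `^ (alpha + eta - 2)]].

Definition admissible (R : realType) (eta0 : R -> nat -> R) (p : R -> R) :
    Prop :=
  exists (delta M : R) (m : nat),
    [/\ 0 < delta < 2^-1, 1 <= M, (1 <= m)%N & hardy_class eta0 delta M m p].

Definition non_atomic d (X : measurableType d) (R : realType)
    (mu : {measure set X -> \bar R}) : Prop :=
  forall A : set X, measurable A -> (0 < mu A)%E ->
    exists B : set X,
      [/\ measurable B, B `<=` A, (0 < mu B)%E & (mu B < mu A)%E].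

Record measure_preserving_Zaction d (X : measurableType d) (R : realType)
    (mu : {measure set X -> \bar R}) (tau : int -> X -> X) : Prop := {
  Zact0 : forall x, tau 0 x = x;
  ZactD : forall (k l : int) x, tau (k + l) x = tau k (tau l x);
  Zact_measurable : forall k : int, measurable_fun setT (tau k);
  Zact_preserving : forall (k : int) (A : set X), measurable A ->
    mu (tau k @^-1` A) = mu A
}.

Definition cmodulus (R : realType) (z : R[i]) : R := complex.Re `|z|.

Definition unit_exp (R : realType) (t : R) : R[i] :=
  (cos (2 * pi * t) +i* sin (2 * pi * t))%C.

Definition cLnorm d (X : measurableType d) (R : realType)
    (mu : {measure set X -> \bar R}) (r : R) (f : X -> R[i]) : \bar R :=
  Lnorm mu r%:E (fun x => (cmodulus (f x))%:E).

(* [cLfun mu r f]: f represents an element of the complex space L^r(X). *)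
Definition cLfun d (X : measurableType d) (R : realType)
    (mu : {measure set X -> \bar R}) (r : R) (f : X -> R[i]) : Prop :=
  [/\ measurable_fun setT (fun x => complex.Re (f x)),
      measurable_fun setT (fun x => complex.Im (f x)) &
      (cLnorm mu r f < +oo)%E].

(* R[i]^o is R[i] with the topology given by its modulus. *)
Definition hilbert_partial_sum d (X : measurableType d) (R : realType)
    (p : R -> R) (tau : int -> X -> X) (f : X -> R[i]) (x : X) (N K : nat) :
    R[i]^o :=
  \sum_(N <= n < K) unit_exp (p n%:R) / n%:R * f (tau n%:Z x).

Definition hilbert_tail d (X : measurableType d) (R : realType)
    (p : R -> R) (tau : int -> X -> X) (f : X -> R[i]) (x : X) (N : nat) :
    R[i] :=
  limn (hilbert_partial_sum p tau f x N).

(* The limits defining [hilbert_tail] need not exist at every x. *)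
Definition hilbert_tails_cvg d (X : measurableType d) (R : realType)
    (p : R -> R) (tau : int -> X -> X) (f : X -> R[i]) (x : X) : Prop :=
  forall N, (1 <= N)%N -> cvgn (hilbert_partial_sum p tau f x N).

Definition hilbert_max d (X : measurableType d) (R : realType)
    (p : R -> R) (tau : int -> X -> X) (f : X -> R[i]) (x : X) : \bar R :=
  ereal_sup [set (cmodulus (hilbert_tail p tau f x N))%:E
            | N in [set N : nat | (1 <= N)%N]].

Definition weak_L1_quasinorm d (X : measurableType d) (R : realType)
    (mu : {measure set X -> \bar R}) (g : X -> \bar R) : \bar R :=
  ereal_sup [set (lambda%:E * mu [set x | (lambda%:E < g x)%E])%E
            | lambda in [set l : R | 0 < l]].

(* Measurability of T f is part of T f belonging to the target space. *)
Definition bounded_on_Lr d (X : measurableType d) (R : realType)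
    (mu : {measure set X -> \bar R}) (r : R)
    (T : (X -> R[i]) -> X -> \bar R) : Prop :=
  exists C : R, forall f, cLfun mu r f ->
    measurable_fun setT (T f) /\
    (Lnorm mu r%:E (T f) <= C%:E * cLnorm mu r f)%E.

Definition bounded_L1_weak_L1 d (X : measurableType d) (R : realType)
    (mu : {measure set X -> \bar R})
    (T : (X -> R[i]) -> X -> \bar R) : Prop :=
  exists C : R, forall f, cLfun mu 1 f ->
    measurable_fun setT (T f) /\
    (weak_L1_quasinorm mu (T f) <= C%:E * cLnorm mu 1 f)%E.

(* Main.v *)
Require Import Defs.
From HB Require Import structures.
From mathcomp Require Import all_boot all_order all_algebra.
From mathcomp Require Import complex.
From mathcomp Require Import all_classical all_reals all_analysis.
From mathcomp Require Import measurable_realfun.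
From mathcomp Require Import zify ring lra.
Import Order.TTheory GRing.Theory Num.Theory.
Import numFieldNormedType.Exports.
Local Open Scope classical_set_scope.
Local Open Scope ring_scope.

(* With the threshold [eta0 = delta / 16], van der Corput differencing followed
   by a Kusmin-Landau estimate shows that [a n = e(p n) / n] is almost
   uncorrelated with its translates: over the block [2 ^ i, 2 ^ i.+1) the
   correlation at lag [z] gains a factor [8 ^ (i %/ e)] on the trivial bound,
   unless [z] is smaller than [2 ^ i / 8 ^ (i %/ e)].

   By transference both maximal inequalities follow from the case of a finitely
   supported [f] on the integers.

   Strong type: the maximal partial sum over the [j]-th dyadic block has an l2
   norm exponentially small in [j]; interpolating with the trivial l1 and sup
   bounds keeps exponential decay on every l^r, so the block maxima are summable.

   Weak type, at height [1]: away from a small exceptional set, [f y] interacts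
   with the scale [2 ^ i] only if all dyadic intervals around [y] of length at
   least [2 ^ i] have mean at most [1].  Write [s] for the first such scale
   [2 ^ s] at [y] and sort the pairs [(i, y)] by [k = min(i - s, i %/ e)].
   For fixed [k] the starting point [N] of the truncated sum is removed by
   quantizing an upper bound for the mass of the part beyond [N]: up to a small
   error the truncated sum is a sum of full level sets of this quantity, at most
   [4 ^ (k %/ 8)] of them, whose second moments add up to [O(2 ^ - k)] by the
   correlation estimate.  The exceptional sets are therefore summable in [k].

   For [r > 1] the summability of the block maxima also gives convergence almost
   everywhere; for [r = 1] convergence follows by truncating [f] and applying the
   weak type inequality to the unbounded part. *)

(** The obstacle in the weak type bound is that the relevant starting point [N] depends on [x]
    without any regularity. Expanding squares turns cutoffs into weights in sums over [x] of
    products $a_{y-x}\overline{a_{y'-x}}$, and cancellation survives only if these weights have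
    controlled variation. Level sets of the tail mass do not involve [N] and are constant on cells,
    so the weights jump $O(2^k)$ times per block, which the gain $8^{i/e} \ge 8^k$ pays for. This is
    why [k] is a minimum: $k \le i/e$ secures the gain, and $k \le i - s$ keeps the mass of dyadic
    intervals of length at least $2^{i-k}$ below their length. The latter also handles pairs closer
    than one cell, for which no cancellation is available. For the exponential sums, [m]
    differencing steps bring the increments of the phase between a positive lower bound and $1/16$,
    the range of a Kusmin-Landau estimate. Lags may be much larger than the block; the constant sign
    of $p^{(m+2)}$ prevents the phase from degenerating there. *)

Set Implicit Arguments.
Unset Strict Implicit.
Unset Printing Implicit Defensive.

(** * Modulus and exponentials in [R[i]] *)

Section Modulus.
Variable R : realType.
Implicit Types (z w : R[i]) (t : R).
Local Notation cm := (@cmodulus R).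

Lemma cmodulus_normc z : cm z = ComplexField.Normc.normc z.
Proof. by case: z. Qed.

Lemma cmodulus_ge0 z : 0 <= cm z.
Proof. by rewrite cmodulus_normc; case: z => a b /=; exact: sqrtr_ge0. Qed.

Lemma cmodulus0 : cm 0 = 0.
Proof. by rewrite cmodulus_normc ComplexField.Normc.normc0. Qed.

Lemma cmodulusM z w : cm (z * w) = cm z * cm w.
Proof. by rewrite !cmodulus_normc ComplexField.Normc.normcM. Qed.

Lemma cmodulusN z : cm (- z) = cm z.
Proof. by case: z => a b; rewrite !cmodulus_normc/= !sqrrN. Qed.

Lemma cmodulusD z w : cm (z + w) <= cm z + cm w.
Proof.
have := ler_normD z w; rewrite lecE => /andP[_].
by rewrite /cmodulus; case: (`|z|) => a b; case: (`|w|).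
Qed.

Lemma cmodulusB z w : cm (z - w) <= cm z + cm w.
Proof. by rewrite -(cmodulusN w); exact: cmodulusD. Qed.

Lemma cmodulus_sum (I : Type) (s : seq I) (P : pred I) (F : I -> R[i]) :
  cm (\sum_(i <- s | P i) F i) <= \sum_(i <- s | P i) cm (F i).
Proof.
elim/big_ind2 : _ => //; first by rewrite cmodulus0.
by move=> x1 x2 y1 y2 h1 h2; rewrite (le_trans (cmodulusD _ _))// lerD.
Qed.

Lemma cmodulus_conj z : cm (conjc z) = cm z.
Proof. by case: z => a b; rewrite !cmodulus_normc/= sqrrN. Qed.

Lemma cmodulus_real t : cm (t%:C)%C = `|t|.
Proof. by rewrite cmodulus_normc/= expr0n/= addr0 sqrtr_sqr. Qed.

Lemma cmodulus_sqr z : cm z ^+ 2 = complex.Re (z * conjc z).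
Proof.
case: z => a b; rewrite cmodulus_normc /= sqr_sqrtr ?addr_ge0 ?sqr_ge0//.
by ring.
Qed.

Lemma ler_Re_cmodulus z : complex.Re z <= cm z.
Proof.
case: z => a b; rewrite cmodulus_normc /= (le_trans (ler_norm a))//.
by rewrite -sqrtr_sqr ler_wsqrtr// lerDl sqr_ge0.
Qed.

Lemma Re_sum (I : Type) (s : seq I) (P : pred I) (F : I -> R[i]) :
  complex.Re (\sum_(i <- s | P i) F i) = \sum_(i <- s | P i) complex.Re (F i).
Proof.
by elim/big_rec2 : _ => // i y1 y2 _ <-; case: (F i); case: (y2).
Qed.

Lemma Im_sum (I : Type) (s : seq I) (P : pred I) (F : I -> R[i]) :
  complex.Im (\sum_(i <- s | P i) F i) = \sum_(i <- s | P i) complex.Im (F i).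
Proof.
by elim/big_rec2 : _ => // i y1 y2 _ <-; case: (F i); case: (y2).
Qed.

Lemma unit_expD t s : unit_exp (t + s) = unit_exp t * unit_exp s.
Proof.
rewrite /unit_exp mulrDr cosD sinD /=; apply/eqP; rewrite eq_complex /=.
by rewrite addrC eqxx /= [X in _ == X]addrC eqxx.
Qed.

Lemma conj_unit_exp t : conjc (unit_exp t) = unit_exp (- t).
Proof. by rewrite /unit_exp mulrN cosN sinN. Qed.

Lemma cmodulus_unit_exp t : cm (unit_exp t) = 1.
Proof. by rewrite cmodulus_normc /= cos2Dsin2 sqrtr1. Qed.

End Modulus.

(** * Exponential sums *)

Section ExponentialSums.
Variable R : realType.
Implicit Types (z w : R[i]) (t : R).
Local Notation cm := (@cmodulus R).

(** Cauchy-Schwarz against the constant sequence; the new cross term is bounded through $2 x_a x_b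
    \le x_a^2 + x_b^2$. *)
Lemma sum_sqr_le (I : Type) (s : seq I) (x : I -> R) :
  (\sum_(i <- s) x i) ^+ 2 <= (size s)%:R * \sum_(i <- s) x i ^+ 2.
Proof.
elim: s => [|a s IHs]; first by rewrite !big_nil expr0n mulr0.
have cross : 2 * x a * (\sum_(i <- s) x i) <=
    (size s)%:R * x a ^+ 2 + \sum_(i <- s) x i ^+ 2.
  elim: s {IHs} => [|b s IHs]; first by rewrite !big_nil mulr0 mul0r addr0.
  rewrite !big_cons /= -natr1; have := sqr_ge0 (x a - x b); nra.
by rewrite !big_cons /= -natr1; nra.
Qed.

Lemma cmodulus_sqr_sum (I : Type) (s : seq I) (P : pred I) (F : I -> R[i]) :
  cm (\sum_(i <- s | P i) F i) ^+ 2 =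
  \sum_(i <- s | P i) \sum_(j <- s | P j) complex.Re (F i * conjc (F j)).
Proof.
rewrite cmodulus_sqr rmorph_sum mulr_suml Re_sum; apply: eq_bigr => i _.
by rewrite mulr_sumr Re_sum.
Qed.

Lemma lipschitz1 (f df : R -> R) (a b : R) :
  (forall x : R, is_derive x 1 f (df x)) -> (forall x : R, `|df x| <= 1) ->
  `|f b - f a| <= `|b - a|.
Proof.
move=> fd df1; wlog ab : a b / a <= b.
  by move=> h; case: (leP a b) => [/h //|/ltW /h]; rewrite distrC (distrC a).
have [|c _ ->] := @MVT_segment R f df a b ab (fun x _ => fd x).
  by apply: continuous_subspaceT => y; apply: differentiable_continuous;
    apply/derivable1_diffP; case: (fd y).
by rewrite normrM ler_piMl.
Qed.

Lemma pi_le4 : pi <= 4 :> R.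
Proof. by have [/andP[_ h] _] := @pihalf_02_cos_pihalf R; lra. Qed.

Lemma cos_lipschitz (a b : R) : `|cos b - cos a| <= `|b - a|.
Proof.
apply: (@lipschitz1 _ (fun x => - sin x)) => x.
by rewrite normrN ler_norml sin_geN1 sin_le1.
Qed.

Lemma sin_lipschitz (a b : R) : `|sin b - sin a| <= `|b - a|.
Proof.
by apply: (@lipschitz1 _ cos) => x; rewrite ler_norml cos_geN1 cos_le1.
Qed.

Lemma sin_ge_half (x : R) : 0 <= x <= 2^-1 -> x / 2 <= sin x.
Proof.
move=> /andP[x0 x1].
have [|c] := @MVT_segment R (@sin R) (@cos R) 0 x x0
  (fun y _ => is_derive_sin y).
  by apply: continuous_subspaceT => y; exact: continuous_sin.
rewrite in_itv/= sin0 !subr0 => /andP[c0 cx] ->.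
have := cos_lipschitz 0 c; rewrite cos0 subr0 (ger0_norm c0) ler_norml.
move=> /andP[h _]; rewrite mulrC ler_wpM2r//; lra.
Qed.

(** The imaginary part suffices: $t \le 1/16$ and [pi_le4] put $2\pi t$ in $[0, 1/2]$, where $\sin s
    \ge s/2$. *)
Lemma unit_exp_sub1_ge t : 0 <= t <= 16^-1 -> t <= cm (unit_exp t - 1).
Proof.
move=> /andP[t0 t1]; have p2 := @pi_ge2 R; have p4 := pi_le4.
have h : 0 <= 2 * pi * t <= 2^-1.
  by rewrite !mulr_ge0//; [nra|lra].
have := sin_ge_half h; set s := sin _ => hs.
apply: (@le_trans _ _ s); first by nra.
rewrite cmodulus_normc /unit_exp -/s /= subr0.
by rewrite (le_trans (ler_norm s))// -sqrtr_sqr ler_wsqrtr// lerDr sqr_ge0.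
Qed.

(** Two coordinates, each with Lipschitz constant $2\pi \le 8$. *)
Lemma unit_exp_lipschitz t s : cm (unit_exp t - unit_exp s) <= 16 * `|t - s|.
Proof.
have p4 := pi_le4; have p0 := @pi_ge0 R.
have -> : unit_exp t - unit_exp s =
   ((cos (2 * pi * t) - cos (2 * pi * s))%:C +
    'i * (sin (2 * pi * t) - sin (2 * pi * s))%:C)%C.
  by rewrite [LHS]complexE.
apply: (le_trans (cmodulusD _ _)); rewrite cmodulusM !cmodulus_real.
have -> : cm 'i%C = 1.
  by rewrite cmodulus_normc /= expr0n expr1n add0r sqrtr1.
have := cos_lipschitz (2 * pi * s) (2 * pi * t).
have := sin_lipschitz (2 * pi * s) (2 * pi * t).
rewrite -mulrBr normrM ger0_norm ?mulr_ge0// => h1 h2.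
have n0 := normr_ge0 (t - s); nra.
Qed.

(* Summation by parts, writing [z n = (z n.+1 - z n) w n] with
   [w n = 1 / (e(theta n) - 1)]; no monotonicity of the increments [theta] is
   assumed, only a bound on their variation. *)
Lemma kusmin_landau (psi : nat -> R) (lam v : R) (a b : nat) :
  0 < lam -> 0 <= v -> (a <= b)%N ->
  (forall n, (a <= n <= b)%N -> lam <= psi n.+1 - psi n <= 16^-1) ->
  (forall n, (a <= n <= b)%N ->
     `|(psi n.+2 - psi n.+1) - (psi n.+1 - psi n)| <= v) ->
  cm (\sum_(a <= n < b) unit_exp (psi n)) <=
    2 / lam + 16 * (b - a)%:R * v / lam ^+ 2.
Proof.
move=> lam0 v0 ab hth hv.
pose th n := psi n.+1 - psi n; pose w n := (unit_exp (th n) - 1)^-1.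
have zS n : unit_exp (psi n.+1) = unit_exp (psi n) * unit_exp (th n).
  by rewrite -unit_expD /th addrC subrK.
have cV z : cm z^-1 = (cm z)^-1.
  by rewrite !cmodulus_normc ComplexField.Normc.normcV.
have nz n : (a <= n <= b)%N -> lam <= cm (unit_exp (th n) - 1).
  move=> /hth /andP[h1 h2]; apply: (le_trans h1); apply: unit_exp_sub1_ge.
  by rewrite h2 (le_trans (ltW lam0) h1).
have wle n : (a <= n <= b)%N -> cm (w n) <= lam^-1.
  by move=> /nz h; rewrite cV lef_pV2 ?posrE// (lt_le_trans lam0).
have ne0 n : (a <= n <= b)%N -> unit_exp (th n) - 1 != 0.
  move=> /nz h; apply/eqP => e; move: h; rewrite e cmodulus0.
  by rewrite leNgt lam0.
(* The boundary terms cost at most $2/\lambda$. Each index leaves an error $z_{c+1}(w_c - w_{c+1})$,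
   of modulus at most $|e(\theta_{c+1}) - e(\theta_c)| \lambda^{-2} \le 16 v / \lambda^2$. *)
suff H : forall c, (a <= c <= b)%N ->
   cm (\sum_(a <= n < c) unit_exp (psi n) -
       (unit_exp (psi c) * w c - unit_exp (psi a) * w a))
   <= (c - a)%:R * (16 * v / lam ^+ 2).
  set S := \sum_(_ <= _ < _) _; have := H b; rewrite ab leqnn => /(_ isT).
  rewrite -/S; set T := (_ * w b - _) => hST.
  have hT : cm T <= 2 / lam.
    apply: (le_trans (cmodulusB _ _)); rewrite !cmodulusM !cmodulus_unit_exp.
    rewrite !mul1r mulrDl mul1r; apply: lerD; apply: wle; rewrite ?leqnn ?ab//.
  rewrite -[S](subrK T) addrC (le_trans (cmodulusD _ _))//.
  by apply: lerD => //; apply: le_trans hST _; rewrite !mulrA (mulrC _ 16).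
elim=> [|c IHc].
  by rewrite leqn0 => /andP[/eqP a0 _]; rewrite a0 big_geq// !subrr cmodulus0 mul0r.
rewrite leq_eqVlt => /andP[/predU1P[<-|ac] cb].
  by rewrite big_geq// !subrr subnn cmodulus0 mul0r.
have hc : (a <= c <= b)%N by rewrite -ltnS ac ltnW.
have hc1 : (a <= c.+1 <= b)%N by rewrite cb ltnW.
rewrite big_nat_recr//= subSn// -natr1 mulrDl mul1r.
have -> : \sum_(a <= i < c) unit_exp (psi i) + unit_exp (psi c) -
   (unit_exp (psi c.+1) * w c.+1 - unit_exp (psi a) * w a) =
   (\sum_(a <= i < c) unit_exp (psi i) -
     (unit_exp (psi c) * w c - unit_exp (psi a) * w a)) +
   unit_exp (psi c.+1) * (w c - w c.+1).
  have {1}-> : unit_exp (psi c) = unit_exp (psi c.+1) * w c - unit_exp (psi c) * w c.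
    rewrite -mulrBl zS -[X in _ - X]mulr1 -mulrBr -mulrA.
    by rewrite /w mulfV ?mulr1// ne0.
  by ring.
apply: (le_trans (cmodulusD _ _)); apply: lerD; first exact: IHc.
rewrite cmodulusM cmodulus_unit_exp mul1r.
have -> : w c - w c.+1 = (unit_exp (th c.+1) - unit_exp (th c)) * w c * w c.+1.
  have h1 := ne0 _ hc; have h2 := ne0 _ hc1.
  by rewrite /w; field; rewrite h1 h2.
rewrite !cmodulusM expr2 invfM !mulrA.
have L0 : 0 <= lam^-1 by rewrite invr_ge0 ltW.
apply: ler_pM; rewrite ?mulr_ge0 ?cmodulus_ge0 ?wle//.
apply: ler_pM; rewrite ?mulr_ge0 ?cmodulus_ge0 ?wle//.
apply: (le_trans (unit_exp_lipschitz _ _)); rewrite ler_wpM2l//.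
by rewrite /th; exact: hv.
Qed.

End ExponentialSums.
Lemma sum_supp_shift (V : nmodType) (f : nat -> V) (h M T : nat) :
  (h + M <= T)%N -> (forall t, ~~ (h <= t < h + M)%N -> f t = 0) ->
  \sum_(0 <= t < T) f t = \sum_(0 <= n < M) f (n + h)%N.
Proof.
move=> hT f0; rewrite (big_cat_nat (n := h))//=; last first.
  exact: leq_trans (leq_addr _ _) hT.
rewrite big_nat_cond big1 ?add0r; last first.
  by move=> i /andP[/andP[_ ih] _]; rewrite f0// leqNgt ih.
rewrite (big_cat_nat (n := (h + M)%N)) ?leq_addr//=.
rewrite [X in _ + X]big_nat_cond [X in _ + X]big1 ?addr0; last first.
  by move=> i /andP[/andP[ih _] _]; rewrite f0// negb_and -!leqNgt ih orbT.
by rewrite -{1}[h]add0n big_addn addKn.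
Qed.

(** * Van der Corput differencing *)

Section VanDerCorput.
Variable R : realType.

Local Notation cm := (@cmodulus R).

(** Averaging over [H] delayed copies of [z]: $HS$ is the sum over $N+H$ positions of all copies
    there. Cauchy-Schwarz in the position and expansion of the square leave the correlations at lags
    $|h-h'| < H$, those with $h = h'$ being at most $N$. *)
Lemma van_der_corput (N H L : nat) (z : nat -> R[i]) (E : R) :
  (0 < H <= N)%N -> (L <= N)%N -> 0 <= E ->
  (forall n, cm (z n) <= 1) ->
  (forall h, (0 < h < H)%N ->
     cm (\sum_(0 <= n < L - h) z (n + h)%N * conjc (z n)) <= E) ->
  H%:R * cm (\sum_(0 <= n < L) z n) ^+ 2 <= 2 * N%:R * (N%:R + H%:R * E).
Proof.
move=> /andP[H0 HN] LN E0 z1 hE.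
pose Z t h := if (h <= t < h + L)%N then z (t - h)%N else 0.
have Z1 t h : cm (Z t h) <= 1.
  by rewrite /Z; case: ifP => // _; rewrite cmodulus0.
have sumZ h : (h < H)%N -> \sum_(0 <= t < N + H) Z t h = \sum_(0 <= n < L) z n.
  move=> hH; rewrite (@sum_supp_shift _ _ h L); last 2 first.
  - by lia.
  - by move=> t; rewrite /Z => /negbTE ->.
  apply: eq_big_nat => n /andP[_ nL].
  by rewrite /Z leq_addl addnC ltn_add2l nL addKn.
have corr_lt h h' : (h < h' < H)%N ->
    cm (\sum_(0 <= t < N + H) Z t h * conjc (Z t h')) <= E.
  move=> /andP[hh' h'H].
  have -> : \sum_(0 <= t < N + H) Z t h * conjc (Z t h') =
     \sum_(0 <= n < L - (h' - h)) z (n + (h' - h))%N * conjc (z n).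
    rewrite (@sum_supp_shift _ _ h' (L - (h' - h))); last 2 first.
    - by lia.
    - move=> t ht; rewrite /Z; case: ifP => h1; last by rewrite mul0r.
      case: ifP => h2; last by rewrite conjc0 mulr0.
      by exfalso; lia.
    apply: eq_big_nat => n /andP[_ nL]; rewrite /Z !ifT; try lia.
    by congr (z _ * conjc (z _)); lia.
  by apply: hE; lia.
have corr h h' : (h < H)%N -> (h' < H)%N ->
    complex.Re (\sum_(0 <= t < N + H) Z t h * conjc (Z t h')) <=
    (if h == h' then N%:R else 0) + E.
  move=> hH h'H; apply: (le_trans (ler_Re_cmodulus _)).
  case: (ltngtP h h') => hh'; rewrite ?add0r.
  - by apply: corr_lt; rewrite hh'.
  - rewrite -cmodulus_conj rmorph_sum.
    under eq_bigr do rewrite rmorphM/= conjcK mulrC.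
    by apply: corr_lt; rewrite hh'.
  - rewrite -hh' ler_wpDr//.
    have -> : \sum_(0 <= t < N + H) Z t h * conjc (Z t h) =
        \sum_(0 <= n < L) Z (n + h)%N h * conjc (Z (n + h)%N h).
      apply: sum_supp_shift; first by lia.
      by move=> t /negbTE; rewrite /Z => ->; rewrite mul0r.
    apply: (le_trans (cmodulus_sum _ _ _)).
    apply: (@le_trans _ _ (\sum_(0 <= n < L) 1)).
      apply: ler_sum => n _; rewrite cmodulusM cmodulus_conj.
      by rewrite mulr_ile1 ?cmodulus_ge0.
    by rewrite sumr_const_nat subn0 ler_nat.
set S := \sum_(0 <= n < L) z n.
have HS : H%:R * S = \sum_(0 <= t < N + H) \sum_(0 <= h < H) Z t h.
  rewrite exchange_big /= (eq_big_nat _ _ (F2 := fun=> S)).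
    by rewrite sumr_const_nat subn0 mulr_natl.
  by move=> h /andP[_ hH]; rewrite sumZ.
have key : (H%:R * cm S) ^+ 2 <= (N + H)%:R * (H%:R * N%:R + H%:R ^+ 2 * E).
  have -> : H%:R * cm S = cm (H%:R * S).
    by rewrite cmodulusM -(rmorph_nat (real_complex R)) cmodulus_real ger0_norm.
  rewrite HS.
  apply: (@le_trans _ _
     ((\sum_(0 <= t < N + H) cm (\sum_(0 <= h < H) Z t h)) ^+ 2)).
    rewrite ler_pXn2r ?nnegrE ?cmodulus_ge0 ?cmodulus_sum//.
    by apply: sumr_ge0 => i _; rewrite cmodulus_ge0.
  apply: (le_trans (sum_sqr_le _ _)); rewrite size_iota subn0 ler_wpM2l//.
  under eq_bigr do rewrite cmodulus_sqr_sum.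
  rewrite exchange_big /=; under eq_bigr do rewrite exchange_big /=.
  under eq_bigr => h _ do under eq_bigr => h' _ do rewrite -Re_sum.
  apply: (@le_trans _ _ (\sum_(0 <= h < H) \sum_(0 <= h' < H)
     ((if h == h' then N%:R else 0) + E))).
    rewrite [leLHS]big_nat_cond [leRHS]big_nat_cond.
    apply: ler_sum => h /andP[/andP[_ hH] _].
    rewrite [leLHS]big_nat_cond [leRHS]big_nat_cond.
    apply: ler_sum => h' /andP[/andP[_ h'H] _].
    exact: corr.
  rewrite (eq_big_nat _ _ (F2 := fun=> N%:R + H%:R * E)); last first.
    move=> h /andP[_ hH]; rewrite big_split /= sumr_const_nat subn0 mulr_natl.
    congr (_ + _); rewrite -big_mkcond /= (big_rem h)/= ?mem_index_iota ?hH//.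
    rewrite eqxx big_seq_cond big1 ?addr0// => i /andP[].
    by rewrite rem_filter ?iota_uniq// mem_filter /= eq_sym => /andP[/negbTE ->].
  by rewrite sumr_const_nat subn0 -[_ *+ H]mulr_natl mulrDr expr2 -mulrA.
have Hp : 0 < H%:R :> R by rewrite ltr0n.
rewrite -(ler_pM2l Hp); apply: (@le_trans _ _ ((H%:R * cm S) ^+ 2)).
  by rewrite exprMn [H%:R ^+ 2]expr2 mulrA.
apply: (le_trans key); rewrite natrD.
have HNR : H%:R <= N%:R :> R by rewrite ler_nat.
have : 0 <= N%:R + H%:R * E by rewrite addr_ge0 ?mulr_ge0.
nra.
Qed.

Definition fdiff (f : nat -> R) (n : nat) := f n.+1 - f n.

(** One differencing step trades differences of order [k.+1] of the old phase for differences of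
    order [k] of the new one, at the cost of [h] summands. *)
Lemma iter_fdiff_shift k h (f : nat -> R) n :
  iter k fdiff (fun n => f (n + h)%N - f n) n =
  \sum_(0 <= l < h) iter k.+1 fdiff f (n + l)%N.
Proof.
have -> : \sum_(0 <= l < h) iter k.+1 fdiff f (n + l)%N =
    iter k fdiff f (n + h)%N - iter k fdiff f n.
  rewrite -[in RHS](addn0 n) -addnA add0n -(telescope_sumr (fun l => iter k fdiff f (n + l)%N))//.
  by apply: eq_bigr => l _; rewrite iterS /fdiff addnS.
elim: k n => //= k IHk n; rewrite /fdiff !IHk.
by rewrite addSn; ring.
Qed.

Lemma exprD_le (x y : R) k : 0 <= x -> 0 <= y ->
  (x + y) ^+ k <= 2 ^+ k * (x ^+ k + y ^+ k).
Proof.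
move=> x0 y0; wlog xy : x y x0 y0 / x <= y.
  by move=> h; case: (leP x y) => [/h //|/ltW /h]; rewrite addrC [x ^+ k + _]addrC; apply.
apply: (@le_trans _ _ ((2 * y) ^+ k)).
  by rewrite lerXn2r ?nnegrE ?mulr_ge0 ?addr_ge0//; lra.
by rewrite exprMn ler_wpM2l ?exprn_ge0// lerDr exprn_ge0.
Qed.

(* [m] differencing steps with shifts smaller than [H] reduce a phase whose
   difference of order [m + 1] is small to the situation of
   [kusmin_landau]. *)
Lemma van_der_corput_iter m : exists2 C : R, 0 <= C &
  forall (lam Lam v : R) (H N : nat) (phi : nat -> R) (a b : nat),
  0 < lam -> 0 <= Lam -> 0 <= v -> (0 < H <= N)%N -> (a <= b <= a + N)%N ->
  H%:R ^+ m * Lam <= 16^-1 ->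
  2 / lam + 16 * N%:R * (H%:R ^+ m * v) / lam ^+ 2 <= N%:R / H%:R ->
  (forall n, (a <= n <= b)%N -> lam <= iter m.+1 fdiff phi n <= Lam) ->
  (forall n, (a <= n <= b)%N -> `|iter m.+2 fdiff phi n| <= v) ->
  cm (\sum_(a <= n < b) unit_exp (phi n)) ^+ (2 ^ m)%N <=
     C * (N%:R ^+ (2 ^ m)%N / H%:R).
Proof.
elim: m => [|m [C C0 IHm]].
  exists 1 => // lam Lam v H N phi a b lam0 Lam0 v0 HN /andP[ab bN].
  rewrite expr0 !mul1r expn0 !expr1 => hLam hbal hlam hv.
  apply: le_trans hbal; apply: le_trans (kusmin_landau lam0 v0 ab _ hv) _.
    by move=> n /hlam /andP[h1 h2]; rewrite h1/= (le_trans h2 hLam).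
  rewrite lerD2l ler_wpM2r ?invr_ge0 ?exprn_ge0 ?(ltW lam0)// ler_wpM2r//.
  by rewrite ler_wpM2l// ler_nat leq_subLR.
pose K := (2 ^ m)%N.
exists (2 ^+ K * (2 ^+ K * (1 + C))).
  by rewrite !mulr_ge0 ?exprn_ge0 ?addr_ge0.
move=> lam Lam v H N phi a b lam0 Lam0 v0 /andP[H0 HN] /andP[ab bN].
move=> hLam hbal hlam hv.
have Hp : 0 < H%:R :> R by rewrite ltr0n.
have H1 : 1 <= H%:R :> R by rewrite ler1n.
have Np : 0 < N%:R :> R by rewrite ltr0n (leq_trans H0).
pose B := C * (N%:R ^+ K / H%:R).
have B0 : 0 <= B by rewrite /B mulr_ge0 ?divr_ge0 ?exprn_ge0.
pose z n := unit_exp (phi (n + a)%N).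
pose cor h := cm (\sum_(0 <= n < b - a - h) z (n + h)%N * conjc (z n)).
(* The induction hypothesis bounds each [cor h] separately; the maximum is the uniform bound that
   [van_der_corput] asks for. *)
pose E := \big[Num.max/0]_(h < H | (0 < h)%N) cor h.
have [E0 EB] : 0 <= E /\ E ^+ K <= B.
  rewrite /E; apply: (big_ind (fun x => 0 <= x /\ x ^+ K <= B)).
  - by split=> //; rewrite expr0n; rewrite /K expn_eq0.
  - by move=> x y [? ?] [? ?]; rewrite /Num.max; case: ifP.
  move=> h h0; split; first exact: cmodulus_ge0.
  have [hba|/ltnW hba] := leqP h (b - a); last first.
    by rewrite /cor (eqP hba) big_geq// cmodulus0 expr0n expn_eq0.
  have -> : cor h = cm (\sum_(a <= n < b - h)
      unit_exp ((fun n => phi (n + h)%N - phi n) n)).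
    rewrite /cor -{2}[a]add0n big_addn subnAC; congr cm.
    apply: eq_bigr => n _; rewrite conj_unit_exp -unit_expD.
    by rewrite addnAC.
  have hle n : (a <= n <= b - h)%N -> forall l, (l < h)%N -> (a <= n + l <= b)%N.
    by move=> hn l lh; move: hba hn lh; clear; lia.
  have h1R : 1 <= h%:R :> R by rewrite ler1n.
  have hHR : h%:R <= H%:R :> R by rewrite ler_nat ltnW.
  (* Since $1 \le h < H$, the lower bound [lam] persists, while [Lam] and [v] grow by at most a
     factor [H], which the missing power of [H] in the induction hypothesis absorbs. *)
  apply: (IHm lam (H%:R * Lam) (H%:R * v)) => //.
  - by rewrite mulr_ge0.
  - by rewrite mulr_ge0.
  - by rewrite H0.
  - by move: hba bN ab; clear; lia.
  - by rewrite mulrA -exprSr.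
  - by rewrite (mulrA _ _ v) -exprSr.
  - move=> n hn; rewrite iter_fdiff_shift; apply/andP; split.
      apply: (@le_trans _ _ (\sum_(0 <= l < h) lam)).
        by rewrite sumr_const_nat subn0 -[_ *+ h]mulr_natl ler_peMl// ltW.
      rewrite [leLHS]big_nat_cond [leRHS]big_nat_cond.
      apply: ler_sum => l /andP[/andP[_ lh] _].
      by have /andP[] := hlam _ (hle _ hn _ lh).
    apply: (@le_trans _ _ (\sum_(0 <= l < h) Lam)).
      rewrite [leLHS]big_nat_cond [leRHS]big_nat_cond.
      apply: ler_sum => l /andP[/andP[_ lh] _].
      by have /andP[] := hlam _ (hle _ hn _ lh).
    by rewrite sumr_const_nat subn0 -[_ *+ h]mulr_natl ler_wpM2r.
  - move=> n hn; rewrite iter_fdiff_shift.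
    apply: (le_trans (ler_norm_sum _ _ _)).
    apply: (@le_trans _ _ (\sum_(0 <= l < h) v)).
      rewrite [leLHS]big_nat_cond [leRHS]big_nat_cond.
      apply: ler_sum => l /andP[/andP[_ lh] _].
      exact: hv (hle _ hn _ lh).
    by rewrite sumr_const_nat subn0 -[_ *+ h]mulr_natl ler_wpM2r.
set S := \sum_(a <= n < b) _.
have ES : S = \sum_(0 <= n < b - a) z n.
  by rewrite /S -{1}[a]add0n big_addn.
have vdc : H%:R * cm S ^+ 2 <= 2 * N%:R * (N%:R + H%:R * E).
  rewrite ES; apply: van_der_corput => //.
  - by rewrite H0.
  - by rewrite leq_subLR.
  - by move=> n; rewrite cmodulus_unit_exp.
  - move=> h /andP[h0 hH]; rewrite -/(cor h).
    exact: (le_bigmax_cond _ (fun h : 'I_H => cor h) (j := Ordinal hH)).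
have S2 : cm S ^+ 2 <= 2 * (N%:R ^+ 2 / H%:R + N%:R * E).
  rewrite -(ler_pM2l Hp); apply: (le_trans vdc); rewrite le_eqVlt; apply/orP; left.
  by apply/eqP; field; rewrite gt_eqF.
have -> : (2 ^ m.+1 = 2 * K)%N by rewrite expnS.
rewrite exprM; apply: (@le_trans _ _ ((2 * (N%:R ^+ 2 / H%:R + N%:R * E)) ^+ K)).
  rewrite lerXn2r ?nnegrE ?exprn_ge0 ?cmodulus_ge0//.
  by rewrite mulr_ge0 ?addr_ge0 ?divr_ge0 ?mulr_ge0 ?exprn_ge0.
rewrite exprMn -!mulrA ler_wpM2l ?exprn_ge0//.
apply: (le_trans (exprD_le _ _ _)); rewrite ?divr_ge0 ?mulr_ge0 ?exprn_ge0//.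
rewrite ler_wpM2l ?exprn_ge0// mulrDl mul1r; apply: lerD.
  rewrite mulrA -expr2 expr_div_n -exprM ler_wpM2l ?exprn_ge0//.
  rewrite lef_pV2 ?posrE ?exprn_gt0// -{1}[H%:R]expr1 ler_weXn2l//.
  by rewrite expn_gt0.
rewrite exprMn exprM expr2.
have -> : C * ((N%:R * N%:R) ^+ K / H%:R) = N%:R ^+ K * B.
    by rewrite /B exprMn; ring.
by rewrite ler_wpM2l ?exprn_ge0.
Qed.

End VanDerCorput.
Arguments fdiff {R} f n.

(** * Finite differences against derivatives, and Abel summation *)

Section Differences.
Variable R : realType.
Local Notation cm := (@cmodulus R).

Lemma is_derive_within (f : R -> R) (s : R) : 1 < s ->
  derivable_within (@half_line R) f s ->
  is_derive s 1 f (derive_within (@half_line R) f s).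
Proof.
move=> s1 df; set l := derive_within _ _ _.
have dl : (diff_quotient f s y @[y --> within (@half_line R) s^']) --> l by [].
suff cl : (fun h : R => h^-1 *: ((f \o shift s) (h *: 1) - f s)) @ 0^' --> l.
  by apply: DeriveDef; [apply/cvg_ex; exists l | exact/cvg_lim].
move/cvgrPdist_lt : dl => dl; apply/cvgrPdist_lt => e e0.
have /= := dl _ e0; rewrite !near_withinE => /nbhs_ballP[r /= r0 hr].
near_simpl; apply/nbhs_ballP.
exists (Num.min r (s - 1)); first by rewrite /= lt_min r0 subr_gt0.
move=> h; rewrite /ball/= sub0r normrN lt_min => /andP[hr1 hr2] hn0.
have := hr (h + s); rewrite /ball/= opprD addrCA subrr addr0 normrN => /(_ hr1).
rewrite /diff_quotient addrK => H; rewrite [h%:A]mulr1; apply: H.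
  by apply/eqP => hs; apply/negP/negPn: hn0; apply/eqP; lra.
rewrite /half_line /= in_itv/= andbT.
by move: hr2; rewrite ltr_norml => /andP[]; lra.
Qed.

Lemma is_derive_translate (f : R -> R) (z s l : R) :
  is_derive (s + z) 1 f l -> is_derive s 1 (fun x => f (x + z)) l.
Proof.
move=> df; rewrite -[l]mulr1.
exact: (@is_derive1_comp _ f (fun x => x + z) _ _ _ df (is_derive_shift s 1 z)).
Qed.

(** The family [f] lists a function and its derivatives. The induction replaces each member by its
    unit increment; by the mean value theorem the increment of [f k] is a value of [f k.+1], and the
    interval loses one unit. *)
Lemma iter_fdiff_mvt k (f : nat -> R -> R) (a b lo hi : R) :
  (forall t s, (t < k)%N -> a <= s -> is_derive s 1 (f t) (f t.+1 s)) ->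
  (forall s, a <= s <= b -> lo <= f k s <= hi) ->
  forall n, a <= n%:R -> n%:R + k%:R <= b ->
  lo <= iter k fdiff (fun n => f 0%N n%:R) n <= hi.
Proof.
elim: k f b lo hi => [|k IHk] f b lo hi df hf n an nb.
  by rewrite /=; apply: hf; rewrite an -[leLHS]addr0.
rewrite iterSr.
have -> : fdiff (fun n => f 0%N n%:R) =
    (fun n => (fun t s => f t (s + 1) - f t s) 0%N n%:R).
  by apply/funext => x; rewrite /fdiff natr1.
apply: (IHk (fun t s => f t (s + 1) - f t s) (b - 1)) => //; last first.
  by rewrite -natr1 in nb; lra.
- move=> s /andP[as1 sb].
  have [|||c] := @MVT_segment R (f k) (f k.+1) s (s + 1).
  - lra.
  - move=> x; rewrite in_itv/= => /andP[sx _]; apply: df => //.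
    by rewrite (le_trans as1) ?ltW.
  - apply: derivable_within_continuous => x; rewrite in_itv/= => /andP[sx _].
    by have [] := df k x (ltnSn k) (le_trans as1 sx).
  rewrite in_itv/= => /andP[c1 c2] ->; rewrite addrAC subrr add0r mulr1.
  by apply: hf; lra.
- move=> t s tk as1.
have d1 : is_derive s 1 (fun x => f t (x + 1)) (f t.+1 (s + 1)).
  by apply: is_derive_translate; apply: df; [rewrite ltnW | lra].
have d2 : is_derive s 1 (f t) (f t.+1 s) by apply: df; [rewrite ltnW|].
exact: is_deriveB d1 d2.
Qed.

(** The weight enters only through its last value and its total variation; in [level_corr_far] it is
    an indicator that jumps back and forth. *)
Lemma abel_sum_le (w : nat -> R) (z : nat -> R[i]) (B : R) (a b : nat) :
  (a <= b)%N ->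
  (forall c, (a <= c <= b)%N -> cm (\sum_(a <= n < c) z n) <= B) ->
  cm (\sum_(a <= n < b) (w n)%:C%C * z n) <=
    B * (`|w b| + \sum_(a <= n < b) `|w n.+1 - w n|).
Proof.
move=> ab hB.
have -> : \sum_(a <= n < b) (w n)%:C%C * z n =
   (w b)%:C%C * (\sum_(a <= n < b) z n) -
   \sum_(a <= n < b) (w n.+1 - w n)%:C%C * \sum_(a <= l < n.+1) z l.
  elim: b ab {hB} => [|b IHb ab].
    by rewrite leqn0 => /eqP ->; rewrite !big_geq// mulr0 subr0.
  move: ab; rewrite leq_eqVlt => /predU1P[->|ab].
    by rewrite !big_geq// mulr0 subr0.
  rewrite !(@big_nat_recr _ _ _ b)//= IHb//.
  by rewrite rmorphB/=; ring.
apply: (le_trans (cmodulusB _ _)); rewrite mulrDr; apply: lerD.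
  by rewrite cmodulusM cmodulus_real mulrC ler_wpM2r// hB// ab leqnn.
apply: (le_trans (cmodulus_sum _ _ _)); rewrite mulr_sumr.
rewrite [leLHS]big_nat_cond [leRHS]big_nat_cond.
apply: ler_sum => n /andP[/andP[an nb] _].
rewrite cmodulusM cmodulus_real mulrC ler_wpM2r// hB//.
by rewrite nb andbT ltnW.
Qed.

Lemma abel_sum_nonincreasing (w : nat -> R) (z : nat -> R[i]) (B : R)
    (a b : nat) : (a <= b)%N -> 0 <= w b ->
  (forall n, (a <= n < b)%N -> w n.+1 <= w n) ->
  (forall c, (a <= c <= b)%N -> cm (\sum_(a <= n < c) z n) <= B) ->
  cm (\sum_(a <= n < b) (w n)%:C%C * z n) <= B * w a.
Proof.
move=> ab wb hw hB; apply: le_trans (abel_sum_le _ ab hB) _.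
suff -> : `|w b| + \sum_(a <= n < b) `|w n.+1 - w n| = w a by [].
rewrite ger0_norm// (eq_big_nat _ _ (F2 := fun n => - (w n.+1 - w n))).
  by rewrite sumrN telescope_sumr// opprB addrC subrK.
by move=> n /hw h; rewrite ler0_norm// subr_le0.
Qed.

End Differences.

(** * Correlations of $e(p(n))/n$ at a fixed lag *)

Section Correlation.
Variable R : realType.
Local Notation cm := (@cmodulus R).

Lemma continuous_constant_sign (g : R -> R) :
  {within @half_line R, continuous g} -> (forall s, 1 <= s -> g s != 0) ->
  exists b : bool, forall s, 1 <= s -> (-1) ^+ b * g s = `|g s|.
Proof.
move=> cg g0; exists (g 1 < 0) => s s1.
have [gs|gs|gs] := ltgtP (g s) 0; last by move: (g0 s s1); rewrite gs eqxx.
- case: (ltP (g 1) 0) => g1; first by rewrite expr1 mulN1r ltr0_norm.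
  have [||c] := @IVT R g 1 s 0 s1.
  + apply: continuous_subspaceW cg => x; rewrite /half_line/= !in_itv/= andbT.
    by case/andP.
  + by rewrite ge_min le_max (ltW gs) g1 orbT.
  by rewrite in_itv/= => /andP[c1 _] /eqP; rewrite (negbTE (g0 c c1)).
- case: (ltP (g 1) 0) => g1; last by rewrite expr0 mul1r gtr0_norm.
  have [||c] := @IVT R g 1 s 0 s1.
  + apply: continuous_subspaceW cg => x; rewrite /half_line/= !in_itv/= andbT.
    by case/andP.
  + by rewrite ge_min le_max (ltW gs) (ltW g1) orbT.
  by rewrite in_itv/= => /andP[c1 _] /eqP; rewrite (negbTE (g0 c c1)).
Qed.

Lemma powR_npos_le (x y c : R) : 0 < x -> x <= y -> c <= 0 -> y `^ c <= x `^ c.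
Proof.
move=> x0 xy c0; rewrite -[c]opprK (powRN y) (powRN x).
have y0 := lt_le_trans x0 xy.
rewrite lef_pV2 ?posrE ?powR_gt0//.
have := @ge0_ler_powR R (- c); rewrite oppr_ge0 => /(_ c0 x y).
by rewrite !nnegrE; apply; rewrite // ltW.
Qed.

Lemma exists_pow2_powR_ge (d C : R) : 0 < d ->
  exists i0 : nat, forall i, (i0 <= i)%N -> C <= (2 ^+ i) `^ d.
Proof.
move=> d0; pose c := (Num.truncn C).+1.
exists (Num.truncn (c%:R / d)).+1 => i hi.
have h : c%:R <= i%:R * d.
  rewrite -ler_pdivrMr// (le_trans (ltW (truncnS_gt _)))// ler_nat//.
apply: (@le_trans _ _ c%:R); first exact/ltW/truncnS_gt.
apply: (@le_trans _ _ (2 ^+ c)); first by rewrite -natrX ler_nat ltnW// ltn_expl.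
by rewrite -!powR_mulrn// -powRrM ler_powR// ler1n.
Qed.

Lemma unit_exp_sign (b : bool) (I : Type) (s : seq I) (f : I -> R) :
  cm (\sum_(i <- s) unit_exp ((-1) ^+ b * f i)) =
  cm (\sum_(i <- s) unit_exp (f i)).
Proof.
case: b; last by under eq_bigr do rewrite expr0 mul1r.
under eq_bigr do rewrite expr1 mulN1r -conj_unit_exp.
by rewrite -rmorph_sum /= cmodulus_conj.
Qed.

(** The bound [c] on [P2] holds only on $[N, 4N]$, while [z] may be far larger than [N]. The
    increment over the initial piece of length [z'] stays in this range, and the remaining increment
    has the same sign. The upper bound holds because both values of [P1] lie in $[0, U]$. *)
Lemma increment_bounds (P1 P2 : R -> R) (sg : bool) (N c U z z' s : R) :
  1 < N -> (forall s : R, 1 < s -> is_derive s 1 P1 (P2 s)) ->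
  (forall s, 1 <= s -> (-1) ^+ sg * P2 s = `|P2 s|) ->
  (forall s, N <= s -> 0 <= P1 s <= U) ->
  (forall s, N <= s <= 4 * N -> c <= `|P2 s|) ->
  0 <= c -> 0 <= z' <= z -> z' <= N -> N <= s <= 3 * N ->
  c * z' <= (-1) ^+ sg * (P1 (s + z) - P1 s) <= U.
Proof.
move=> N1 dP Hsg PU Pc c0 /andP[z'0 z'z] z'N /andP[Ns sN].
have Pmvt (x h : R) : 1 < x -> 0 <= h ->
    exists2 xi, x <= xi <= x + h & P1 (x + h) - P1 x = P2 xi * h.
  move=> x1 h0.
  have [|||t] := @MVT_segment R P1 P2 x (x + h).
  - by rewrite lerDl.
  - by move=> y; rewrite in_itv/= => /andP[xy _]; apply: dP (lt_trans x1 xy).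
  - apply: derivable_within_continuous => y; rewrite in_itv/= => /andP[xy _].
    by have [] := dP y (lt_le_trans x1 xy).
  by rewrite in_itv/= => cs ->; exists t => //; rewrite [x + h]addrC addrK.
have s1 : 1 < s by apply: lt_le_trans Ns.
apply/andP; split; last first.
  have z0 : 0 <= z := le_trans z'0 z'z.
  have /andP[h1 h2] := PU s Ns.
  have /andP[h3 h4] : 0 <= P1 (s + z) <= U by apply: PU; rewrite ler_wpDr.
  apply: le_trans (_ : `|P1 (s + z) - P1 s| <= _).
    by rewrite (le_trans (ler_norm _))// normrM normr_sign mul1r.
  by rewrite ler_norml; clear - h1 h2 h3 h4; lra.
have zz0 : 0 <= z - z' by rewrite subr_ge0.
have s1' : 1 < s + z' by rewrite ltr_wpDr.
have [c1 /andP[sc1 c1s] e1] := Pmvt s z' s1 z'0.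
have [c2 /andP[sc2 _] e2] := Pmvt (s + z') (z - z') s1' zz0.
have -> : (-1) ^+ sg * (P1 (s + z) - P1 s) = `|P2 c1| * z' + `|P2 c2| * (z - z').
  rewrite -(Hsg c1 (le_trans (ltW s1) sc1)) -(Hsg c2 (le_trans (ltW s1') sc2)).
  rewrite -2!mulrA -e1 -e2 -mulrDr; congr (_ * _).
  have -> : s + z = s + z' + (z - z') by rewrite addrA addrAC addrK.
  by ring.
apply: (@le_trans _ _ (`|P2 c1| * z')); last by rewrite lerDl mulr_ge0.
apply: ler_wpM2r => //; apply: Pc.
by clear - Ns sN z'N sc1 c1s; lra.
Qed.

(** The derivative of order $m+1$ of $p(s+z) - p(s)$ is an increment of $p^{(m+1)}$, which up to
    sign lies between [lam] and [Lam] however large [z] is. This is the input of [m] differencing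
    steps. *)
Lemma correlation_phase (delta M : R) (m : nat) (p : R -> R) :
  0 < delta < 2^-1 -> 1 <= M ->
  hardy_class (fun d _ => d / 16) delta M m p ->
  exists (e : nat) (C : R), [/\ (2 < e)%N, 0 <= C &
  forall i z a b : nat, (2 ^ i <= a <= b)%N -> (b <= 2 ^ i.+1)%N ->
    (2 ^ i <= z * 8 ^ (i %/ e))%N ->
    cm (\sum_(a <= n < b) unit_exp (p (n + z)%:R - p n%:R)) <=
      C * (2 ^+ i / 8 ^+ (i %/ e))].
Proof.
move=> /andP[d0 d12] M1 p_class.
have M0 : 0 < M := lt_le_trans ltr01 M1.
have [_ [Cdiff Ccont] [alpha [eta [/andP[al1 al2] /andP[eta0 eta1] Pbd Pm2bd]]]] :=
  p_class.
pose P t := derive_within_n (@half_line R) t p.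
have dP t (s : R) : (t < m.+2)%N -> 1 < s -> is_derive s 1 (P t) (P t.+1 s).
  move=> tm s1; rewrite /P /derive_within_n iterS; apply: is_derive_within => //.
  by apply: Cdiff => //; rewrite /half_line/= in_itv/= andbT ltW.
have [sg Hsg] : exists b : bool, forall s, 1 <= s ->
    (-1) ^+ b * P m.+2 s = `|P m.+2 s|.
  apply: continuous_constant_sign; first exact: Ccont.
  move=> s s1; have /andP[h _] := Pm2bd s s1; rewrite -normr_gt0.
  by apply: lt_le_trans h; rewrite mulr_gt0 ?invr_gt0// powR_gt0//; lra.
(* [van_der_corput_iter] saves a factor [H] on the [K]-th power of the sum, so [H] has to be
   $8^{\kappa K}$. The largest loss met below is then $H^{m+1} 8^{2\kappa} = 8^{\kappa q}$. *)
pose K := (2 ^ m)%N; pose q := (K * m.+1 + 2)%N.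
have q1 : (K * m <= q)%N by rewrite /q mulnS addnAC leq_addl.
have q2 : (K + 1 <= q)%N.
  by rewrite /q mulnS addnAC (leq_trans _ (leq_addr _ _))// leq_add2l.
have q3 : (K <= q)%N := leq_trans (leq_addr _ _) q2.
(* With $\kappa \le i/e$ this gives $8^{\kappa q} = 2^{3\kappa q} \le (2^i)^{\delta/2}$. *)
pose e := (Num.truncn (6 * q%:R / delta)).+1.
have [Cm Cm0 Hvdc] := van_der_corput_iter R m.
pose Cc := 2 ^+ 18 * M ^+ 3.
have [i1 Hi1] := @exists_pow2_powR_ge (delta / 4) Cc (divr_gt0 d0 (ltr0n R 4)).
pose i0 := (i1 + m.+2)%N.
pose C := (1 + Cm) + 8 ^+ i0.
exists e, C; split; [|by rewrite /C !addr_ge0 ?exprn_ge0|].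
  have h : 6 * q%:R / delta < e%:R := truncnS_gt _.
  rewrite -(ltr_nat R); apply: le_lt_trans h; rewrite ler_pdivlMr//.
  have : 1 <= q%:R :> R by rewrite ler1n addn_gt0 orbT.
  by clear - d0 d12; lra.
move=> i z a b /andP[ia ab] bi iz.
set kap := (i %/ e)%N; set N : R := 2 ^+ i.
have N1 : 1 <= N by rewrite /N exprn_ege1//; lra.
have N0 : 0 < N by lra.
have NE : (2 ^ i)%:R = N by rewrite natrX.
set S := cm _.
have [ii0|i0i] := ltnP i i0.
  have SN : S <= N.
    apply: (le_trans (cmodulus_sum _ _ _)).
    under eq_bigr do rewrite cmodulus_unit_exp.
    rewrite sumr_const_nat -NE ler_nat leq_subLR.
    by apply: (leq_trans bi); rewrite expnS mul2n -addnn leq_add2r.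
  apply: (le_trans SN); rewrite mulrCA ler_peMr ?(ltW N0)//.
  rewrite ler_pdivlMr ?exprn_gt0// mul1r /C.
  have : 8 ^+ kap <= 8 ^+ i0 :> R.
    by rewrite ler_weXn2l ?ler1n// (leq_trans (leq_div _ _))// ltnW.
  by move=> h; lra.
have {Hi1} HQ : Cc <= N `^ (delta / 4).
  by apply: Hi1; rewrite (leq_trans _ i0i)// leq_addr.
have N2 : (m.+2)%:R <= N.
  rewrite -NE ler_nat (leq_trans _ (ltnW (ltn_expl i (ltnSn 1))))//.
  by rewrite (leq_trans _ i0i)// leq_addl.
have N1' : 1 < N by apply: lt_le_trans N2; rewrite ltr1n.
pose H := (8 ^ (kap * K))%N.
pose X : R := 8 ^+ (kap * q).
have X1 : X <= N `^ (delta / 2).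
  have -> : X = 2 `^ ((3 * (kap * q))%:R).
    by rewrite powR_mulrn// exprM /X; congr (_ ^+ _); rewrite -natrX.
  rewrite /N -powR_mulrn// -powRrM ler_powR ?ler1n//.
  have h1 : (kap * e)%:R <= i%:R :> R by rewrite ler_nat leq_trunc_div.
  have h2 : 6 * q%:R / delta <= e%:R by exact/ltW/truncnS_gt.
  rewrite ler_pdivrMr// in h2; rewrite !natrM in h1 *.
  have h3 : 0 <= kap%:R :> R by [].
  nra.
have nX c : (c <= q)%N -> 8 ^+ (kap * c) <= X.
  by move=> cq; rewrite ler_weXn2l ?ler1n// leq_mul2l cq orbT.
pose w := N `^ (1 + eta - alpha); pose D := N `^ (- (delta / 4)).
have D0 : 0 < D by rewrite powR_gt0.
have DC : D * Cc <= 1.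
  by rewrite /D powRN mulrC ler_pdivrMr ?mul1r// powR_gt0.
have Nadd x y : N `^ x * N `^ y = N `^ (x + y).
  by rewrite powRD// (gt_eqF N0) implybT.
have Npow x y : x <= y -> N `^ x <= N `^ y by apply: ler_powR.
have NN : N = N `^ 1 by rewrite powRr1 ?ltW.
have w0 : 0 < w by rewrite powR_gt0.
(* These three inequalities use $\eta \le \delta/16$. Each keeps a factor [D], which beats the
   constant [Cc] at large scales; the tightest is [F3], where $1 + \delta/2 + 3\eta - \alpha \le 1 -
   \delta/4$. *)
have F1 : X * N `^ (alpha + eta - 1) <= D.
  apply: (@le_trans _ _ (N `^ (delta / 2) * N `^ (alpha + eta - 1))).
    by rewrite ler_wpM2r ?powR_ge0.
  by rewrite Nadd Npow//; clear - al1 al2 eta0 eta1 d0 d12; lra.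
have F2 : X * w <= N * D.
  apply: (@le_trans _ _ (N `^ (delta / 2) * w)).
    by rewrite ler_wpM2r ?powR_ge0.
  by rewrite /w /D [X in _ <= X * _]NN !Nadd Npow//; clear - al1 al2 eta0 eta1 d0 d12; lra.
have F3 : X * (N * N `^ (alpha + eta - 2) * (w * w)) <= N * D.
  apply: (@le_trans _ _ (N `^ (delta / 2) * (N * N `^ (alpha + eta - 2) * (w * w)))).
    by rewrite ler_wpM2r ?mulr_ge0 ?powR_ge0// ltW.
  by rewrite /w /D [X in _ * (X * _ * _) <= _]NN [X in _ <= X * _]NN !Nadd Npow//; clear - al1 al2 eta0 eta1 d0 d12; lra.
(* Over a length $N/8^\kappa$ the increment of $p^{(m+1)}$ is at least $M^{-1}(4N)^{\alpha-\eta-2}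
   N/8^\kappa$ in modulus, and the power of 4 is at least $4^{-3} = 1/64$. *)
pose lam := (64 * M * 8 ^+ kap * w)^-1.
pose Lam := M * N `^ (alpha + eta - 1).
pose v := 2 * M * N `^ (alpha + eta - 2).
have k0 : 0 < 8 ^+ kap :> R by rewrite exprn_gt0.
have lam0 : 0 < lam by rewrite invr_gt0 !mulr_gt0.
have HE j : H%:R ^+ j = 8 ^+ (kap * (K * j)) :> R.
  by rewrite /H natrX -exprM mulnA.
have H0 : 0 < H%:R :> R by rewrite ltr0n expn_gt0.
have M3 : 1 <= M ^+ 3 /\ M <= M ^+ 3 by split; rewrite ?exprn_ege1// ler_eXnr.
have Ndelta : N `^ (delta / 2) <= N by rewrite [leRHS]NN Npow//; clear - al1 al2 eta0 eta1 d0 d12; lra.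
have bal1 : H%:R ^+ m * Lam <= 16^-1.
  have h1 : H%:R ^+ m <= X.
    by rewrite HE nX.
  have h2 : H%:R ^+ m * Lam <= M * D.
    rewrite /Lam mulrCA ler_pM2l// (le_trans _ F1)// ler_wpM2r ?powR_ge0//.
  have h3 : Cc >= 16 * M by rewrite /Cc; case: M3; clear - M0; lra.
  have : D * (16 * M) <= 1 by apply: le_trans DC; rewrite ler_pM2l.
  move: h2; clear; lra.
have bal2 : 2 / lam + 16 * N * (H%:R ^+ m * v) / lam ^+ 2 <= N / H%:R.
  rewrite ler_pdivlMr// mulrDl.
  have -> : 2 / lam * H%:R = 128 * M * (H%:R * 8 ^+ kap * w).
    by rewrite /lam invrK; ring.
  have -> : 16 * N * (H%:R ^+ m * v) / lam ^+ 2 * H%:R =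
     2 ^+ 17 * M ^+ 3 * ((H%:R ^+ m.+1 * (8 ^+ kap) ^+ 2) *
        (N * N `^ (alpha + eta - 2) * (w * w))).
    by rewrite -exprVn /lam invrK [H%:R ^+ m.+1]exprS /v; ring.
  have a1 : H%:R * 8 ^+ kap <= X.
    have -> : H%:R * 8 ^+ kap = 8 ^+ (kap * (K + 1)) :> R.
      by rewrite mulnDr muln1 exprD -[H%:R]expr1 HE muln1.
    exact: nX.
  have a2 : H%:R ^+ m.+1 * (8 ^+ kap) ^+ 2 <= X.
    by rewrite HE -exprM -exprD -mulnDr nX.
  have b1 : H%:R * 8 ^+ kap * w <= N * D.
    by apply: le_trans F2; rewrite ler_wpM2r// ltW.
  have b2 : (H%:R ^+ m.+1 * (8 ^+ kap) ^+ 2) *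
        (N * N `^ (alpha + eta - 2) * (w * w)) <= N * D.
    apply: le_trans F3; apply: ler_wpM2r a2.
    by rewrite !mulr_ge0 ?powR_ge0 ?(ltW w0) ?(ltW N0).
  have c1 : 128 * M * (H%:R * 8 ^+ kap * w) <= 128 * M * (N * D).
    by rewrite ler_wpM2l// mulr_ge0// ltW.
  have c2 := ler_wpM2l (mulr_ge0 (exprn_ge0 17 (ler0n R 2)) (exprn_ge0 3 (ltW M0))) b2.
  apply: (le_trans (lerD c1 c2)).
  have c3 : D * (2 ^+ 18 * M ^+ 3) <= 1 by [].
  have c4 : 0 <= N * D by rewrite mulr_ge0 ?ltW.
  have c5 : N * (D * (2 ^+ 18 * M ^+ 3)) <= N * 1 by rewrite ler_pM2l.
  case: M3 c4 c5; clear - N0 D0 M0; nra.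
pose f t (s : R) := (-1) ^+ sg * (P t (s + z%:R) - P t s).
have df t (s : R) : (t < m.+2)%N -> N <= s -> is_derive s 1 (f t) (f t.+1 s).
  move=> tm Ns; have s1 : 1 < s by apply: lt_le_trans Ns.
  have d1 : is_derive s 1 (fun s : R => P t (s + z%:R)) (P t.+1 (s + z%:R)).
    by apply: is_derive_translate; apply: dP => //; rewrite ltr_wpDr.
  exact: (is_deriveZ ((-1) ^+ sg) (is_deriveB d1 (dP t s tm s1))).
have Pm1bd (s : R) : N <= s -> 0 <= P m.+1 s <= Lam.
  move=> Ns; have /andP[h1 h2] := Pbd m.+1 s (leqnn _) (le_trans N1 Ns).
  apply/andP; split.
    by apply: le_trans h1; rewrite mulr_ge0 ?invr_ge0 ?powR_ge0// ltW.
  apply: (le_trans h2); rewrite /Lam ler_pM2l// -natr1.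
  have -> : m%:R + alpha + eta - (m%:R + 1) = alpha + eta - 1 by ring.
  by apply: powR_npos_le => //; clear - al2 eta1 d0; lra.
have Pm2bd' (s : R) : N <= s -> `|P m.+2 s| <= M * N `^ (alpha + eta - 2).
  move=> Ns; have /andP[_ h2] := Pm2bd s (le_trans N1 Ns).
  by apply: (le_trans h2); rewrite ler_pM2l//; apply: powR_npos_le => //; clear - al2 eta1 d0; lra.
have z0 : 0 <= z%:R :> R by [].
have fm1 (s : R) : N <= s <= 3 * N -> lam <= f m.+1 s <= Lam.
  pose z' := minn z (2 ^ i).
  have Nz' : N / 8 ^+ kap <= z'%:R.
    rewrite ler_pdivrMr// -NE -natrX -natrM ler_nat /z' minnMl leq_min iz.
    by rewrite leq_pmulr ?expn_gt0.
  pose c := M^-1 * (64^-1 * N `^ (alpha - eta - 2)).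
  have c0 : 0 <= c by rewrite /c !mulr_ge0 ?invr_ge0 ?powR_ge0// ltW.
  move=> hs; have /andP[h1 h2] : c * z'%:R <= f m.+1 s <= Lam.
    apply: (@increment_bounds (P m.+1) (P m.+2) sg N c Lam z%:R z'%:R s
      N1' _ Hsg Pm1bd _ c0 _ _ hs).
    - by move=> x x1; exact: (@dP m.+1).
    - move=> x /andP[Nx xN].
      have /andP[h1 _] := Pm2bd x (le_trans N1 Nx); apply: le_trans h1.
      rewrite ler_pM2l ?invr_gt0//.
      apply: (@le_trans _ _ ((4 * N) `^ (alpha - eta - 2))); last first.
        apply: powR_npos_le => //; first exact: lt_le_trans Nx.
        by clear - al2 eta0 d0; lra.
      rewrite powRM ?(ltW N0)// ler_wpM2r ?powR_ge0//.
      have -> : 64^-1 = 4 `^ (- 3%:R) :> R by rewrite powR_invn//; field.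
      by apply: ler_powR; [rewrite ler1n | clear - al1 eta1 d0 d12; lra].
    - by rewrite ler0n ler_nat geq_minl.
    - by rewrite -NE ler_nat geq_minr.
  rewrite h2 andbT; apply: le_trans h1.
  have -> : lam = c * (N / 8 ^+ kap).
    have -> : c = M^-1 * (64^-1 * (w^-1 / N)).
      rewrite /c /w -powRN [X in _ / X]NN -powRN Nadd.
      by congr (_ * (_ * _ `^ _)); ring.
    by rewrite /lam; field; rewrite !gt_eqF.
  exact: ler_wpM2l.
have fm2 (s : R) : N <= s <= 3 * N -> - v <= f m.+2 s <= v.
  move=> /andP[Ns sN].
  rewrite -ler_norml normrM normr_sign mul1r (le_trans (ler_normB _ _))//.
  have -> : v = M * N `^ (alpha + eta - 2) + M * N `^ (alpha + eta - 2).
    by rewrite /v; ring.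
  by apply: lerD; apply: Pm2bd' => //; lra.
have nbd (n k : nat) : (a <= n <= b)%N -> (k <= m.+2)%N ->
    N <= n%:R :> R /\ n%:R + k%:R <= 3 * N :> R.
  move=> /andP[an nb] km; split; first by rewrite -NE ler_nat (leq_trans ia).
  have : n%:R <= 2 * N :> R.
    by rewrite -NE -natrM ler_nat (leq_trans nb)// -expnS.
  have : k%:R <= m.+2%:R :> R by rewrite ler_nat.
  by move: N2; lra.
have HS : cm (\sum_(a <= n < b) unit_exp (f 0%N n%:R)) ^+ K <=
    Cm * ((2 ^ i)%:R ^+ K / H%:R).
  apply: (Hvdc lam Lam v H (2 ^ i)%N (fun n => f 0%N n%:R) a b) => //.
  - by rewrite /Lam mulr_ge0 ?powR_ge0 ?ltW.
  - by rewrite /v !mulr_ge0 ?powR_ge0 ?ltW.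
  - rewrite /H expn_gt0/= -(ler_nat R) NE natrX.
    apply: le_trans Ndelta; apply: le_trans X1; exact: nX.
  - rewrite ab/=; apply: (leq_trans bi).
    by rewrite expnS mul2n -addnn leq_add2r.
  - by rewrite NE.
  - move=> n hn; have [h1 h2] := nbd n m.+1 hn (leqnSn _).
    apply: (iter_fdiff_mvt (a := N) (b := 3 * N)) => // t s tm.
    by apply: df; rewrite ltnW.
  - move=> n hn; have [h1 h2] := nbd n m.+2 hn (leqnn _).
    by rewrite ler_norml; apply: (iter_fdiff_mvt (a := N) (b := 3 * N)).
have ES : S = cm (\sum_(a <= n < b) unit_exp (f 0%N n%:R)).
  by rewrite /f unit_exp_sign /S; under eq_bigr do rewrite natrD.
have K0 : (0 < K)%N by rewrite expn_gt0.
(* Comparison of [K]-th powers: $H = (8^\kappa)^K$, and $C \ge 1$ gives $C \le C^K$. *)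
rewrite -(ler_pXn2r K0) ?nnegrE; last 2 first.
- exact: cmodulus_ge0.
- by rewrite mulr_ge0 ?divr_ge0 ?exprn_ge0 ?(ltW N0)// /C !addr_ge0 ?exprn_ge0.
rewrite ES; apply: (le_trans HS).
rewrite NE /H natrX exprM exprMn expr_div_n ler_wpM2r ?divr_ge0 ?exprn_ge0 ?(ltW N0)//.
have C1 : 1 <= C by rewrite /C -!addrA lerDl addr_ge0 ?exprn_ge0.
apply: (@le_trans _ _ C); last by rewrite ler_eXnr.
by rewrite /C addrAC ler_wpDl ?addr_ge0 ?exprn_ge0.
Qed.

Definition modulation (p : R -> R) (n : nat) : R[i] :=
  unit_exp (p n%:R) / n%:R.

Lemma cmodulus_modulation p n : (0 < n)%N -> cm (modulation p n) = n%:R^-1.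
Proof.
move=> n0; rewrite /modulation cmodulusM cmodulus_unit_exp mul1r.
rewrite -(rmorph_nat (real_complex R)) -fmorphV /= cmodulus_real.
by rewrite ger0_norm// invr_ge0.
Qed.

Lemma conj_modulation p n :
  conjc (modulation p n) = unit_exp (- p n%:R) / n%:R.
Proof.
transitivity (conjc (unit_exp (p n%:R)) * conjc n%:R^-1); first exact: rmorphM.
by rewrite conj_unit_exp fmorphV rmorph_nat.
Qed.

Definition decorrelated (a : nat -> R[i]) (e : nat) (C : R) : Prop :=
  forall i j z n0 n1 : nat,
  (2 ^ i <= n0)%N -> (n1 <= 2 ^ i.+1)%N -> (2 ^ j <= n0 + z)%N ->
  (i < j)%N || (2 ^ i <= z * 8 ^ (i %/ e))%N ->
  cm (\sum_(n0 <= n < n1) a n * conjc (a (n + z)%N)) <=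
    C / (2 ^+ j * 8 ^+ (i %/ e)).

Lemma modulation_decorrelated (p : R -> R) :
  admissible (fun d _ => d / 16) p ->
  exists (e : nat) (C : R),
    [/\ (2 < e)%N, 0 <= C & decorrelated (modulation p) e C].
Proof.
move=> [delta [M [m [delta_itv M1 _ p_class]]]].
have [e [C [e0 C0 HC]]] := correlation_phase delta_itv M1 p_class.
exists e, (C + 1); split => //; first by rewrite addr_ge0.
move=> i j z a b ia bi jaz hz; set kap := (i %/ e)%N.
have p2 (k : nat) : 0 < 2 ^+ k :> R by rewrite exprn_gt0.
have p8 (k : nat) : 0 < 8 ^+ k :> R by rewrite exprn_gt0.
have [ab|ba] := leqP a b; last first.
  rewrite big_geq ?(ltnW ba)// cmodulus0.
  by rewrite divr_ge0 ?addr_ge0 ?mulr_ge0 ?exprn_ge0.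
have a0 : (0 < a)%N by apply: leq_trans ia; rewrite expn_gt0.
pose wt n : R := (n%:R * (n + z)%:R)^-1.
have wta : wt a <= (2 ^+ i * 2 ^+ j)^-1.
  rewrite lef_pV2 ?posrE ?mulr_gt0 ?ltr0n ?addn_gt0 ?a0//.
  by rewrite -!natrX -!natrM ler_nat leq_mul.
(* If $2^i \le z 8^\kappa$, [correlation_phase] applies after Abel summation against $1/(n(n+z))$.
   Otherwise $i < j$, and $b \le 2^{i+1} \le 2^j \le a + z$ leaves at most [z] terms, fewer than
   $2^i/8^\kappa$, so that the trivial bound is enough. *)
have [zsmall|zbig] := leqP (2 ^ i) (z * 8 ^ kap).
  have -> : \sum_(a <= n < b) modulation p n * conjc (modulation p (n + z)) =
     \sum_(a <= n < b) (wt n)%:C%C * conjc (unit_exp (p (n + z)%:R - p n%:R)).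
    apply: eq_bigr => n _; rewrite conj_modulation /modulation conj_unit_exp opprB.
    rewrite unit_expD /wt.
    have -> : ((n%:R * (n + z)%:R)^-1)%:C%C = n%:R^-1 / (n + z)%:R :> R[i].
      by rewrite -invfM fmorphV rmorphM !rmorph_nat.
    by ring.
  apply: le_trans (abel_sum_nonincreasing (B := C * (2 ^+ i / 8 ^+ kap)) ab _ _ _) _.
  - by rewrite invr_ge0 mulr_ge0.
  - move=> n /andP[an nb]; rewrite lef_pV2 ?posrE -?natrM ?ltr0n ?muln_gt0 ?addn_gt0//.
      by rewrite ler_nat leq_mul// addSn.
    by rewrite (leq_trans a0 an).
  - move=> c /andP[ac cb]; rewrite -rmorph_sum cmodulus_conj.
    by apply: HC => //; rewrite ?ia ?ac//; exact: leq_trans bi.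
  apply: (@le_trans _ _ (C * (2 ^+ i / 8 ^+ kap) * (2 ^+ i * 2 ^+ j)^-1)).
    by rewrite ler_wpM2l// mulr_ge0// divr_ge0 ?ltW.
  have -> : C * (2 ^+ i / 8 ^+ kap) * (2 ^+ i * 2 ^+ j)^-1 = C / (2 ^+ j * 8 ^+ kap).
    by field; rewrite !gt_eqF.
  by rewrite ler_wpM2r ?lerDl// invr_ge0 mulr_ge0 ?ltW.
have ij : (i < j)%N by case/orP: hz => //; rewrite leqNgt zbig.
have baz : (b - a <= z)%N.
  rewrite leq_subLR; apply: leq_trans jaz; apply: (leq_trans bi).
  by rewrite leq_pexp2l.
apply: (le_trans (cmodulus_sum _ _ _)).
apply: (@le_trans _ _ (\sum_(a <= n < b) (2 ^+ i * 2 ^+ j)^-1)).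
  rewrite [leLHS]big_nat_cond [leRHS]big_nat_cond.
  apply: ler_sum => n /andP[/andP[an nb] _].
  have n0 := leq_trans a0 an.
  rewrite cmodulusM cmodulus_conj !cmodulus_modulation ?addn_gt0 ?n0//.
  rewrite -invfM lef_pV2 ?posrE ?mulr_gt0 ?ltr0n ?addn_gt0 ?n0//.
  rewrite -!natrX -!natrM ler_nat leq_mul//; first exact: leq_trans an.
  by rewrite (leq_trans jaz)// leq_add2r.
rewrite sumr_const_nat -[_ *+ (b - a)]mulr_natl.
have h : (b - a)%:R * 8 ^+ kap <= 2 ^+ i :> R.
  rewrite -!natrX -natrM ler_nat (leq_trans _ (ltnW zbig))// leq_mul2r baz orbT//.
apply: (@le_trans _ _ (1 / (2 ^+ j * 8 ^+ kap))); last first.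
  by rewrite ler_wpM2r ?lerDr// invr_ge0 mulr_ge0 ?ltW.
rewrite ler_pdivlMr ?mulr_gt0//.
have -> : (b - a)%:R / (2 ^+ i * 2 ^+ j) * (2 ^+ j * 8 ^+ kap) =
    (b - a)%:R * 8 ^+ kap / 2 ^+ i :> R by field; rewrite !gt_eqF.
by rewrite ler_pdivrMr// mul1r.
Qed.
End Correlation.

(** * The weak type inequality on the integers *)

Section NatSums.
Variable R : realType.

Lemma ler_sum_nat_cond (a b : nat) (P : pred nat) (F G : nat -> R) :
  (forall n, (a <= n < b)%N -> P n -> F n <= G n) ->
  \sum_(a <= n < b | P n) F n <= \sum_(a <= n < b | P n) G n.
Proof.
move=> FG; rewrite big_nat_cond [leRHS]big_nat_cond.
by apply: ler_sum => n /andP[]; exact: FG.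
Qed.

Lemma sum_nat_subinterval (a a' b b' : nat) (F : nat -> R) :
  (forall n, 0 <= F n) -> (a' <= a)%N -> (b <= b')%N ->
  \sum_(a <= n < b) F n <= \sum_(a' <= n < b') F n.
Proof.
move=> F0 a'a bb'; have [ab|ba] := leqP a b; last first.
  by rewrite big_geq ?(ltnW ba)// sumr_ge0.
rewrite [leRHS](big_cat_nat (n := a))//=; last exact: leq_trans bb'.
rewrite [X in _ + X](big_cat_nat (n := b))//=.
by rewrite ler_wpDl ?sumr_ge0// ler_wpDr ?sumr_ge0.
Qed.

Lemma big_nat_pred1 (V : nmodType) (F : nat -> V) (a b j : nat) :
  (a <= j < b)%N -> \sum_(a <= i < b | i == j) F i = F j.
Proof.
move=> hj; rewrite big_mkcond (bigD1_seq j) ?mem_index_iota ?iota_uniq//= eqxx.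
by rewrite big1 ?addr0// => i /negbTE ->.
Qed.

Lemma dyadic_blocks (V : nmodType) (J : nat) (F : nat -> V) :
  \sum_(1 <= n < 2 ^ J) F n =
  \sum_(0 <= j < J) \sum_(2 ^ j <= n < 2 ^ j.+1) F n.
Proof.
elim: J => [|J IHJ]; first by rewrite !big_geq.
rewrite big_nat_recr//= -IHJ (big_cat_nat (n := (2 ^ J)%N)) ?expn_gt0//=.
by rewrite leq_exp2l.
Qed.

Lemma trunc_log2_itv n j : (2 ^ j <= n < 2 ^ j.+1)%N -> trunc_log 2 n = j.
Proof. exact: trunc_log_eq. Qed.

Lemma trunc_log2_le n : (0 < n)%N ->
  (2 ^ trunc_log 2 n <= n < 2 ^ (trunc_log 2 n).+1)%N.
Proof. by move=> n0; apply: trunc_log_bounds. Qed.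

End NatSums.

(* Scale [2 ^ j] is cut into [2 ^ k] cells of length [cell j]; every quantity
   used to truncate the sums is constant on these cells, jointly in the
   summation variable and in the space variable. *)
Section Cells.
Variables (R : realType) (a : nat -> R[i]) (k J : nat) (g : nat -> nat -> R[i]).
Local Notation cm := (@cmodulus R).
Local Notation lg := (trunc_log 2).

(** For [j < k] truncated subtraction makes the cells single points; the functions [g j] will vanish
    at these scales. *)
Definition cell j := (2 ^ (j - k))%N.

Definition cell_mass j q : R :=
  \sum_(q * cell j <= y < q.+1 * cell j) cm (g j y).

(* This is constant for [n] in a cell, and its sum over the cell
   dominates that of [cm (a n) * cm (g (lg n) (x + n))], because [x + n] then
   stays in two adjacent cells. *)
Definition cell_density n x : R :=
  let L := cell (lg n) in
  (cell_mass (lg n) (x %/ L + n %/ L) + cell_mass (lg n) (x %/ L + n %/ L).+1) /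
  (2 ^ lg n * L)%:R.

Definition cell_start n := (n %/ cell (lg n) * cell (lg n))%N.

(** The sum starts at the left end of the cell of [n], so that it depends on [n] only through its
    cell. *)
Definition tail_mass n x : R :=
  \sum_(cell_start n <= n' < 2 ^ J) cell_density n' x.

(** Since the level is nonincreasing in [n], the indices from any [N] on form full level sets and a
    part of one more. *)
Definition level T n x : nat := Num.truncn (T%:R * tail_mass n x).

Definition level_sum T c x : R[i] :=
  \sum_(1 <= n < 2 ^ J | level T n x == c) a n * g (lg n) (x + n).

Lemma cell_gt0 j : (0 < cell j)%N. Proof. by rewrite expn_gt0. Qed.

Lemma cell_dvd j : (cell j %| 2 ^ j)%N.
Proof. by rewrite dvdn_exp2l// leq_subr. Qed.

Lemma cell_dvd_le i j : (i <= j)%N -> (cell i %| cell j)%N.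
Proof. by move=> ij; rewrite dvdn_exp2l// leq_sub2r. Qed.

Lemma cell_start_le n : (cell_start n <= n)%N.
Proof. exact: leq_trunc_div. Qed.

Lemma cell_start_ge n : (0 < n)%N -> (2 ^ lg n <= cell_start n)%N.
Proof.
move=> /trunc_log2_le/andP[h _]; rewrite /cell_start.
by rewrite -{1}(divnK (cell_dvd (lg n))) leq_mul2r leq_div2r ?orbT.
Qed.

Lemma cell_start_gt0 n : (0 < n)%N -> (0 < cell_start n)%N.
Proof. by move=> n0; apply: leq_trans (cell_start_ge n0); rewrite expn_gt0. Qed.

Lemma lt_cell_end n : (n < cell_start n + cell (lg n))%N.
Proof. by rewrite /cell_start -mulSnr ltn_ceil// cell_gt0. Qed.

Lemma cell_end_le n : (0 < n)%N -> (cell_start n + cell (lg n) <= 2 ^ (lg n).+1)%N.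
Proof.
move=> /trunc_log2_le/andP[_ h]; rewrite /cell_start -mulSnr.
have dv : (cell (lg n) %| 2 ^ (lg n).+1)%N.
  by rewrite (dvdn_trans (cell_dvd _))// expnS dvdn_mull.
by rewrite -(divnK dv) leq_mul2r ltn_divLR ?cell_gt0// divnK// h orbT.
Qed.

Lemma lg_in_cell n n' : (0 < n)%N ->
  (cell_start n <= n' < cell_start n + cell (lg n))%N -> lg n' = lg n.
Proof.
move=> n0 /andP[h1 h2]; apply: trunc_log2_itv.
by rewrite (leq_trans (cell_start_ge n0) h1) (leq_trans h2 (cell_end_le n0)).
Qed.

Lemma cell_start_in_cell n n' : (0 < n)%N ->
  (cell_start n <= n' < cell_start n + cell (lg n))%N ->
  cell_start n' = cell_start n.
Proof.
move=> n0 h; rewrite /cell_start (lg_in_cell n0 h); congr (_ * _)%N.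
move: h => /andP[]; rewrite /cell_start -mulSnr => h1 h2.
by apply/eqP; rewrite eqn_leq -ltnS ltn_divLR ?cell_gt0// h2 leq_divRL ?cell_gt0.
Qed.

Lemma cell_start_next n : (0 < n)%N ->
  cell_start (cell_start n + cell (lg n)) = (cell_start n + cell (lg n))%N.
Proof.
move=> n0; set n' := (_ + _)%N.
have : (n' <= 2 ^ (lg n).+1)%N by exact: cell_end_le.
have n'ge : (2 ^ lg n <= n')%N.
  by rewrite (leq_trans (cell_start_ge n0))// leq_addr.
(* A cell that ends its block is followed by a cell of the next scale, whose length also divides
   that power of 2. *)
rewrite leq_eqVlt => /predU1P[e|h].
  rewrite {1}/cell_start e trunc_expnK// divnK//; exact: cell_dvd.
rewrite {1}/cell_start (@trunc_log2_itv n' (lg n)) ?n'ge//.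
by rewrite /n' /cell_start -mulSnr mulnK ?cell_gt0.
Qed.

Lemma cell_start_id n : (0 < n)%N -> cell_start (cell_start n) = cell_start n.
Proof.
by move=> n0; apply: cell_start_in_cell; rewrite // leqnn -addn1 leq_add2l cell_gt0.
Qed.

Lemma leq_cell_start n n' : (0 < n)%N -> (n <= n')%N ->
  (cell_start n <= cell_start n')%N.
Proof.
move=> n0 nn'; have n'0 := leq_trans n0 nn'.
have := leq_trunc_log 2 nn'; rewrite leq_eqVlt => /predU1P[e|h].
  by rewrite /cell_start -e leq_mul2r leq_div2r ?orbT.
apply: (leq_trans (cell_start_le n)); apply: leq_trans (cell_start_ge n'0).
have /andP[_ /ltnW h1] := trunc_log2_le n0.
by rewrite (leq_trans h1)// leq_exp2l.
Qed.

Lemma cell_mass_ge0 j q : 0 <= cell_mass j q.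
Proof. by apply: sumr_ge0 => y _; exact: cmodulus_ge0. Qed.

Lemma cell_density_ge0 n x : 0 <= cell_density n x.
Proof. by rewrite divr_ge0 ?addr_ge0 ?cell_mass_ge0. Qed.

Lemma tail_mass_ge0 n x : 0 <= tail_mass n x.
Proof. by apply: sumr_ge0 => ? _; exact: cell_density_ge0. Qed.

Lemma tail_mass_nonincreasing n n' x : (0 < n)%N -> (n <= n')%N ->
  tail_mass n' x <= tail_mass n x.
Proof.
move=> n0 nn'; apply: sum_nat_subinterval => //; last exact: leq_cell_start.
by move=> ?; exact: cell_density_ge0.
Qed.

Lemma level_nonincreasing T n n' x : (0 < n)%N -> (n <= n')%N ->
  (level T n' x <= level T n x)%N.
Proof.
move=> n0 nn'; apply: le_truncn; rewrite ler_wpM2l//.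
exact: tail_mass_nonincreasing.
Qed.

Hypothesis g0 : forall j y, (j < k)%N -> g j y = 0.
Hypothesis gmass : forall j q, cell_mass j q <= (cell j)%:R.
Hypothesis a_le : forall n, (0 < n)%N -> cm (a n) <= n%:R^-1.

Lemma sum_cell_density n x : (0 < n)%N ->
  \sum_(cell_start n <= n' < cell_start n + cell (lg n)) cell_density n' x =
  (cell_mass (lg n) (x %/ cell (lg n) + n %/ cell (lg n)) +
   cell_mass (lg n) (x %/ cell (lg n) + n %/ cell (lg n)).+1) / 2 ^+ lg n.
Proof.
move=> n0; set L := cell (lg n).
rewrite (eq_big_nat _ _ (F2 := fun=> (cell_mass (lg n) (x %/ L + n %/ L) +
   cell_mass (lg n) (x %/ L + n %/ L).+1) / (2 ^ lg n * L)%:R)); last first.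
  move=> n' hn'; rewrite /cell_density (lg_in_cell n0 hn') -/L.
  suff -> : (n' %/ L = n %/ L)%N by [].
  have := cell_start_in_cell n0 hn'; rewrite /cell_start (lg_in_cell n0 hn').
  by move/eqP; rewrite eqn_pmul2r ?cell_gt0// => /eqP.
rewrite sumr_const_nat addKn -[_ *+ L]mulr_natl natrM natrX.
have L0 : L%:R != 0 :> R by rewrite pnatr_eq0 -lt0n cell_gt0.
by field; rewrite L0 expf_neq0.
Qed.

(** Two cells of mass at most $2^{j-k}$ each, against the weight $2^{-j}$. *)
Lemma sum_cell_density_le n x : (0 < n)%N ->
  \sum_(cell_start n <= n' < cell_start n + cell (lg n)) cell_density n' x
  <= 2 / 2 ^+ k.
Proof.
move=> n0; rewrite sum_cell_density//.
have [kn|nk] := leqP k (lg n); last first.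
  rewrite /cell_mass !big1 ?addr0 ?mul0r ?divr_ge0 ?exprn_ge0// => y _;
  by rewrite g0// cmodulus0.
rewrite ler_pdivrMr ?exprn_gt0//.
apply: (le_trans (lerD (gmass _ _) (gmass _ _))).
have -> : 2 ^+ lg n = 2 ^+ k * 2 ^+ (lg n - k) :> R by rewrite -exprD subnKC.
rewrite /cell natrX le_eqVlt; apply/orP; left; apply/eqP.
by field; rewrite expf_neq0.
Qed.

Lemma sum_cell_le n x : (0 < n)%N ->
  \sum_(cell_start n <= n' < cell_start n + cell (lg n))
    cm (a n') * cm (g (lg n') (x + n')) <=
  \sum_(cell_start n <= n' < cell_start n + cell (lg n)) cell_density n' x.
Proof.
move=> n0; rewrite sum_cell_density//; set L := cell (lg n).
set q := (x %/ L + n %/ L)%N.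
have L0 : (0 < L)%N := cell_gt0 _.
have -> : cell_mass (lg n) q + cell_mass (lg n) q.+1 =
    \sum_(q * L <= y < q.+2 * L) cm (g (lg n) y).
  by rewrite [RHS](big_cat_nat (n := (q.+1 * L)%N))//= leq_mul2r ?leqnSn ?orbT.
apply: (@le_trans _ _ (\sum_(cell_start n <= n' < cell_start n + L)
   (2 ^+ lg n)^-1 * cm (g (lg n) (x + n')))).
  apply: ler_sum_nat_cond => n' hn' _; rewrite (lg_in_cell n0 hn').
  have /andP[h1 h2] := hn'.
  have n'0 : (0 < n')%N := leq_trans (cell_start_gt0 n0) h1.
  rewrite ler_wpM2r ?cmodulus_ge0// (le_trans (a_le n'0))//.
  rewrite lef_pV2 ?posrE ?ltr0n ?exprn_gt0// -natrX ler_nat.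
  exact: leq_trans (cell_start_ge n0) h1.
rewrite -mulr_sumr mulrC ler_wpM2r ?invr_ge0 ?exprn_ge0//.
have -> : \sum_(cell_start n <= i < cell_start n + L) cm (g (lg n) (x + i)) =
    \sum_(x + cell_start n <= y < x + cell_start n + L) cm (g (lg n) y).
  by rewrite (addnC x) addnAC big_addn addnK; apply: eq_bigr => i _; rewrite addnC.
apply: sum_nat_subinterval => [y||]; first exact: cmodulus_ge0.
  by rewrite /q mulnDl leq_add2r leq_trunc_div.
move: (ltnW (ltn_ceil x L0)).
rewrite /cell_start -/L /q -addn2 !mulnDl mulSn mul2n -addnn => h.
by move: h; move: (x %/ L * L)%N (n %/ L * L)%N => A B; clear; lia.
Qed.
End Cells.

(** * Removing the starting point of a truncated sum *)

Section LevelChain.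
Variables (R : realType) (a : nat -> R[i]) (k J : nat) (g : nat -> nat -> R[i]).
Local Notation cm := (@cmodulus R).
Local Notation lg := (trunc_log 2).
Local Notation cell := (cell k).
Local Notation cell_mass := (cell_mass k g).
Local Notation cell_density := (cell_density k g).
Local Notation cell_start := (cell_start k).
Local Notation tail_mass := (tail_mass k J g).
Local Notation level := (level k J g).
Local Notation level_sum := (level_sum a k J g).
Hypothesis g0 : forall j y, (j < k)%N -> g j y = 0.
Hypothesis gmass : forall j q, cell_mass j q <= (cell j)%:R.
Hypothesis a_le : forall n, (0 < n)%N -> cm (a n) <= n%:R^-1.

Lemma cell_end_le_pow n : (0 < n)%N -> (n < 2 ^ J)%N ->
  (cell_start n + cell (lg n) <= 2 ^ J)%N.
Proof.
move=> n0 nJ; apply: (leq_trans (cell_end_le _ n0)); rewrite leq_exp2l//.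
have /andP[h _] := trunc_log2_le n0.
by rewrite -(ltn_exp2l _ _ (ltnSn 1)) (leq_ltn_trans h).
Qed.

(** Domination by the density is available only after summation over a cell, and a level set is a
    union of cells. The induction removes one cell at a time. *)
Lemma level_sum_le_density T d x n0 : (0 < n0)%N -> cell_start n0 = n0 ->
  \sum_(n0 <= n < 2 ^ J | level T n x == d) cm (a n) * cm (g (lg n) (x + n)) <=
  \sum_(n0 <= n < 2 ^ J | level T n x == d) cell_density n x.
Proof.
have [m] := ubnP (2 ^ J - n0); elim: m n0 => // m IHm n0 hm n00 sn0.
have [n0J|Jn0] := ltnP n0 (2 ^ J); last by rewrite !big_geq.
have hend := cell_end_le_pow n00 n0J; rewrite sn0 in hend.
have n0end : (n0 < n0 + cell (lg n0))%N by rewrite -{1}[n0]addn0 ltn_add2l cell_gt0.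
rewrite (big_cat_nat (n := (n0 + cell (lg n0))%N))//=; last exact: ltnW.
rewrite [leRHS](big_cat_nat (n := (n0 + cell (lg n0))%N))//=; last exact: ltnW.
apply: lerD; last first.
  apply: IHm; last by rewrite -{1}sn0 cell_start_next// sn0.
    rewrite ltnS in hm; apply: leq_trans hm.
    exact: ltn_sub2l.
  by rewrite addn_gt0 n00.
have hlev n : (n0 <= n < n0 + cell (lg n0))%N -> level T n x = level T n0 x.
  move=> hn; rewrite /level /tail_mass.
  rewrite (@cell_start_in_cell k n0 n) ?sn0//.
have [e|ne] := eqVneq (level T n0 x) d.
  have hS (F : nat -> R) : \sum_(n0 <= n < n0 + cell (lg n0) | level T n x == d) F n =
      \sum_(n0 <= n < n0 + cell (lg n0)) F n.
    rewrite big_nat_cond [RHS]big_nat_cond; apply: eq_bigl => n.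
    by case: (boolP (n0 <= n < n0 + _)%N) => //= hn; rewrite hlev// e eqxx.
  rewrite !hS; have := @sum_cell_le R a k g a_le n0 x n00.
  by rewrite sn0.
rewrite big_nat_cond big1.
  by apply: sumr_ge0 => n _; exact: cell_density_ge0.
by move=> n /andP[/hlev -> /eqP h]; rewrite h eqxx in ne.
Qed.

(** Between two indices of the same level the tail mass drops by at most $1/T$. The cell of the last
    index of level [d] is not covered by this drop and adds $2/2^k$. *)
Lemma level_density_le T d x n0 m : (0 < T)%N -> (0 < n0)%N ->
  cell_start n0 = n0 -> level T n0 x = d -> (m <= 2 ^ J)%N ->
  \sum_(n0 <= n < m | level T n x == d) cell_density n x <=
    T%:R^-1 + 2 / 2 ^+ k.
Proof.
move=> T0 n00 sn0 ed; have TR : 0 < T%:R :> R by rewrite ltr0n.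
elim: m => [|m IHm] mJ.
  by rewrite big_geq// addr_ge0 ?divr_ge0 ?invr_ge0 ?exprn_ge0.
have [n0m|mn0] := leqP n0 m; last first.
  by rewrite big_geq// addr_ge0 ?divr_ge0 ?invr_ge0 ?exprn_ge0.
rewrite big_mkcond big_nat_recr//= -big_mkcond /=.
have [em|_] := eqVneq (level T m x) d; last by rewrite addr0 IHm// ltnW.
have m0 := leq_trans n00 n0m.
apply: (@le_trans _ _ (\sum_(n0 <= n < m.+1) cell_density n x)).
  rewrite big_nat_recr//= lerD2r [leLHS]big_mkcond /= ler_sum// => n _.
  by case: ifP => // _; exact: cell_density_ge0.
have n0s : (n0 <= cell_start m)%N by rewrite -{1}sn0 leq_cell_start.
rewrite (big_cat_nat (n := cell_start m))//=; last first.
  exact: leq_trans (cell_start_le _ _) (leqnSn _).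
apply: lerD; last first.
  apply: le_trans (sum_cell_density_le g0 gmass x m0).
  apply: sum_nat_subinterval => //; last exact: lt_cell_end.
  by move=> n; exact: cell_density_ge0.
have e1 : tail_mass n0 x = \sum_(n0 <= n < cell_start m) cell_density n x + tail_mass m x.
  rewrite /tail_mass sn0 -big_cat_nat//.
  exact: leq_trans (cell_start_le _ _) (ltnW mJ).
have -> : \sum_(n0 <= n < cell_start m) cell_density n x =
    tail_mass n0 x - tail_mass m x by rewrite e1 addrK.
rewrite -(ler_pM2l TR) mulfV ?gt_eqF// mulrBr lerBlDr.
have Tn n : 0 <= T%:R * tail_mass n x by rewrite mulr_ge0 ?tail_mass_ge0.
have /andP[_ h1] := truncn_itv (Tn n0); have /andP[h2 _] := truncn_itv (Tn m).
move: ed em h1 h2; rewrite /level => -> ->.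
by rewrite -natr1 => h1 h2; rewrite (le_trans (ltW h1))// addrC lerD2l.
Qed.

(** The indices from [N] on consist of the full level sets below the level [d] of [N] and a part of
    the level set [d], which is estimated by its small mass. The bound on [tail_mass 1 x] ensures
    [d <= C]. *)
Lemma truncated_sum_le T C N x : (0 < T)%N -> (0 < N)%N ->
  T%:R * tail_mass 1 x <= C%:R ->
  cm (\sum_(N <= n < 2 ^ J) a n * g (lg n) (x + n)) <=
  \sum_(0 <= c < C) cm (level_sum T c x) + (T%:R^-1 + 2 / 2 ^+ k).
Proof.
move=> T0 N0 hC; have [JN|NJ] := leqP (2 ^ J) N.
  rewrite big_geq// cmodulus0 addr_ge0 ?addr_ge0 ?invr_ge0 ?divr_ge0 ?exprn_ge0//.
  by apply: sumr_ge0 => ? _; exact: cmodulus_ge0.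
set F := fun n => a n * g (lg n) (x + n); set d := level T N x.
have lev_le n : (N <= n)%N -> (level T n x <= d)%N.
  by move=> Nn; exact: level_nonincreasing.
have dC : (d <= C)%N.
  have h1 : (d <= level T 1 x)%N by exact: level_nonincreasing.
  apply: (leq_trans h1); rewrite /level -(ler_nat R).
  apply: le_trans hC; rewrite truncn_le.
  by rewrite mulr_ge0 ?tail_mass_ge0.
have split : \sum_(N <= n < 2 ^ J) F n =
    \sum_(0 <= c < d) level_sum T c x + \sum_(N <= n < 2 ^ J | level T n x == d) F n.
  have -> : \sum_(0 <= c < d) level_sum T c x =
      \sum_(1 <= n < 2 ^ J | (level T n x < d)%N) F n.
    rewrite /level_sum (exchange_big_dep xpredT)//= [RHS]big_mkcond.
    apply: eq_bigr => n _; case: ltnP => h.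
      rewrite (big_rem (level T n x))/= ?mem_index_iota ?h// eqxx.
      rewrite big_seq_cond big1 ?addr0// => i /andP[].
      rewrite rem_filter ?iota_uniq// mem_filter /= => /andP[/negbTE h1 _].
      by rewrite eq_sym h1.
    rewrite big_nat_cond big1// => c /andP[/andP[_ cd] /eqP e].
    by move: (leq_trans cd h); rewrite e ltnn.
  rewrite (big_cat_nat (n := N) (m := 1))//=; last exact: ltnW.
  rewrite [X in _ = X + _ + _]big_nat_cond [X in _ = X + _ + _]big1 ?add0r.
    rewrite [X in _ = X + _]big_mkcond [X in _ = _ + X]big_mkcond -big_split /=.
    apply: eq_big_nat => n /andP[/lev_le].
    by rewrite leq_eqVlt => /predU1P[->|h]; rewrite ?ltnn ?eqxx ?add0r// h
      (ltn_eqF h) addr0.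
  move=> n /andP[/andP[n0 nN] h]; have := level_nonincreasing k J g T x n0 (ltnW nN).
  by rewrite -/(level T N x) leqNgt h.
rewrite split; apply: (le_trans (cmodulusD _ _)); apply: lerD.
  apply: (le_trans (cmodulus_sum _ _ _)).
  by apply: sum_nat_subinterval => // c; exact: cmodulus_ge0.
apply: (le_trans (cmodulus_sum _ _ _)).
have s0 : (0 < cell_start N)%N by exact: cell_start_gt0.
have ss : cell_start (cell_start N) = cell_start N by exact: cell_start_id.
have levs : level T (cell_start N) x = d by rewrite /d /level /tail_mass ss.
apply: le_trans (level_density_le T0 s0 ss levs (leqnn _)).
apply: le_trans (level_sum_le_density T d x s0 ss).
rewrite [leRHS](big_cat_nat (n := N))//=; [|exact: cell_start_le|exact: ltnW].
under [leLHS]eq_bigr do rewrite cmodulusM.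
by rewrite lerDr sumr_ge0// => n _; rewrite mulr_ge0 ?cmodulus_ge0.
Qed.

End LevelChain.

(** * First moment of the tail mass *)

Section CellMoments.
Variables (R : realType) (k J W : nat) (g : nat -> nat -> R[i]).
Local Notation cm := (@cmodulus R).
Local Notation lg := (trunc_log 2).
Hypothesis gW : forall j y, (W <= y)%N -> g j y = 0.

Lemma sum_divn_range (V : nmodType) (F : nat -> V) (L Q : nat) : (0 < L)%N ->
  \sum_(0 <= x < Q * L) F (x %/ L)%N = (\sum_(0 <= q < Q) F q) *+ L.
Proof.
move=> L0; elim: Q => [|Q IHQ]; first by rewrite !big_geq// mul0rn.
rewrite (big_cat_nat (n := (Q * L)%N))//=; last by rewrite leq_mul2r leqnSn orbT.
rewrite IHQ big_nat_recr//= mulrnDl; congr (_ + _).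
rewrite (eq_big_nat _ _ (F2 := fun=> F Q)); last first.
  move=> x /andP[h1 h2]; congr F; apply/eqP.
  by rewrite eqn_leq -ltnS ltn_divLR// h2 leq_divRL.
by rewrite sumr_const_nat mulSn addnK.
Qed.

Lemma sum_consecutive (V : nmodType) (F : nat -> V) (L v Q : nat) :
  \sum_(0 <= q < Q) \sum_((q + v) * L <= y < (q + v).+1 * L) F y =
  \sum_(v * L <= y < (Q + v) * L) F y.
Proof.
elim: Q => [|Q IHQ]; first by rewrite add0n !big_geq.
rewrite big_nat_recr//= IHQ addSn -big_cat_nat//=.
  by rewrite leq_mul2r leq_addl orbT.
by rewrite leq_mul2r leqnSn orbT.
Qed.

Lemma sum_le_supp (a b : nat) (F : nat -> R) :
  (forall y, 0 <= F y) -> (forall y, (W <= y)%N -> F y = 0) ->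
  \sum_(a <= y < b) F y <= \sum_(0 <= y < W) F y.
Proof.
move=> F0 FW; apply: (@le_trans _ _ (\sum_(0 <= y < maxn W b) F y)).
  by apply: sum_nat_subinterval => //; rewrite leq_maxr.
rewrite (big_cat_nat (n := W)) ?leq_maxl//= [X in _ + X]big_nat_cond.
by rewrite [X in _ + X]big1 ?addr0// => y /andP[/andP[/FW]].
Qed.

Lemma sum_cell_mass_le j v :
  \sum_(0 <= x < W) cell_mass k g j (x %/ cell k j + v) <=
  (cell k j)%:R * \sum_(0 <= y < W) cm (g j y).
Proof.
have L0 : (0 < cell k j)%N := cell_gt0 _ _.
apply: (@le_trans _ _
    (\sum_(0 <= x < W * cell k j) cell_mass k g j (x %/ cell k j + v))).
  apply: sum_nat_subinterval => //; last by rewrite leq_pmulr.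
  by move=> x; exact: cell_mass_ge0.
rewrite (@sum_divn_range _ (fun q => cell_mass k g j (q + v)))//.
rewrite -[_ *+ _]mulr_natl ler_wpM2l// /cell_mass sum_consecutive.
apply: sum_le_supp => y; first exact: cmodulus_ge0.
by move=> Wy; rewrite gW// cmodulus0.
Qed.

(** At scale [j] each of the $2^j$ indices sees two cell masses; summed over [x], each of these is
    at most the cell length times the mass of [g j]. *)
Lemma tail_mass_first_moment :
  \sum_(0 <= x < W) tail_mass k J g 1 x <=
  2 * \sum_(0 <= j < J) \sum_(0 <= y < W) cm (g j y).
Proof.
have -> : \sum_(0 <= x < W) tail_mass k J g 1 x =
    \sum_(0 <= j < J) \sum_(2 ^ j <= n < 2 ^ j.+1) \sum_(0 <= x < W) cell_density k g n x.
  rewrite -(dyadic_blocks J (fun n => \sum_(0 <= x < W) cell_density k g n x)).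
  rewrite [RHS]exchange_big /=; apply: eq_bigr => x _.
  by rewrite /tail_mass /cell_start trunc_log1 /cell sub0n expn0 divn1 muln1.
rewrite mulr_sumr; apply: ler_sum => j _; set A := \sum_(0 <= y < W) _.
apply: (@le_trans _ _ (\sum_(2 ^ j <= n < 2 ^ j.+1) 2 * A / 2 ^+ j)); last first.
  rewrite sumr_const_nat expnS mul2n -addnn addnK -[_ *+ _]mulr_natl natrX.
  by rewrite mulrC divfK// expf_neq0.
apply: ler_sum_nat_cond => n /trunc_log2_itv hn _.
rewrite /cell_density hn -mulr_suml big_split /=.
under [X in _ + X]eq_bigr do rewrite -addnS.
have L0 : (cell k j)%:R != 0 :> R by rewrite pnatr_eq0 -lt0n cell_gt0.
have -> : 2 * A / 2 ^+ j =
   ((cell k j)%:R * A + (cell k j)%:R * A) / (2 ^ j * cell k j)%:R.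
  by rewrite natrM natrX; field; rewrite L0 expf_neq0.
by rewrite ler_wpM2r ?invr_ge0//; apply: lerD; exact: sum_cell_mass_le.
Qed.

End CellMoments.

(** * Second moment of the level sums *)

Section LevelCorrelation.
Variables (R : realType) (a : nat -> R[i]) (e : nat) (C : R).
Variables (k J W : nat) (g : nat -> nat -> R[i]) (T Cn : nat).
Local Notation cm := (@cmodulus R).
Local Notation lg := (trunc_log 2).
Local Notation cell := (cell k).
Hypothesis C0 : 0 <= C.
Hypothesis a_le : forall n, (0 < n)%N -> cm (a n) <= n%:R^-1.
Hypothesis a_corr : decorrelated a e C.

(** The product of the level indicators of $y - x$ and $y' - x$, summed over the levels below
    [Cn]. *)
Definition same_level y y' x :=
  (level k J g T (y - x) x == level k J g T (y' - x) x) &&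
  (level k J g T (y - x) x < Cn)%N.

Definition block_kernel i x y :=
  if (x <= y)%N && (2 ^ i <= y - x < 2 ^ i.+1)%N then a (y - x) else 0.

Definition level_corr i y j y' :=
  \sum_(0 <= x < W) ((same_level y y' x)%:R)%:C%C *
    (block_kernel i x y * conjc (block_kernel j x y')).

(** All terms of the tail have scale at least that of [n], and cells of larger scales are unions of
    smaller ones; hence the cell of [x] at the scale of [n] determines every density involved. *)
Lemma level_cell n n' x x' : (0 < n)%N -> lg n = lg n' ->
  cell_start k n = cell_start k n' -> (x %/ cell (lg n) = x' %/ cell (lg n))%N ->
  level k J g T n x = level k J g T n' x'.
Proof.
move=> n0 en es ex; rewrite /level /tail_mass -es; congr (Num.truncn (_ * _)).
apply: eq_big_nat => m /andP[nm _].
have nm' : (lg n <= lg m)%N.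
  rewrite -(@trunc_log2_itv (cell_start k n) (lg n)).
    exact: leq_trunc_log.
  rewrite cell_start_ge//= (leq_ltn_trans (cell_start_le _ _))//.
  by have /andP[] := trunc_log2_le n0.
have e1 : (x %/ cell (lg m) = x' %/ cell (lg m))%N.
  by rewrite -(divnK (cell_dvd_le k nm')) mulnC !divnMA ex.
by rewrite /cell_density e1.
Qed.

Lemma sum_dvdn_le (L M c n0 n1 : nat) : (0 < L)%N -> (n1 <= n0 + M * L)%N ->
  \sum_(n0 <= n < n1) (L %| n.+1 + c)%:R <= M.+1%:R :> R.
Proof.
move=> L0 n1M; have [n10|n01] := leqP n1 n0; first by rewrite big_geq.
have e1 m : (n0 <= m)%N -> ((n0 + c) %/ L)%:R + \sum_(n0 <= n < m) (L %| n.+1 + c)%:R =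
   ((m + c) %/ L)%:R :> R.
  move=> /subnK <-; elim: (m - n0)%N => [|d IHd].
    by rewrite add0n big_geq// addr0.
  rewrite addSn big_nat_recr ?leq_addl//= addrA IHd -natrD !addSn.
  by rewrite divnS// addnC.
have := e1 n1 (ltnW n01) => e2.
rewrite -(lerD2l ((n0 + c) %/ L)%:R) e2 -natrD ler_nat.
have h : (n1 + c <= M * L + (n0 + c))%N by rewrite addnA leq_add2r addnC.
apply: (leq_trans (leq_div2r L h)); rewrite divnMDl//.
by rewrite addnS addnC leqnSn.
Qed.

Lemma big_nat_supp (V : nmodType) (F : nat -> V) (n0 n1 m : nat) :
  (n1 <= m)%N -> (forall n, (n < m)%N -> ~~ (n0 <= n < n1)%N -> F n = 0) ->
  \sum_(0 <= n < m) F n = \sum_(n0 <= n < n1) F n.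
Proof.
move=> n1m F0; have [n10|n01] := leqP n1 n0.
  rewrite [RHS]big_geq// big_nat_cond big1// => n /andP[/andP[_ nm] _].
  by apply: F0 => //; apply/negP => /andP[h1 h2]; rewrite ltnNge (leq_trans n10 h1) in h2.
rewrite (big_cat_nat (n := n0))//=; last exact: leq_trans (ltnW n01) n1m.
rewrite [X in X + _]big_nat_cond [X in X + _]big1 ?add0r; last first.
  move=> n /andP[/andP[_ nn0] _]; apply: F0; last by rewrite leqNgt nn0.
  exact: leq_trans (leq_trans nn0 (ltnW n01)) n1m.
rewrite (big_cat_nat (n := n1))//=; last exact: ltnW.
rewrite [X in _ + X]big_nat_cond [X in _ + X]big1 ?addr0//.
move=> n /andP[/andP[n1n nm] _]; apply: F0 => //.
by rewrite negb_and -!leqNgt n1n orbT.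
Qed.

(** In the variable $n = y - x$ this is a correlation of [a] at lag [z] over an interval, weighted
    by [same_level]. The weight changes only where $n$, $n+z$ or $y-n$ crosses a cell boundary, at
    most $2^k + 1$ times each. With one jump at the cut [n1] the variation is at most $3(2^k+1) + 1
    \le 7 \cdot 2^k$. *)
Lemma level_corr_far i j y y' : (i <= j)%N -> (y <= y')%N -> (y < W)%N ->
  (k <= i %/ e)%N -> (i < j)%N || (cell j <= y' - y)%N ->
  cm (level_corr i y j y') <= 7 * 2 ^+ k * (C / (2 ^+ j * 8 ^+ (i %/ e))).
Proof.
move=> ij yy' yW ke far; set z := (y' - y)%N.
have ki : (k <= i)%N := leq_trans ke (leq_div _ _).
set B := C / _; have B0 : 0 <= B by rewrite divr_ge0 ?mulr_ge0 ?exprn_ge0.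
pose n0 := maxn (2 ^ i) (2 ^ j - z).
pose n1 := minn (minn (2 ^ i.+1) (2 ^ j.+1 - z)) y.+1.
(* The value 0 from [n1] on kills the boundary term of [abel_sum_le] at the price of one jump. *)
pose w n : R := if (n < n1)%N then (same_level y y' (y - n))%:R else 0.
have n1y : (n1 <= y.+1)%N by rewrite geq_minr.
have n1i : (n1 <= 2 ^ i.+1)%N.
  by rewrite (leq_trans (geq_minl _ _))// geq_minl.
have n1j : (n1 <= 2 ^ j.+1 - z)%N.
  by rewrite (leq_trans (geq_minl _ _))// geq_minr.
have n0i : (2 ^ i <= n0)%N by rewrite leq_maxl.
have n0j : (2 ^ j <= n0 + z)%N by rewrite addnC -leq_subLR leq_maxr.
have nin n : (n0 <= n < n1)%N -> [/\ (n <= y)%N, (2 ^ i <= n < 2 ^ i.+1)%N &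
   (2 ^ j <= n + z < 2 ^ j.+1)%N].
  move=> /andP[h1 h2]; split.
  - by rewrite -ltnS (leq_trans h2).
  - by rewrite (leq_trans n0i h1) (leq_trans h2 n1i).
  - rewrite (leq_trans n0j) ?leq_add2r//= addnC -ltn_subRL.
    exact: leq_trans h2 n1j.
have -> : level_corr i y j y' =
    \sum_(n0 <= n < n1) (w n)%:C%C * (a n * conjc (a (n + z)%N)).
  rewrite /level_corr (@big_nat_supp _ _ 0 y.+1)//; last first.
    move=> x _; rewrite /= ltnS -ltnNge => yx.
    by rewrite /block_kernel leqNgt yx /= mul0r mulr0.
  rewrite big_nat_rev /= add0n (@big_nat_supp _ _ n0 n1)//.
    apply: eq_big_nat => n hn; have [ny hi hj] := nin n hn.
    have /andP[_ nn1] := hn; rewrite /w nn1 subSS.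
    have e1 : (y - (y - n) = n)%N by rewrite subKn.
    have e2 : (y' - (y - n) = n + z)%N by rewrite subnBA// /z addnC addnBA.
    rewrite /block_kernel e1 e2 hi hj leq_subr/=.
    by rewrite (leq_trans (leq_subr _ _) yy').
  move=> n; rewrite ltnS => ny hn; rewrite subSS.
  have e1 : (y - (y - n) = n)%N by rewrite subKn.
  have e2 : (y' - (y - n) = n + z)%N by rewrite subnBA// /z addnC addnBA.
  rewrite /block_kernel e1 e2 leq_subr (leq_trans (leq_subr _ _) yy')/=.
  case: ifP => h1; last by rewrite mul0r mulr0.
  case: ifP => h2; last by rewrite conjc0 !mulr0.
  exfalso; move/negP: hn; apply; case/andP: h1 => h1 h1'; case/andP: h2 => h2 h2'.
  rewrite /n0 /n1 geq_max !leq_min ltnS h1 h1' ny andbT /=.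
  by rewrite leq_subLR addnC h2/= ltn_subRL addnC.
have [n10|n01] := leqP n1 n0.
  by rewrite big_geq// cmodulus0 !mulr_ge0 ?exprn_ge0.
have Li0 : (0 < cell i)%N := cell_gt0 _ _.
have Lj0 : (0 < cell j)%N := cell_gt0 _ _.
apply: le_trans (abel_sum_le (B := B) w (ltnW n01) _) _.
  move=> c /andP[n0c cn1]; apply: a_corr => //; first exact: leq_trans n1i.
  move: far; case: (ltnP i j) => //= ji; rewrite -/z => far.
  have eij : i = j by apply/eqP; rewrite eqn_leq ij ji.
  (* A lag of at least one cell is long enough for [decorrelated] because $2^k \le 8^{i/e}$. *)
  have -> : (2 ^ i = cell i * 2 ^ k)%N by rewrite /cell -expnD subnK.
  rewrite -eij in far; rewrite leq_mul//.
  by rewrite -[8%N]/(2 ^ 3)%N -expnM leq_exp2l// (leq_trans ke)// leq_pmull.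
have w1 : `|w n1| = 0 by rewrite /w ltnn normr0.
rewrite w1 add0r mulrC ler_wpM2r//.
(* A natural number congruent to $-(y+1)$ modulo [cell i]: for $n \le y$, [cell i] divides
   [n.+1 + c1] exactly when it divides [y - n], where the cell of [x] changes. Cell boundaries of
   scale [j] are among those of scale [i]. *)
pose c1 := (y * (cell i).-1 + (cell i).-1)%N.
apply: (@le_trans _ _ (\sum_(n0 <= n < n1) ((cell i %| n.+1 + 0)%:R +
    (cell j %| n.+1 + z)%:R + (cell i %| n.+1 + c1)%:R + (n.+1 == n1)%:R))).
  apply: ler_sum_nat_cond => n hn _; rewrite addn0.
  have [nn1|] := ltnP n.+1 n1; last first.
    move=> nn1; have /andP[_ nn1'] := hn.
    have -> : n.+1 == n1 by rewrite eqn_leq nn1 nn1'.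
    rewrite ler_wpDl ?addr_ge0// /w ltnNge nn1 nn1' /= sub0r normrN.
    by case: same_level; rewrite ?normr1 ?normr0.
  have hn1 : (n0 <= n.+1 < n1)%N by rewrite nn1; case/andP: hn => /leqW ->.
  have [ny hi hj] := nin n hn; have [ny1 hi1 hj1] := nin _ hn1.
  have nz0 : (0 < n)%N by case/andP: hi => h _; apply: leq_trans h; rewrite expn_gt0.
  have nzz0 : (0 < n + z)%N by rewrite addn_gt0 nz0.
  rewrite /w nn1 (ltnW nn1) (ltn_eqF nn1) addr0.
  case: (boolP (cell i %| n.+1)%N) => [_|d1].
    rewrite -addrA ler_wpDr ?addr_ge0//.
    by do 2![case: same_level]; rewrite /= ?subrr ?normr0 ?subr0 ?sub0r ?normrN ?normr1.
  case: (boolP (cell j %| n.+1 + z)%N) => [_|d2].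
    rewrite add0r ler_wpDr//.
    by do 2![case: same_level]; rewrite /= ?subrr ?normr0 ?subr0 ?sub0r ?normrN ?normr1.
  case: (boolP (cell i %| n.+1 + c1)%N) => [_|d3].
    rewrite !add0r.
    by do 2![case: same_level]; rewrite /= ?subrr ?normr0 ?subr0 ?sub0r ?normrN ?normr1.
  suff -> : same_level y y' (y - n.+1) = same_level y y' (y - n).
    by rewrite subrr normr0 !addr0.
  have d4 : ~~ (cell i %| y - n)%N.
    apply: contra d3 => d4; rewrite -(dvdn_addl _ d4).
    have -> : (n.+1 + c1 + (y - n) = y.+1 * cell i)%N.
      rewrite /c1; move: (cell i) Li0 ny; clear; case=> // l _ ny /=.
      rewrite mulSn mulnS; move: (y * l)%N => yl; lia.
    exact: dvdn_mull.
  have d5 : ~~ (cell j %| y - n)%N.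
    by apply: contra d4; apply: dvdn_trans; exact: cell_dvd_le.
  have yn : (y - n = (y - n.+1).+1)%N by rewrite subnSK.
  have dvS L m : (0 < L)%N -> ~~ (L %| m.+1)%N -> (m.+1 %/ L = m %/ L)%N.
    by move=> L0 /negbTE dv; rewrite divnS// dv.
  have lgn : lg n = i by exact: trunc_log2_itv.
  have lgn1 : lg n.+1 = i by exact: trunc_log2_itv.
  have lgz : lg (n + z) = j by exact: trunc_log2_itv.
  have lgz1 : lg (n + z).+1 = j by rewrite -addSn; exact: trunc_log2_itv.
  have l1 : level k J g T n.+1 (y - n.+1) = level k J g T n (y - n).
    apply: level_cell; rewrite // ?lgn1 ?lgn//.
      by rewrite /cell_start lgn lgn1 dvS.
    by rewrite yn dvS// -yn.
  have l2 : level k J g T (n + z).+1 (y - n.+1) = level k J g T (n + z) (y - n).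
    apply: level_cell; rewrite // ?lgz1 ?lgz//.
      by rewrite /cell_start lgz lgz1 dvS.
    by rewrite yn dvS// -yn.
  have e2 m : (m <= y)%N -> (y' - (y - m) = m + z)%N.
    by move=> my; rewrite subnBA// /z addnC addnBA.
  by rewrite /same_level !subKn// !e2// addSn l1 l2.
rewrite !big_split /=.
have two_i : (2 ^ i = 2 ^ k * cell i)%N by rewrite mulnC -expnD subnK.
have n1n0 : (n1 <= n0 + 2 ^ k * cell i)%N.
  rewrite -two_i (leq_trans n1i)// expnS mul2n -addnn leq_add2r//.
have n1n0j : (n1 <= n0 + 2 ^ k * cell j)%N.
  apply: (leq_trans n1n0); rewrite leq_add2l leq_mul2l; apply/orP; right.
  by rewrite leq_exp2l// leq_sub2r.
have s1 := sum_dvdn_le 0 Li0 n1n0.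
have s2 := sum_dvdn_le z Lj0 n1n0j.
have s3 := sum_dvdn_le c1 Li0 n1n0.
have s4 : \sum_(n0 <= n < n1) (n.+1 == n1)%:R = 1 :> R.
  have n1p : (n1 = n1.-1.+1)%N by rewrite prednK// (leq_trans _ n01).
  rewrite n1p big_nat_recr/=; last by rewrite -ltnS -n1p.
  rewrite eqxx big_nat_cond big1 ?add0r// => n /andP[/andP[_ nn] _].
  by rewrite eqSS (ltn_eqF nn).
apply: (le_trans (lerD (lerD (lerD s1 s2) s3) (lexx _))); rewrite s4.
have p1 : 1 <= 2 ^+ k :> R by rewrite exprn_ege1// ler1n.
rewrite -natr1 natrX; move: p1; move: (2 ^+ k : R) => p p1; lra.
Qed.

Lemma same_levelC y y' x : same_level y' y x = same_level y y' x.
Proof. by rewrite /same_level eq_sym; case: eqP => // ->. Qed.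

Lemma level_corrC i y j y' : cm (level_corr j y' i y) = cm (level_corr i y j y').
Proof.
rewrite -cmodulus_conj /level_corr rmorph_sum; congr cm; apply: eq_bigr => x _.
transitivity (conjc ((same_level y' y x)%:R)%:C%C *
    (conjc (block_kernel j x y') * conjc (conjc (block_kernel i x y)))).
  by rewrite -!rmorphM.
by rewrite conjcK conjc_real same_levelC [X in _ * X]mulrC.
Qed.

(** A contributing [x] satisfies $y - x < 2^{i+1}$ and $y' - x < 2^{j+1}$; if $i < j$, also $y - x <
    2^j \le y' - x$. *)
Lemma level_corr_eq0 i j y y' : (i <= j)%N ->
  ~~ [&& y < y' + 2 ^ j.+1, y' < y + 2 ^ j.+1 & (i < j) ==> (y <= y')]%N ->
  level_corr i y j y' = 0.
Proof.
move=> ij h; rewrite /level_corr big1// => x _; rewrite /block_kernel.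
case: ifP => [/and3P[xy h1 h2]|]; last by rewrite mul0r mulr0.
case: ifP => [/and3P[xy' h1' h2']|]; last by rewrite conjc0 !mulr0.
have le2 : (2 ^ i.+1 <= 2 ^ j.+1)%N by rewrite leq_exp2l.
exfalso; move/negP: h; apply; apply/and3P; split.
- by move: xy xy' h2 le2; clear; lia.
- by move: xy xy' h2'; clear; lia.
- apply/implyP => ij'; have : (2 ^ i.+1 <= 2 ^ j)%N by rewrite leq_exp2l.
  by move: xy xy' h2 h1'; clear; lia.
Qed.

Lemma cmodulus_block_kernel j x y : cm (block_kernel j x y) <=
  if (x <= y)%N && (2 ^ j <= y - x < 2 ^ j.+1)%N then (2 ^+ j)^-1 else 0.
Proof.
rewrite /block_kernel; case: ifP => [/and3P[_ h _]|_]; last by rewrite cmodulus0.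
have y0 : (0 < y - x)%N by apply: leq_trans h; rewrite expn_gt0.
apply: (le_trans (a_le y0)).
by rewrite lef_pV2 ?posrE ?ltr0n ?exprn_gt0// -natrX ler_nat.
Qed.

Lemma level_corr_trivial j y y' : cm (level_corr j y j y') <= (2 ^+ j)^-1.
Proof.
apply: (le_trans (cmodulus_sum _ _ _)).
apply: (@le_trans _ _ (\sum_(y.+1 - 2 ^ j.+1 <= x < y.+1 - 2 ^ j) (2 ^+ j)^-1 ^+ 2)).
  set G := fun x => if (y.+1 - 2 ^ j.+1 <= x < y.+1 - 2 ^ j)%N then (2 ^+ j)^-1 ^+ 2 else 0 : R.
  have p0 : 0 <= (2 ^+ j)^-1 :> R by rewrite invr_ge0 exprn_ge0.
  apply: (@le_trans _ _ (\sum_(0 <= x < maxn W (y.+1 - 2 ^ j)) G x)).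
    apply: (@le_trans _ _ (\sum_(0 <= x < W) G x)); last first.
      apply: sum_nat_subinterval => //; last by rewrite leq_maxl.
      by move=> n; rewrite /G; case: ifP => // _; rewrite exprn_ge0.
    apply: ler_sum => x _; rewrite !cmodulusM cmodulus_conj cmodulus_real.
    apply: (@le_trans _ _ (cm (block_kernel j x y) * cm (block_kernel j x y'))).
      rewrite ler_piMl ?mulr_ge0 ?cmodulus_ge0//.
      by case: same_level; rewrite /= ?normr1 ?normr0.
    have := cmodulus_block_kernel j x y; have := cmodulus_block_kernel j x y'.
    have b0 := cmodulus_ge0 (block_kernel j x y).
    have b0' := cmodulus_ge0 (block_kernel j x y').
    move=> h' h; have {}h' : cm (block_kernel j x y') <= (2 ^+ j)^-1.
      by apply: (le_trans h'); case: ifP.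
    move: h; case: ifP => [/and3P[xy h1 h2] h|_ h].
      rewrite /G ifT; first by rewrite expr2 ler_pM.
      move: xy h1 h2; move: (2 ^ j)%N (2 ^ j.+1)%N; clear; lia.
    have -> : cm (block_kernel j x y) = 0 by apply/le_anti/andP; split.
    by rewrite mul0r /G; case: ifP => // _; rewrite exprn_ge0.
  rewrite (@big_nat_supp _ G (y.+1 - 2 ^ j.+1) (y.+1 - 2 ^ j)) ?leq_maxr//.
    by rewrite /G; apply: ler_sum_nat_cond => n -> _.
  by move=> n _ /negbTE hn; rewrite /G hn.
rewrite sumr_const_nat -[_ *+ _]mulr_natl.
have h : (y.+1 - 2 ^ j - (y.+1 - 2 ^ j.+1))%:R <= 2 ^+ j :> R.
  rewrite -natrX ler_nat expnS; move: (2 ^ j)%N; clear; lia.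
apply: (@le_trans _ _ (2 ^+ j * (2 ^+ j)^-1 ^+ 2)).
  by rewrite ler_wpM2r ?exprn_ge0 ?invr_ge0 ?exprn_ge0.
by rewrite expr2 mulrA mulfV ?mul1r// expf_neq0.
Qed.

(** Pairs of one scale that are closer than a cell get the trivial bound. All others fall under
    [level_corr_far], after an exchange of the two points if $i = j$ and $y' < y$, or are zero. *)
Lemma level_corr_le i j y y' : (i <= j)%N -> (y < W)%N -> (y' < W)%N ->
  (k <= i %/ e)%N ->
  cm (level_corr i y j y') <=
    (if [&& i == j, y < y' + cell j & y' < y + cell j]%N then (2 ^+ j)^-1 else 0) +
    (if (y < y' + 2 ^ j.+1)%N && (y' < y + 2 ^ j.+1)%N
     then 7 * 2 ^+ k * (C / (2 ^+ j * 8 ^+ (i %/ e))) else 0).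
Proof.
move=> ij yW y'W ke; set B := 7 * _ * _.
have B0 : 0 <= B by rewrite !mulr_ge0 ?invr_ge0 ?mulr_ge0 ?exprn_ge0.
have p0 : 0 <= (2 ^+ j)^-1 :> R by rewrite invr_ge0 exprn_ge0.
case: ifP => [/andP[/eqP -> _]|nnear].
  rewrite (le_trans (level_corr_trivial _ _ _))// lerDl.
  by case: ifP.
rewrite add0r; case: (boolP [&& y < y' + 2 ^ j.+1, y' < y + 2 ^ j.+1 &
    (i < j) ==> (y <= y')]%N) => [/and3P[h1 h2 h3]|h]; last first.
  by rewrite (level_corr_eq0 ij h) cmodulus0; case: ifP.
rewrite h1 h2 /=; have [yy'|y'y] := leqP y y'.
  apply: level_corr_far => //; have [//|ji] /= := ltnP i j.
  have eij : i == j by rewrite eqn_leq ij ji.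
  move: nnear; rewrite eij /= => /negbT; rewrite negb_and -!leqNgt.
  have := cell_gt0 k j; move: yy'; clear; lia.
have ji : (j <= i)%N by rewrite leqNgt; apply/negP => hij; rewrite hij/= leqNgt y'y in h3.
have eij : i = j by apply/eqP; rewrite eqn_leq ij ji.
rewrite /B eij -level_corrC -[in X in _ <= X]eij {1 2}eij; apply: level_corr_far => //.
- exact: ltnW.
- by rewrite -eij.
rewrite ltnn /=; move: nnear; rewrite eij eqxx /= => /negbT; rewrite negb_and -!leqNgt.
have := cell_gt0 k j; move: y'y; clear; lia.
Qed.

Hypothesis e0 : (0 < e)%N.
Hypothesis gW : forall j y, (W <= y)%N -> g j y = 0.
Hypothesis ge : forall j y, (j %/ e < k)%N -> g j y = 0.
Hypothesis gdyadic : forall t i q, (i <= t + k)%N ->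
  \sum_(q * 2 ^ t <= y < q.+1 * 2 ^ t) cm (g i y) <= 2 ^+ t.

Lemma sum_near_le t i y' : (i <= t + k)%N ->
  \sum_(0 <= y < W | (y < y' + 2 ^ t)%N && (y' < y + 2 ^ t)%N) cm (g i y) <= 3 * 2 ^+ t.
Proof.
(* Three consecutive dyadic intervals cover the window; if [y'] lies in the interval number 0, then
   [q] is 0 too and they still do. *)
move=> it; set L := (2 ^ t)%N; pose q := (y' %/ L).-1.
have L0 : (0 < L)%N by rewrite expn_gt0.
apply: (@le_trans _ _ (\sum_(q * L <= y < (3 + q) * L) cm (g i y))).
  set G := fun y => if (q * L <= y < (3 + q) * L)%N then cm (g i y) else 0.
  apply: (@le_trans _ _ (\sum_(0 <= y < maxn W ((3 + q) * L)) G y)).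
    apply: (@le_trans _ _ (\sum_(0 <= y < W) G y)); last first.
      apply: sum_nat_subinterval => //; last by rewrite leq_maxl.
      by move=> n; rewrite /G; case: ifP => // _; rewrite cmodulus_ge0.
    rewrite big_mkcond /=; apply: ler_sum => y _; rewrite /G.
    case: ifP => [/andP[h1 h2]|_]; last by case: ifP => // _; rewrite cmodulus_ge0.
    rewrite ifT//.
    have := leq_trunc_div y' L; have := ltn_ceil y' L0.
    rewrite /q; move: h1 h2 L0; case: (y' %/ L)%N => [|v] /=.
      by rewrite mul0n mul1n mulnDl; clear; lia.
    rewrite mulnDl !mulSn; move: (v * L)%N; clear; lia.
  rewrite (@big_nat_supp _ G (q * L) ((3 + q) * L)) ?leq_maxr//.
    by rewrite /G; apply: ler_sum_nat_cond => n -> _.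
  by move=> n _ /negbTE hn; rewrite /G hn.
rewrite -sum_consecutive; apply: (@le_trans _ _ (\sum_(0 <= q' < 3) 2 ^+ t)).
  by apply: ler_sum => q' _; apply: gdyadic.
by rewrite sumr_const_nat subn0 -[_ *+ _]mulr_natl.
Qed.

(** Each quotient occurs [e] times; the induction carries $2/8^Q$ as an upper bound for the rest of
    the geometric series. *)
Lemma sum_geometric_div :
  \sum_(0 <= i < J | (k <= i %/ e)%N) (8 ^+ (i %/ e))^-1 <= 2 * e%:R / 8 ^+ k :> R.
Proof.
pose F q : R := if (k <= q)%N then (8 ^+ q)^-1 else 0.
have F0 q : 0 <= F q by rewrite /F; case: ifP => // _; rewrite invr_ge0 exprn_ge0.
apply: (@le_trans _ _ (\sum_(0 <= i < J * e) F (i %/ e)%N)).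
  rewrite big_mkcond /=; apply: sum_nat_subinterval => //.
    by move=> n; exact: F0.
  by rewrite leq_pmulr.
rewrite sum_divn_range// -[_ *+ e]mulr_natl.
have -> : 2 * e%:R / 8 ^+ k = e%:R * (2 / 8 ^+ k) :> R by ring.
rewrite ler_wpM2l//.
have key Q : \sum_(0 <= q < Q) F q + (if (k <= Q)%N then 2 / 8 ^+ Q else 0) <= 2 / 8 ^+ k.
  elim: Q => [|Q IHQ].
    rewrite big_geq// add0r leqn0; case: eqP => [->//|_].
    by rewrite divr_ge0 ?exprn_ge0.
  rewrite big_nat_recr//= /F.
  have p0 : 0 < (8 ^+ Q)^-1 :> R by rewrite invr_gt0 exprn_gt0.
  move: IHQ; have [kQ|Qk] := leqP k Q.
    rewrite (leqW kQ) exprS invfM; lra.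
  rewrite !addr0; have [kQ1|_] := leqP k Q.+1; last by rewrite addr0.
  have -> : k = Q.+1 by apply/eqP; rewrite eqn_leq kQ1 Qk.
  rewrite big_nat_cond big1 ?add0r// => q /andP[/andP[_ qQ] _].
  by rewrite /F leqNgt (ltn_trans qQ Qk).
by apply: le_trans (key J); rewrite lerDl; case: ifP.
Qed.

(** A row sum as in Schur's test. Close pairs carry mass at most $3 \cdot 2^{j-k}$ against $2^{-j}$.
    For the others the mass in the window is at most $6 \cdot 2^j$, which leaves $42 C\, 2^k
    8^{-(i/e)}$ per scale; the sum over $i/e \ge k$ is at most $84 C e\, 4^{-k}$. *)
Lemma level_corr_row j y' : (y' < W)%N -> (k <= j %/ e)%N ->
  \sum_(0 <= i < J | (i <= j)%N) \sum_(0 <= y < W)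
    cm (g i y) * cm (level_corr i y j y') <= (3 + 84 * C * e%:R) / 2 ^+ k.
Proof.
move=> y'W kj; have kj' : (k <= j)%N := leq_trans kj (leq_div _ _).
have P0 n : 0 < 2 ^+ n :> R by rewrite exprn_gt0.
have P8 n : 0 < 8 ^+ n :> R by rewrite exprn_gt0.
pose N i y := [&& i == j, y < y' + cell j & y' < y + cell j]%N.
pose D y := (y < y' + 2 ^ j.+1)%N && (y' < y + 2 ^ j.+1)%N.
pose B i : R := if (k <= i %/ e)%N then
   7 * 2 ^+ k * (C / (2 ^+ j * 8 ^+ (i %/ e))) else 0.
have B0 i : 0 <= B i.
  by rewrite /B; case: ifP => // _; rewrite !mulr_ge0 ?invr_ge0 ?mulr_ge0 ?exprn_ge0.
apply: (@le_trans _ _ (\sum_(0 <= i < J | (i <= j)%N) \sum_(0 <= y < W)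
    (cm (g i y) * (if N i y then (2 ^+ j)^-1 else 0) +
     cm (g i y) * (if D y then B i else 0)))).
  apply: ler_sum => i ij; apply: ler_sum_nat_cond => y /andP[_ yW] _.
  rewrite -mulrDr; have [ki|ik] := leqP k (i %/ e); last first.
    by rewrite ge// cmodulus0 !mul0r.
  rewrite ler_wpM2l ?cmodulus_ge0// (le_trans (level_corr_le ij yW y'W ki))//.
  by rewrite /B ki.
under eq_bigr do rewrite big_split /=; rewrite big_split /=.
have -> : (3 + 84 * C * e%:R) / 2 ^+ k = 3 / 2 ^+ k + 84 * C * e%:R / 2 ^+ k.
  by rewrite mulrDl.
apply: lerD.
  rewrite big_mkcond /= (eq_bigr (fun i => if i == j then
    \sum_(0 <= y < W | (y < y' + cell j)%N && (y' < y + cell j)%N) cm (g j y) / 2 ^+ j else 0)).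
    rewrite -big_mkcond /=; have [jJ|Jj] := ltnP j J; last first.
      rewrite big_nat_cond big1 ?divr_ge0 ?ltW// => i /andP[/andP[_ iJ] /eqP ij].
      by rewrite ij ltnNge Jj in iJ.
    rewrite big_nat_pred1//.
    rewrite -mulr_suml ler_pdivrMr//.
    have h : (j <= (j - k) + k)%N by rewrite subnK.
    apply: (le_trans (sum_near_le y' h)).
    rewrite -mulrA ler_wpM2l// -[in leRHS](subnK kj') exprD.
    by rewrite mulrCA mulVf ?mulr1// gt_eqF.
  move=> i _; case: (eqVneq i j) => [->|nij]; last first.
    case: ifP => // _; rewrite big1// => y _.
    by rewrite /N (negbTE nij) mulr0.
  rewrite leqnn [RHS]big_mkcond /=; apply: eq_bigr => y _.
  by rewrite /N eqxx /=; case: ifP => //; rewrite mulr0.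
apply: (@le_trans _ _ (\sum_(0 <= i < J | (k <= i %/ e)%N)
   (42 * C * 2 ^+ k) * (8 ^+ (i %/ e))^-1)).
  rewrite [leLHS]big_mkcond [leRHS]big_mkcond /=; apply: ler_sum => i _.
  case: ifP => ij; last first.
    by case: ifP => // _; rewrite !mulr_ge0 ?invr_ge0 ?exprn_ge0.
  have -> : \sum_(0 <= y < W) cm (g i y) * (if D y then B i else 0) =
      B i * \sum_(0 <= y < W | D y) cm (g i y).
    rewrite mulr_sumr [RHS]big_mkcond /=; apply: eq_bigr => y _.
    by rewrite mulrC; case: ifP; rewrite ?mul0r.
  have h : (i <= j.+1 + k)%N by rewrite (leq_trans ij)// addSn (leqW (leq_addr _ _)).
  apply: (le_trans (ler_wpM2l (B0 i) (sum_near_le y' h))).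
  rewrite /B; case: ifP => _; last by rewrite mul0r.
  rewrite exprS le_eqVlt; apply/orP; left; apply/eqP.
  by field; rewrite !gt_eqF.
rewrite -mulr_sumr.
apply: (le_trans (ler_wpM2l _ sum_geometric_div)).
  by rewrite !mulr_ge0 ?exprn_ge0.
have h : 2 ^+ k * (2 * e%:R / 8 ^+ k) <= 2 * e%:R / 2 ^+ k :> R.
  rewrite mulrCA ler_wpM2l ?mulr_ge0//.
  rewrite ler_pdivrMr// mulrC ler_pdivlMr// -expr2 -exprM.
  rewrite (_ : 8 = 2 ^+ 3 :> R); last by rewrite -natrX.
  by rewrite -exprM ler_weXn2l ?ler1n// mulnC leq_mul2r orbT.
have -> : 84 * C * e%:R / 2 ^+ k = 42 * C * (2 * e%:R / 2 ^+ k) by ring.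
by rewrite -[leLHS]mulrA; apply: ler_wpM2l h; rewrite mulr_ge0.
Qed.

Lemma level_sumE c x : level_sum a k J g T c x =
  \sum_(0 <= j < J) \sum_(0 <= y < W)
    (if level k J g T (y - x) x == c then block_kernel j x y * g j y else 0).
Proof.
rewrite /level_sum big_mkcond /= dyadic_blocks; apply: eq_bigr => j _.
set G := fun y => if level k J g T (y - x) x == c then block_kernel j x y * g j y else 0.
transitivity (\sum_(0 <= y < maxn W (x + 2 ^ j.+1)) G y).
  rewrite (@big_nat_supp _ G (2 ^ j + x) (2 ^ j.+1 + x)).
  - rewrite big_addn addnK; apply: eq_big_nat => n hn.
    by rewrite /G /block_kernel addnK leq_addl hn (trunc_log2_itv hn) addnC.
  - by rewrite addnC leq_maxr.
  - move=> y _ hn; rewrite /G /block_kernel.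
    case: ifP => // _; case: ifP => [/and3P[xy h1 h2]|_]; last by rewrite mul0r.
    exfalso; move/negP: hn; apply.
    by move: xy h1 h2; move: (2 ^ j)%N (2 ^ j.+1)%N; clear; lia.
rewrite (@big_nat_supp _ G 0 W) ?leq_maxl// => y _ /=; rewrite -leqNgt => Wy.
by rewrite /G gW// mulr0; case: ifP.
Qed.

(** Expanding the squares and summing over the levels produces [level_corr]. By symmetry it is
    enough to count pairs with $i \le j$ twice, and [level_corr_row] applies to each $(j, y')$. *)
Lemma level_sum_second_moment :
  \sum_(0 <= x < W) \sum_(0 <= c < Cn) cm (level_sum a k J g T c x) ^+ 2 <=
  2 * ((3 + 84 * C * e%:R) / 2 ^+ k) *
    \sum_(0 <= j < J) \sum_(0 <= y < W) cm (g j y).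
Proof.
pose I := [seq (j, y) | j <- index_iota 0 J, y <- index_iota 0 W].
have sumI (V : nmodType) (F : nat -> nat -> V) :
    \sum_(s <- I) F s.1 s.2 = \sum_(0 <= j < J) \sum_(0 <= y < W) F j y.
  by rewrite /I big_allpairs.
pose u (s : nat * nat) := cm (g s.1 s.2).
pose F c x (s : nat * nat) := if level k J g T (s.2 - x) x == c
   then block_kernel s.1 x s.2 * g s.1 s.2 else 0.
pose K x (s s' : nat * nat) := complex.Re (block_kernel s.1 x s.2 * g s.1 s.2 *
   conjc (block_kernel s'.1 x s'.2 * g s'.1 s'.2)).
pose corr (s s' : nat * nat) := level_corr s.1 s.2 s'.1 s'.2.
have step1 : \sum_(0 <= x < W) \sum_(0 <= c < Cn) cm (level_sum a k J g T c x) ^+ 2 =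
    \sum_(s <- I) \sum_(s' <- I) complex.Re (g s.1 s.2 * conjc (g s'.1 s'.2) * corr s s').
  transitivity (\sum_(0 <= x < W) \sum_(s <- I) \sum_(s' <- I)
      (same_level s.2 s'.2 x)%:R * K x s s').
    apply: eq_bigr => x _.
    under eq_bigr => c _ do rewrite level_sumE -(sumI _ (fun j y => F c x (j, y)))
      cmodulus_sqr_sum.
    rewrite exchange_big /=; apply: eq_bigr => s _.
    rewrite exchange_big /=; apply: eq_bigr => s' _.
    rewrite (eq_bigr (fun c => if (c == level k J g T (s.2 - x) x) then
      (if level k J g T (s'.2 - x) x == level k J g T (s.2 - x) x then K x s s' else 0)
      else 0)); last first.
      move=> c _; rewrite /F -!surjective_pairing; case: eqP => [->|h].
        rewrite eqxx; case: ifP => // _; by rewrite conjc0 mulr0.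
      by rewrite mul0r; case: eqP => // h'; case: h.
    rewrite -big_mkcond /= /same_level [X in (X && _)%:R]eq_sym.
    case: eqP => [e1|_]; last by rewrite big1// mul0r.
    have [lC|Cl] := ltnP (level k J g T (s.2 - x) x) Cn; last first.
      rewrite mul0r big_nat_cond big1// => c /andP[/andP[_ cC] /eqP h].
      by rewrite h ltnNge Cl in cC.
    by rewrite mul1r big_nat_pred1.
  rewrite exchange_big /=; apply: eq_bigr => s _.
  rewrite exchange_big /=; apply: eq_bigr => s' _.
  rewrite /corr /level_corr mulr_sumr Re_sum; apply: eq_bigr => x _.
  rewrite /K.
  have -> : conjc (block_kernel s'.1 x s'.2 * g s'.1 s'.2) =
     conjc (block_kernel s'.1 x s'.2) * conjc (g s'.1 s'.2) by exact: rmorphM.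
  have hre (t : R) (z : R[i]) : t * complex.Re z = complex.Re (t%:C%C * z).
    by case: z => z1 z2 /=; rewrite mul0r subr0.
  by rewrite hre; congr complex.Re; ring.
rewrite step1.
apply: (@le_trans _ _ (\sum_(s <- I) \sum_(s' <- I)
   ((if (s.1 <= s'.1)%N then u s * (u s' * cm (corr s s')) else 0) +
    (if (s'.1 <= s.1)%N then u s' * (u s * cm (corr s' s)) else 0)))).
  apply: ler_sum => s _; apply: ler_sum => s' _.
  apply: (le_trans (ler_Re_cmodulus _)).
  rewrite !cmodulusM cmodulus_conj -mulrA.
  have p0 : 0 <= u s * (u s' * cm (corr s s')).
    by rewrite !mulr_ge0 ?cmodulus_ge0.
  have [ss'|/ltnW s's] := leqP s.1 s'.1.
    rewrite lerDl; case: ifP => // _; by rewrite !mulr_ge0 ?cmodulus_ge0.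
  by rewrite s's add0r /corr level_corrC mulrCA.
under eq_bigr do rewrite big_split /=; rewrite big_split /=.
rewrite [X in X + _]exchange_big /= -mulr2n -[_ *+ 2]mulr_natl -mulrA ler_wpM2l//.
rewrite -(sumI _ (fun j y => cm (g j y))) mulr_sumr [leLHS]big_seq_cond [leRHS]big_seq_cond.
apply: ler_sum => s' /andP[/allpairsP[[j y'] [_ hy' es']] _].
rewrite /= mem_index_iota in hy'; rewrite {}es' /=.
have [kj|jk] := leqP k (j %/ e); last first.
  rewrite (ge y' jk) cmodulus0 mulr0 big1// => s _.
  by case: ifP => // _; rewrite /u /= (ge y' jk) cmodulus0 mul0r mulr0.
rewrite (eq_bigr (fun s : nat * nat => u (j, y') * (if (s.1 <= j)%N then
   cm (g s.1 s.2) * cm (level_corr s.1 s.2 j y') else 0))); last first.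
  by move=> s _; case: ifP => _; rewrite ?mulr0// mulrCA.
rewrite -mulr_sumr /u /= mulrC ler_wpM2r ?cmodulus_ge0//.
rewrite (sumI _ (fun i y => if (i <= j)%N then
   cm (g i y) * cm (level_corr i y j y') else 0)).
have /andP[_ y'W] := hy'; apply: le_trans (level_corr_row y'W kj).
rewrite [leRHS]big_mkcond /=; apply: ler_sum => i _.
by case: (i <= j)%N; [exact: lexx | rewrite big1].
Qed.

End LevelCorrelation.

(** * Exceptional set for one offset [k] *)

Section FixedOffset.
Variables (R : realType) (a : nat -> R[i]) (e : nat) (C : R).
Variables (k J W : nat) (g : nat -> nat -> R[i]).
Local Notation cm := (@cmodulus R).
Local Notation lg := (trunc_log 2).
Hypothesis C0 : 0 <= C.
Hypothesis e0 : (0 < e)%N.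
Hypothesis a_le : forall n, (0 < n)%N -> cm (a n) <= n%:R^-1.
Hypothesis a_corr : decorrelated a e C.
Hypothesis gW : forall j y, (W <= y)%N -> g j y = 0.
Hypothesis ge : forall j y, (j %/ e < k)%N -> g j y = 0.
Hypothesis gdyadic : forall t i q, (i <= t + k)%N ->
  \sum_(q * 2 ^ t <= y < q.+1 * 2 ^ t) cm (g i y) <= 2 ^+ t.

Lemma markov_sum (E : pred nat) (F : nat -> R) (c : R) : 0 < c ->
  (forall x, 0 <= F x) -> (forall x, E x -> c <= F x) ->
  \sum_(0 <= x < W) (E x)%:R <= c^-1 * \sum_(0 <= x < W) F x.
Proof.
move=> c0 F0 EF; rewrite mulr_sumr; apply: ler_sum => x _.
case: (boolP (E x)) => [/EF h|_]; last by rewrite mulr_ge0 ?invr_ge0 ?F0 ?(ltW c0).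
by rewrite mulrC ler_pdivlMr// mul1r.
Qed.

(** Off [E1] the $4^\kappa$ levels of width $2^{-\kappa}$ suffice. Off [E2] Cauchy-Schwarz over them
    gives $(4^\kappa 2^{-4\kappa})^{1/2} = 2^{-\kappa}$. Markov's inequality costs $2^{4\kappa}$ for
    [E2], which the second moment $O(2^{-k})$ affords because $5\kappa \le k$. *)
Lemma fixed_offset_bound : exists2 E : pred nat,
  \sum_(0 <= x < W) (E x)%:R <=
    (8 + 168 * C * e%:R) / 2 ^+ (k %/ 8) *
    \sum_(0 <= j < J) \sum_(0 <= y < W) cm (g j y) &
  forall x N, (x < W)%N -> ~~ E x -> (0 < N)%N ->
    cm (\sum_(N <= n < 2 ^ J) a n * g (lg n) (x + n)) <= 4 / 2 ^+ (k %/ 8).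
Proof.
set A := \sum_(0 <= j < J) _; set kap := (k %/ 8)%N.
have P2 n : 0 < 2 ^+ n :> R by rewrite exprn_gt0.
have A0 : 0 <= A.
  by apply: sumr_ge0 => j _; apply: sumr_ge0 => y _; exact: cmodulus_ge0.
have g0 j y : (j < k)%N -> g j y = 0.
  by move=> jk; apply: ge; exact: leq_ltn_trans (leq_div _ _) jk.
have gmass j q : cell_mass k g j q <= (cell k j)%:R.
  by rewrite /cell natrX; apply: gdyadic; rewrite addnC -leq_subLR.
pose T := (2 ^ kap)%N; pose Cn := (4 ^ kap)%N.
have TR : T%:R = 2 ^+ kap :> R by rewrite natrX.
have CnR : Cn%:R = 2 ^+ kap * 2 ^+ kap :> R by rewrite natrX -exprMn -natrM.
pose Q x : R := \sum_(0 <= c < Cn) cm (level_sum a k J g T c x) ^+ 2.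
have Q0 x : 0 <= Q x by apply: sumr_ge0 => c _; rewrite exprn_ge0 ?cmodulus_ge0.
pose E1 x := 2 ^+ kap < tail_mass k J g 1 x.
pose E2 x := (2 ^+ (4 * kap))^-1 < Q x.
have k8 : (8 * kap <= k)%N by rewrite mulnC leq_trunc_div.
exists (fun x => E1 x || E2 x).
  apply: (@le_trans _ _ (\sum_(0 <= x < W) ((E1 x)%:R + (E2 x)%:R))).
    by apply: ler_sum => x _; case: (E1 x); case: (E2 x); rewrite /= ?addr0 ?add0r// lerDl.
  rewrite big_split /=.
  have h1 : \sum_(0 <= x < W) (E1 x)%:R <= (2 ^+ kap)^-1 * (2 * A) :> R.
    apply: (le_trans (markov_sum (F := tail_mass k J g 1) (P2 kap) _ _)).
    - by move=> x; exact: tail_mass_ge0.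
    - by move=> x /ltW.
    by rewrite ler_wpM2l ?invr_ge0 ?exprn_ge0// tail_mass_first_moment.
  have h2 : \sum_(0 <= x < W) (E2 x)%:R <=
      2 ^+ (4 * kap) * (2 * ((3 + 84 * C * e%:R) / 2 ^+ k) * A) :> R.
    have Pi : 0 < (2 ^+ (4 * kap))^-1 :> R by rewrite invr_gt0.
    apply: (le_trans (markov_sum (F := Q) Pi Q0 _)); first by move=> x /ltW.
    rewrite invrK ler_wpM2l ?exprn_ge0//.
    exact: level_sum_second_moment C0 a_le a_corr e0 gW ge gdyadic.
  apply: (le_trans (lerD h1 h2)).
  have K0 : 0 <= 2 * (3 + 84 * C * e%:R) * A by rewrite !mulr_ge0 ?addr_ge0 ?mulr_ge0.
  have h3 : 2 ^+ (4 * kap) / 2 ^+ k <= (2 ^+ kap)^-1 :> R.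
    rewrite ler_pdivrMr// mulrC ler_pdivlMr// -exprD ler_weXn2l ?ler1n//.
    by rewrite (leq_trans _ k8)//; clear; lia.
  have := ler_wpM2l K0 h3.
  have -> : 2 ^+ (4 * kap) * (2 * ((3 + 84 * C * e%:R) / 2 ^+ k) * A) =
     2 * (3 + 84 * C * e%:R) * A * (2 ^+ (4 * kap) / 2 ^+ k) by ring.
  have -> : (8 + 168 * C * e%:R) / 2 ^+ kap * A = (2 ^+ kap)^-1 * (2 * A) +
     2 * (3 + 84 * C * e%:R) * A * (2 ^+ kap)^-1 by ring.
  by move=> h; rewrite lerD2l.
move=> x N xW; rewrite negb_or -!leNgt => /andP[x1 x2] N0.
have hC : T%:R * tail_mass k J g 1 x <= Cn%:R by rewrite TR CnR ler_pM2l.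
have T0 : (0 < T)%N by rewrite expn_gt0.
apply: (le_trans (truncated_sum_le g0 gmass a_le T0 N0 hC)); rewrite TR.
have s1 : \sum_(0 <= c < Cn) cm (level_sum a k J g T c x) <= (2 ^+ kap)^-1.
  have pk : 0 <= (2 ^+ kap)^-1 :> R by rewrite invr_ge0 exprn_ge0.
  rewrite -(@ler_pXn2r _ 2) ?nnegrE//; last first.
    by apply: sumr_ge0 => c _; exact: cmodulus_ge0.
  apply: (le_trans (sum_sqr_le _ _)); rewrite size_iota subn0 -/(Q x).
  apply: (@le_trans _ _ (Cn%:R * (2 ^+ (4 * kap))^-1)); first by rewrite ler_wpM2l.
  rewrite CnR le_eqVlt; apply/orP; left; apply/eqP.
  rewrite mulnC exprM; field; rewrite gt_eqF//.
have s2 : 2 / 2 ^+ k <= 2 / 2 ^+ kap :> R.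
  rewrite ler_pM2l// lef_pV2 ?posrE// ler_weXn2l ?ler1n//.
  by rewrite (leq_trans _ k8)// leq_pmull.
have -> : 4 / 2 ^+ kap = (2 ^+ kap)^-1 + ((2 ^+ kap)^-1 + 2 / 2 ^+ kap) :> R by ring.
by rewrite lerD// lerD2l.
Qed.

End FixedOffset.

(** * Stopping scales of Calderon-Zygmund type *)

Section DyadicStopping.
Variables (R : realType) (f : nat -> R[i]) (W : nat).
Local Notation cm := (@cmodulus R).
Hypothesis fW : forall y, (W <= y)%N -> f y = 0.

Definition dyadic_mass s q : R := \sum_(q * 2 ^ s <= y < q.+1 * 2 ^ s) cm (f y).

Definition heavy s y := 2 ^+ s < dyadic_mass s (y %/ 2 ^ s).

Let A : R := \sum_(0 <= y < W) cm (f y).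
Let S := (Num.truncn A).+1.

(* The least [t] such that no dyadic interval of length at least [2 ^ t]
   around [y] carries more mass than its length. *)
Definition stopping y : nat := \max_(s < S | heavy s y) s.+1.

Lemma dyadic_mass_le s q : dyadic_mass s q <= A.
Proof.
apply: sum_le_supp => y; first exact: cmodulus_ge0.
by move=> /fW ->; rewrite cmodulus0.
Qed.

Lemma heavy_lt s y : heavy s y -> (s < S)%N.
Proof.
rewrite /heavy ltnNge => h; apply/negP => Ss; move: h; apply/negP; rewrite -leNgt.
apply: (le_trans (dyadic_mass_le _ _)).
apply: (le_trans (ltW (truncnS_gt A))); rewrite -natrX ler_nat.
by apply: (leq_trans Ss); rewrite ltnW// ltn_expl.
Qed.

Lemma heavy_stopping s y : heavy s y -> (s < stopping y)%N.
Proof.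
move=> h; have hS := heavy_lt h.
exact: (@leq_bigmax_cond _ (fun s : 'I_S => heavy s y) (fun s => s.+1) (Ordinal hS)).
Qed.

Lemma dyadic_mass_stopping s y : (stopping y <= s)%N ->
  dyadic_mass s (y %/ 2 ^ s) <= 2 ^+ s.
Proof.
by move=> h; rewrite leNgt; apply/negP => /heavy_stopping; rewrite ltnNge h.
Qed.

Lemma stopping_heavy t y : stopping y = t.+1 -> heavy t y.
Proof.
rewrite /stopping; elim/big_ind : _ => //.
  by move=> x1 x2 h1 h2; rewrite /maxn; case: ifP => _; auto.
by move=> s h [<-].
Qed.

(** Heaviness at scales from [t] on depends only on the dyadic interval of length $2^t$. Hence
    maximal heavy intervals are disjoint and [stopping] is constant on each. *)
Lemma stopping_cube t y y' : (y %/ 2 ^ t = y' %/ 2 ^ t)%N ->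
  stopping y = t.+1 -> stopping y' = t.+1.
Proof.
move=> eq_t st.
have hs s : (t <= s)%N -> heavy s y' = heavy s y.
  move=> ts; rewrite /heavy.
  have e (z : nat) : (z %/ 2 ^ s = z %/ 2 ^ t %/ 2 ^ (s - t))%N.
    by rewrite -divnMA -expnD subnKC.
  by rewrite !e eq_t.
apply/eqP; rewrite eqn_leq; apply/andP; split.
  apply/bigmax_leqP => s h; have [ts|st'] := leqP t s; last exact: ltnW.
  by rewrite hs// in h; have := heavy_stopping h; rewrite st.
by apply: heavy_stopping; rewrite hs//; exact: stopping_heavy.
Qed.

(** The radius is twice the length of the maximal heavy interval around [y]. For any other $x \le y$
    the index $n = y - x$, when positive, has scale at least [stopping y]. *)
Definition near_heavy x :=
  has (fun y => [&& (0 < stopping y), (x <= y) & (y - x < 2 ^ stopping y)]%N) (iota 0 W).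

Lemma sum_interval_count (b c d : nat) :
  \sum_(0 <= x < W) ((x < c) && (b < x + d))%N%:R <= (c - (b - d))%:R :> R.
Proof.
apply: (@le_trans _ _ (\sum_(0 <= x < maxn W c) ((x < c) && (b < x + d))%N%:R)).
  by apply: sum_nat_subinterval => //; rewrite leq_maxl.
rewrite (@big_nat_supp _ _ (b - d) c) ?leq_maxr//.
  apply: (@le_trans _ _ (\sum_(b - d <= n < c) 1)).
    by apply: ler_sum => x _; case: (_ && _).
  by rewrite sumr_const_nat.
move=> x _ h; case: (boolP (_ && _)) => //= /andP[h1 h2].
by rewrite h1 leq_subLR addnC (ltnW h2) in h.
Qed.

(** A maximal heavy interval of length $2^t$ spoils itself and at most $2^{t+1}$ points to its left,
    fewer than three times its mass; disjointness allows summation. *)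
Lemma near_heavy_count : \sum_(0 <= x < W) (near_heavy x)%:R <= 3 * A.
Proof.
pose marked t q := has (fun y => (y %/ 2 ^ t == q)%N && (stopping y == t.+1)) (iota 0 W).
apply: (@le_trans _ _ (\sum_(0 <= x < W) \sum_(0 <= t < S) \sum_(0 <= q < W)
   (if marked t q then ((x < q.+1 * 2 ^ t) && (q * 2 ^ t < x + 2 ^ t.+1))%N%:R else 0))).
  apply: ler_sum => x _.
  have nn : 0 <= \sum_(0 <= t < S) \sum_(0 <= q < W)
   (if marked t q then ((x < q.+1 * 2 ^ t) && (q * 2 ^ t < x + 2 ^ t.+1))%N%:R else 0) :> R.
    by apply: sumr_ge0 => t _; apply: sumr_ge0 => q _; case: ifP.
  case: (boolP (near_heavy x)) => // /hasP[y yW /and3P[s0 xy yx]].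
  rewrite mem_iota add0n in yW; move: yW => /andP[_ yW].
  set t := (stopping y).-1; have st : stopping y = t.+1 by rewrite prednK.
  pose q := (y %/ 2 ^ t)%N.
  have tS : (t < S)%N := heavy_lt (stopping_heavy st).
  have qW : (q < W)%N := leq_ltn_trans (leq_div _ _) yW.
  have mk : marked t q.
    by apply/hasP; exists y; rewrite ?mem_iota ?yW// eqxx st eqxx.
  rewrite (bigD1_seq t) ?mem_index_iota ?iota_uniq//=.
  rewrite (bigD1_seq q) ?mem_index_iota ?iota_uniq//= mk.
  have -> : (x < q.+1 * 2 ^ t)%N && (q * 2 ^ t < x + 2 ^ t.+1)%N.
    apply/andP; split; first by apply: leq_ltn_trans xy _; rewrite ltn_ceil// expn_gt0.
    apply: (leq_ltn_trans (leq_trunc_div _ _)); rewrite -st.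
    by rewrite -ltn_subLR.
  rewrite -addrA lerDl addr_ge0//; first by apply: sumr_ge0 => ? _; case: ifP.
  by apply: sumr_ge0 => ? _; apply: sumr_ge0 => ? _; case: ifP.
rewrite exchange_big /=.
apply: (@le_trans _ _ (\sum_(0 <= t < S) 3 *
    \sum_(0 <= y < W) (if stopping y == t.+1 then cm (f y) else 0))).
  apply: ler_sum => t _; rewrite exchange_big /=.
  set u := fun y => if stopping y == t.+1 then cm (f y) else 0.
  have u0 y : 0 <= u y by rewrite /u; case: ifP => // _; rewrite cmodulus_ge0.
  apply: (@le_trans _ _ (\sum_(0 <= q < W) 3 *
     \sum_((q + 0) * 2 ^ t <= y < (q + 0).+1 * 2 ^ t) u y)); last first.
    rewrite -mulr_sumr ler_wpM2l// sum_consecutive; apply: sum_le_supp => //.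
    by move=> y Wy; rewrite /u fW// cmodulus0; case: ifP.
  apply: ler_sum => q _; rewrite addn0.
  case: (boolP (marked t q)) => [/hasP[y yW /andP[/eqP yq /eqP sy]]|_]; last first.
    by rewrite big1// mulr_ge0// sumr_ge0.
  have -> : \sum_(q * 2 ^ t <= y0 < q.+1 * 2 ^ t) u y0 = dyadic_mass t q.
    apply: eq_big_nat => z /andP[h1 h2]; rewrite /u ifT//; apply/eqP.
    apply: stopping_cube sy; rewrite yq; apply/eqP.
    by rewrite eqn_leq leq_divRL ?expn_gt0// h1 -ltnS ltn_divLR ?expn_gt0.
  apply: (@le_trans _ _ (3 * 2 ^+ t)); last first.
    rewrite ler_pM2l//; have := stopping_heavy sy; rewrite /heavy yq.
    exact: ltW.
  apply: (le_trans (sum_interval_count _ _ _)); rewrite -natrX -natrM ler_nat.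
  rewrite expnS mulSn; move: (2 ^ t)%N (q * 2 ^ t)%N => L qL; clear; lia.
rewrite -mulr_sumr ler_pM2l// exchange_big /=; apply: ler_sum => y _.
case: (posnP (stopping y)) => [s0|s0].
  by rewrite big1 ?cmodulus_ge0// => t _; rewrite s0.
have st : stopping y = (stopping y).-1.+1 by rewrite prednK.
have tS : (0 <= (stopping y).-1 < S)%N := heavy_lt (stopping_heavy st).
rewrite (eq_bigr (fun t => if t == (stopping y).-1 then cm (f y) else 0)).
  by rewrite -big_mkcond /= big_nat_pred1.
by move=> t _; rewrite {1}st eqSS eq_sym.
Qed.

End DyadicStopping.

(** * Summation over the offsets *)

Section WeakType.
Variables (R : realType) (a : nat -> R[i]) (e : nat) (C : R).
Local Notation cm := (@cmodulus R).
Local Notation lg := (trunc_log 2).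
Hypothesis C0 : 0 <= C.
Hypothesis e0 : (0 < e)%N.
Hypothesis a_le : forall n, (0 < n)%N -> cm (a n) <= n%:R^-1.
Hypothesis a_corr : decorrelated a e C.

Lemma sum_pow_div8 (K : nat) :
  \sum_(0 <= k < K) (2 ^+ (k %/ 8))^-1 <= 16 :> R.
Proof.
pose F q : R := (2 ^+ q)^-1.
have F0 q : 0 <= F q by rewrite invr_ge0 exprn_ge0.
apply: (@le_trans _ _ (\sum_(0 <= k < K * 8) F (k %/ 8)%N)).
  by apply: sum_nat_subinterval => //; rewrite leq_pmulr.
rewrite sum_divn_range// -[_ *+ 8]mulr_natl.
have -> : 16 = 8 * 2 :> R by rewrite -natrM.
rewrite ler_wpM2l//.
suff : \sum_(0 <= q < K) F q + (2 ^+ K)^-1 * 2 <= 2.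
  by apply: le_trans; rewrite lerDl mulr_ge0 ?invr_ge0 ?exprn_ge0.
elim: K => [|K IHK]; first by rewrite big_geq// expr0 invr1 add0r mul1r.
rewrite big_nat_recr//= {2}/F exprS invfM.
have : 0 <= (2 ^+ K)^-1 :> R by rewrite invr_ge0 exprn_ge0.
by move: IHK; move: (2 ^+ K)^-1 (\sum_(_ <= _ < _) _) => p s; lra.
Qed.

Definition offset_part (f : nat -> R[i]) W k i y : R[i] :=
  if (stopping f W y <= i)%N && (minn (i - stopping f W y) (i %/ e) == k)
  then f y else 0.

(** If the interval contains a point with offset [k], its stopping scale is at most $i - k \le t$,
    so the interval is not heavy. *)
Lemma offset_part_dyadic f W k t i q : (forall y, (W <= y)%N -> f y = 0) ->
  (i <= t + k)%N ->
  \sum_(q * 2 ^ t <= y < q.+1 * 2 ^ t) cm (offset_part f W k i y) <= 2 ^+ t.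
Proof.
move=> fW itk.
have le_f y : cm (offset_part f W k i y) <= cm (f y).
  by rewrite /offset_part; case: ifP => // _; rewrite cmodulus0 cmodulus_ge0.
pose P y := (stopping f W y <= i)%N && (minn (i - stopping f W y) (i %/ e) == k).
case: (boolP (has P (index_iota (q * 2 ^ t) (q.+1 * 2 ^ t)))); last first.
  move=> /hasPn h; rewrite big_seq_cond big1 ?exprn_ge0// => y /andP[/h hy _].
  by rewrite /offset_part ifF ?cmodulus0//; exact: negbTE hy.
move=> /hasP[y]; rewrite mem_index_iota => /andP[h1 h2] /andP[si /eqP hk].
apply: (@le_trans _ _ (dyadic_mass f t q)); first exact: ler_sum.
have <- : (y %/ 2 ^ t = q)%N.
  by apply/eqP; rewrite eqn_leq leq_divRL ?expn_gt0// h1 -ltnS ltn_divLR ?expn_gt0// h2.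
apply: (dyadic_mass_stopping fW).
have : (k <= i - stopping f W y)%N by rewrite -hk geq_minl.
by move: itk si; clear; lia.
Qed.

(** The minimum equals [k] only if $i = s + k$ or $i/e = k$, which leaves $1 + e$ scales. *)
Lemma offset_part_count f W k J y :
  \sum_(0 <= i < J) cm (offset_part f W k i y) <= (1 + e%:R) * cm (f y).
Proof.
set s := stopping f W y.
apply: (@le_trans _ _ (\sum_(0 <= i < J * e + (s + k).+1)
    ((i == s + k)%N%:R + (i < J * e)%N%:R * (i %/ e == k)%N%:R) * cm (f y))).
  apply: (@le_trans _ _ (\sum_(0 <= i < J)
    ((i == s + k)%N%:R + (i < J * e)%N%:R * (i %/ e == k)%N%:R) * cm (f y))); last first.
    apply: sum_nat_subinterval => //.
      by move=> i; rewrite mulr_ge0 ?addr_ge0 ?mulr_ge0 ?cmodulus_ge0.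
    by rewrite (leq_trans _ (leq_addr _ _))// leq_pmulr.
  apply: ler_sum_nat_cond => i /andP[_ iJ] _; rewrite /offset_part -/s.
  have iJe : (i < J * e)%N by rewrite (leq_trans iJ)// leq_pmulr.
  rewrite iJe mul1r; case: ifP => [/andP[si /eqP hk]|_]; last first.
    by rewrite cmodulus0 mulr_ge0 ?addr_ge0 ?cmodulus_ge0.
  rewrite -{1}[cm _]mul1r ler_wpM2r ?cmodulus_ge0//.
  move: hk; rewrite /minn; case: ifP => _ <-.
    by rewrite subnKC// eqxx lerDl.
  by rewrite eqxx lerDr.
rewrite -mulr_suml ler_wpM2r ?cmodulus_ge0// big_split /=; apply: lerD.
  rewrite (eq_bigr (fun i => if i == (s + k)%N then 1 else 0)); last first.
    by move=> i _; case: eqP.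
  by rewrite -big_mkcond /= big_nat_pred1//= addnS ltnS leq_addl.
rewrite (@big_nat_supp _ _ 0 (J * e)) ?leq_addr//; last first.
  by move=> i _ /negbTE /= ->; rewrite mul0r.
rewrite (eq_big_nat _ _ (F2 := fun i => (fun q => (q == k)%N%:R) (i %/ e)%N)); last first.
  by move=> i /andP[_ ->]; rewrite mul1r.
rewrite (@sum_divn_range _ (fun q => (q == k)%N%:R : R))// -[_ *+ e]mulr_natl ler_piMr//.
have [kJ|Jk] := ltnP k J.
  rewrite (eq_bigr (fun i => if i == k then 1 else 0)); last by move=> i _; case: eqP.
  by rewrite -big_mkcond /= big_nat_pred1.
rewrite big_nat_cond big1// => i /andP[/andP[_ iJ] _].
by rewrite (ltn_eqF (leq_trans iJ Jk)).
Qed.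

(** The 3 is from [near_heavy_count], the 16 from the sum over [k], and the two factors from
    [fixed_offset_bound] and [offset_part_count]. *)
Definition weak_constant : R := 3 + 16 * ((8 + 168 * C * e%:R) * (1 + e%:R)).

(** Away from heavy intervals every pair of a scale and a point that occurs has exactly one offset,
    smaller than [J], so the truncated sum is the sum of its parts; $64 = 4 \cdot 16$ adds up their
    bounds. *)
Lemma weak_type_unit (f : nat -> R[i]) (W J : nat) :
  (forall y, (W <= y)%N -> f y = 0) ->
  exists2 E : pred nat,
    \sum_(0 <= x < W) (E x)%:R <= weak_constant * \sum_(0 <= y < W) cm (f y) &
    forall x N, (x < W)%N -> ~~ E x -> (0 < N)%N ->
      cm (\sum_(N <= n < 2 ^ J) a n * f (x + n)%N) <= 64.
Proof.
move=> fW; set A := \sum_(0 <= y < W) _.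
pose g k := offset_part f W k.
pose D := 8 + 168 * C * e%:R.
have D0 : 0 <= D by rewrite addr_ge0 ?mulr_ge0.
pose B k (E : pred nat) :=
  \sum_(0 <= x < W) (E x)%:R <= D / 2 ^+ (k %/ 8) * ((1 + e%:R) * A) /\
  forall x N, (x < W)%N -> ~~ E x -> (0 < N)%N ->
    cm (\sum_(N <= n < 2 ^ J) a n * g k (lg n) (x + n)) <= 4 / 2 ^+ (k %/ 8).
have exE k : exists E, B k E.
  have gW j y : (W <= y)%N -> g k j y = 0.
    by move=> Wy; rewrite /g /offset_part fW//; case: ifP.
  have ge j y : (j %/ e < k)%N -> g k j y = 0.
    move=> jk; rewrite /g /offset_part; case: ifP => // /andP[_ /eqP hk].
    by have := geq_minr (j - stopping f W y) (j %/ e); rewrite hk leqNgt jk.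
  have gd t i q : (i <= t + k)%N ->
      \sum_(q * 2 ^ t <= y < q.+1 * 2 ^ t) cm (g k i y) <= 2 ^+ t.
    exact: offset_part_dyadic.
  have [E h1 h2] := @fixed_offset_bound R a e C k J W (g k) C0 e0 a_le a_corr gW ge gd.
  exists E; split => //; apply: (le_trans h1).
  rewrite ler_wpM2l ?divr_ge0 ?exprn_ge0// exchange_big /= mulr_sumr.
  by apply: ler_sum => y _; exact: offset_part_count.
have [E HE] := choice exE.
exists (fun x => near_heavy f W x || has (fun k => E k x) (iota 0 J)).
  apply: (@le_trans _ _ (\sum_(0 <= x < W) ((near_heavy f W x)%:R +
     \sum_(0 <= k < J) (E k x)%:R))).
    apply: ler_sum => x _; case: near_heavy => /=.
      by rewrite lerDl sumr_ge0.
    rewrite add0r; case: (boolP (has _ _)) => [/hasP[k kJ Ek]|_]; last exact: sumr_ge0.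
    rewrite (bigD1_seq k) ?iota_uniq//=; last by rewrite /index_iota subn0.
    by rewrite Ek lerDl sumr_ge0.
  rewrite big_split /= exchange_big /= /weak_constant -/D mulrDl; apply: lerD.
    exact: near_heavy_count.
  apply: (@le_trans _ _ (\sum_(0 <= k < J) D / 2 ^+ (k %/ 8) * ((1 + e%:R) * A))).
    by apply: ler_sum => k _; have [] := HE k.
  rewrite -mulr_suml -mulr_sumr mulrA ler_wpM2r//.
    by apply: sumr_ge0 => y _; exact: cmodulus_ge0.
  rewrite mulrA ler_wpM2r ?addr_ge0// mulrC ler_wpM2r//.
  exact: sum_pow_div8.
move=> x N xW; rewrite negb_or => /andP[nh /hasPn nE] N0.
have -> : \sum_(N <= n < 2 ^ J) a n * f (x + n)%N =
    \sum_(0 <= k < J) \sum_(N <= n < 2 ^ J) a n * g k (lg n) (x + n)%N.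
  rewrite exchange_big /=; apply: eq_big_nat => n /andP[Nn nJ].
  have n0 := leq_trans N0 Nn; have /andP[ln nl] := trunc_log2_le n0.
  rewrite -mulr_sumr; congr (_ * _).
  have [Wy|yW] := leqP W (x + n).
    by rewrite big1 ?fW// => k _; rewrite /g /offset_part fW//; case: ifP.
  set s := stopping f W (x + n).
  have sl : (s <= lg n)%N.
    rewrite leqNgt; apply/negP => ls; move/negP: nh; apply; apply/hasP.
    exists (x + n)%N; first by rewrite mem_iota.
    rewrite -/s (leq_ltn_trans _ ls)// leq_addr addKn /=.
    by apply: (leq_trans nl); rewrite leq_exp2l.
  pose k0 := minn (lg n - s) (lg n %/ e).
  have lJ : (lg n < J)%N by rewrite -(ltn_exp2l _ _ (ltnSn 1)) (leq_ltn_trans ln).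
  have k0J : (0 <= k0 < J)%N.
    by rewrite /= (leq_ltn_trans (geq_minl _ _))// (leq_ltn_trans (leq_subr _ _)).
  rewrite (eq_bigr (fun k => if k == k0 then f (x + n)%N else 0)); last first.
    by move=> k _; rewrite /g /offset_part sl /= -/s -/k0 eq_sym.
  by rewrite -big_mkcond /= big_nat_pred1.
apply: (le_trans (cmodulus_sum _ _ _)).
apply: (@le_trans _ _ (\sum_(0 <= k < J) 4 * (2 ^+ (k %/ 8))^-1)).
  apply: ler_sum_nat_cond => k /andP[_ kJ] _; have [_ h] := HE k.
  by apply: h => //; apply: nE; rewrite mem_iota.
rewrite -mulr_sumr; have -> : 64 = 4 * 16 :> R by rewrite -natrM.
by rewrite ler_wpM2l// sum_pow_div8.
Qed.

Lemma weak_type_nat (f : nat -> R[i]) (W J : nat) (lam : R) : 0 < lam ->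
  (forall y, (W <= y)%N -> f y = 0) ->
  exists2 E : pred nat,
    \sum_(0 <= x < W) (E x)%:R <=
      64 * weak_constant / lam * \sum_(0 <= y < W) cm (f y) &
    forall x N, (x < W)%N -> ~~ E x -> (0 < N)%N ->
      cm (\sum_(N <= n < 2 ^ J) a n * f (x + n)%N) <= lam.
Proof.
move=> lam0 fW; pose t := 64 / lam; have t0 : 0 < t by rewrite divr_gt0.
have [|E h1 h2] := @weak_type_unit (fun y => t%:C%C * f y) W J.
  by move=> y Wy; rewrite fW// mulr0.
exists E.
  apply: (le_trans h1); rewrite mulr_sumr mulr_sumr le_eqVlt; apply/orP; left.
  apply/eqP; apply: eq_bigr => y _; rewrite cmodulusM cmodulus_real gtr0_norm//.
  by rewrite /t; ring.
move=> x N xW Ex N0; rewrite -(ler_pM2l t0).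
have -> : t * lam = 64 by rewrite /t divfK// gt_eqF.
apply: le_trans (h2 x N xW Ex N0).
rewrite -[t in leLHS]gtr0_norm// -cmodulus_real -cmodulusM mulr_sumr.
by under eq_bigr do rewrite mulrCA.
Qed.

End WeakType.

(** * The strong type inequality on the integers *)

Section BlockSquare.
Variables (R : realType) (a : nat -> R[i]) (e : nat) (C : R).
Local Notation cm := (@cmodulus R).
Hypothesis C0 : 0 <= C.
Hypothesis e2 : (2 < e)%N.
Hypothesis a_le : forall n, (0 < n)%N -> cm (a n) <= n%:R^-1.
Hypothesis a_corr : decorrelated a e C.

Definition block_max (f : nat -> R[i]) j x : R :=
  \big[Num.max/0]_(N < 2 ^ j.+1 | (2 ^ j <= N)%N)
    cm (\sum_(N <= n < 2 ^ j.+1) a n * f (x + n)%N).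

Lemma block_max_ge0 f j x : 0 <= block_max f j x.
Proof.
rewrite /block_max; elim/big_ind : _ => // [u v u0 _|N _]; first by rewrite le_max u0.
exact: cmodulus_ge0.
Qed.

Lemma block_max_ge f j x N : (2 ^ j <= N <= 2 ^ j.+1)%N ->
  cm (\sum_(N <= n < 2 ^ j.+1) a n * f (x + n)%N) <= block_max f j x.
Proof.
move=> /andP[jN]; rewrite leq_eqVlt => /predU1P[->|Nj].
  by rewrite big_geq// cmodulus0 block_max_ge0.
exact: (le_bigmax_cond _ (fun N : 'I__ => cm (\sum_(N <= n < 2 ^ j.+1) _))
  (j := Ordinal Nj)).
Qed.

Lemma block_max_le f j x (c : R) : 0 <= c ->
  (forall N, (2 ^ j <= N < 2 ^ j.+1)%N ->
    cm (\sum_(N <= n < 2 ^ j.+1) a n * f (x + n)%N) <= c) ->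
  block_max f j x <= c.
Proof.
move=> c0 h; apply/bigmax_leP; split => // N jN.
by apply: h; rewrite jN ltn_ord.
Qed.

Lemma normr_Re_le (z : R[i]) : `|complex.Re z| <= cm z.
Proof.
rewrite ler_norml ler_Re_cmodulus andbT lerNl -cmodulusN.
have -> : - complex.Re z = complex.Re (- z) by case: z.
exact: ler_Re_cmodulus.
Qed.

Lemma big_nat_shift (V : nmodType) (F : nat -> V) (n m : nat) :
  \sum_(n <= y < m + n) F y = \sum_(0 <= x < m) F (x + n)%N.
Proof. by rewrite -{1}[n]add0n big_addn addnK. Qed.

Lemma triangular_sum (V : nmodType) (G : nat -> nat -> V) (L : nat) :
  \sum_(0 <= n < L) \sum_(n <= n' < L) G n n' =
  \sum_(0 <= h < L) \sum_(0 <= n < L - h) G n (n + h)%N.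
Proof.
transitivity (\sum_(0 <= n < L) \sum_(0 <= h < L | (n + h < L)%N) G n (n + h)%N).
  apply: eq_big_nat => n /andP[_ nL]; rewrite -{1}[n]add0n big_addn [RHS]big_mkcond /=.
  rewrite [RHS](@big_nat_supp _ _ 0 (L - n)).
  - by apply: eq_big_nat => h /andP[_ hL]; rewrite addnC -ltn_subRL hL addnC.
  - exact: leq_subr.
  - by move=> h _; rewrite /= -leqNgt leq_subLR ltnNge => ->.
rewrite (exchange_big_dep xpredT)//=; apply: eq_big_nat => h /andP[_ hL].
rewrite big_mkcond /= (@big_nat_supp _ _ 0 (L - h)) ?leq_subr//.
  by apply: eq_big_nat => n /andP[_ nL]; rewrite addnC -ltn_subRL nL addnC.
by move=> n _; rewrite /= -leqNgt leq_subLR ltnNge addnC => ->.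
Qed.

(** The upper triangle is grouped by lag and doubled; this counts the nonnegative diagonal twice. *)
Lemma sum_symmetric_le (G : nat -> nat -> R) (L : nat) :
  (forall n n', G n n' = G n' n) -> (forall n, 0 <= G n n) ->
  \sum_(0 <= n < L) \sum_(0 <= n' < L) G n n' <=
    2 * \sum_(0 <= h < L) `|\sum_(0 <= n < L - h) G n (n + h)%N|.
Proof.
move=> Gsym G0; set D := \sum_(0 <= n < L) \sum_(n <= n' < L) G n n'.
have D1 : D <= \sum_(0 <= h < L) `|\sum_(0 <= n < L - h) G n (n + h)%N|.
  by rewrite /D triangular_sum; apply: ler_sum => h _; exact: ler_norm.
have -> : \sum_(0 <= n < L) \sum_(0 <= n' < L) G n n' =
    \sum_(0 <= n < L) \sum_(0 <= n' < n) G n n' + D.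
  rewrite /D -big_split /=; apply: eq_big_nat => n /andP[_ nL].
  by rewrite -big_cat_nat// ltnW.
have -> : \sum_(0 <= n < L) \sum_(0 <= n' < n) G n n' =
    D - \sum_(0 <= n < L) G n n.
  have -> : D = \sum_(0 <= n < L) \sum_(0 <= n' < n.+1) G n n'.
    rewrite /D; transitivity (\sum_(0 <= n < L) \sum_(0 <= n' < L | (n <= n')%N) G n n').
      apply: eq_big_nat => n /andP[_ nL]; rewrite [RHS]big_mkcond /=.
      rewrite (@big_nat_supp _ _ n L)//; first by apply: eq_big_nat => n' /andP[->].
      by move=> n' -> /=; rewrite andbT => /negbTE ->.
    rewrite (exchange_big_dep xpredT)//=; apply: eq_big_nat => n /andP[_ nL].
    rewrite big_mkcond /= (@big_nat_supp _ _ 0 n.+1)//.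
      by apply: eq_big_nat => n' /andP[_]; rewrite ltnS Gsym => ->.
    by move=> n' _; rewrite /= ltnS => /negbTE ->.
  under [X in _ = X - _]eq_bigr do rewrite big_nat_recr//=.
  by rewrite big_split /= addrK.
have : 0 <= \sum_(0 <= n < L) G n n by apply: sumr_ge0.
by move: D1; lra.
Qed.

(* [f] vanishes below the largest shift, so that the autocorrelation of [f] is
   insensitive to the cut at [0]. *)
Lemma interval_sum_l2 (f : nat -> R[i]) (W j b : nat) :
  (2 ^ j <= b)%N -> (b + cell (j %/ e) j <= 2 ^ j.+1)%N ->
  (forall y, (y < 2 ^ j.+1)%N || (W <= y)%N -> f y = 0) ->
  \sum_(0 <= x < W) cm (\sum_(b <= n < b + cell (j %/ e) j) a n * f (x + n)%N) ^+ 2 <=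
    2 * (1 + C) / (2 ^+ (j %/ e)) ^+ 4 * \sum_(0 <= y < W) cm (f y) ^+ 2.
Proof.
set kap := (j %/ e)%N; set L := cell kap j => jb bL fW.
set Phi := \sum_(0 <= y < W) cm (f y) ^+ 2.
have P2 n : 0 < 2 ^+ n :> R by rewrite exprn_gt0.
have Phi0 : 0 <= Phi by apply: sumr_ge0 => y _; rewrite exprn_ge0 ?cmodulus_ge0.
(* By $e > 2$; it makes $2^j / 8^\kappa$ an integer. *)
have k3 : (3 * kap <= j)%N.
  by apply: leq_trans (leq_trunc_div j e); rewrite mulnC leq_mul2l e2 orbT.
have kj : (kap <= j)%N by rewrite (leq_trans _ k3)// leq_pmull.
(* The sum over [x] of two translates of [f] depends only on their lag, so the correlations of [a]
   and of [f] separate. *)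
pose A h := \sum_(0 <= y < W) f y * conjc (f (y + h)%N).
have autoc n h : (n < 2 ^ j.+1)%N ->
    \sum_(0 <= x < W) f (x + n)%N * conjc (f (x + (n + h))%N) = A h.
  move=> nj; transitivity (\sum_(n <= y < W + n) f y * conjc (f (y + h)%N)).
    rewrite big_nat_shift; apply: eq_bigr => x _.
    by rewrite addnA.
  rewrite /A; transitivity (\sum_(0 <= y < W + n) f y * conjc (f (y + h)%N)).
    rewrite [RHS](@big_nat_supp _ _ n (W + n))// => y yW; rewrite yW andbT -ltnNge => yn.
    by rewrite fW ?mul0r// (ltn_trans yn nj).
  by rewrite (@big_nat_supp _ _ 0 W) ?leq_addr// => y _ /=; rewrite -leqNgt => Wy;
    rewrite fW ?mul0r// Wy orbT.
have Ale h : cm (A h) <= Phi.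
  apply: (le_trans (cmodulus_sum _ _ _)).
  apply: (@le_trans _ _ (\sum_(0 <= y < W) (cm (f y) ^+ 2 + cm (f (y + h)%N) ^+ 2) / 2)).
    apply: ler_sum => y _; rewrite cmodulusM cmodulus_conj.
    by have := sqr_ge0 (cm (f y) - cm (f (y + h)%N)); nra.
  rewrite -mulr_suml big_split /= -/Phi.
  have : \sum_(0 <= i < W) cm (f (i + h)%N) ^+ 2 <= Phi.
    have -> : \sum_(0 <= i < W) cm (f (i + h)%N) ^+ 2 = \sum_(h <= y < W + h) cm (f y) ^+ 2.
      by rewrite big_nat_shift.
    apply: (@sum_le_supp _ W _ _ (fun y => cm (f y) ^+ 2)) => y.
      by rewrite exprn_ge0 ?cmodulus_ge0.
    by move=> Wy; rewrite fW ?cmodulus0 ?expr0n// Wy orbT.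
  by lra.
pose G n n' := complex.Re (a (b + n)%N * conjc (a (b + n')%N) *
  \sum_(0 <= x < W) f (x + (b + n))%N * conjc (f (x + (b + n'))%N)).
have -> : \sum_(0 <= x < W) cm (\sum_(b <= n < b + L) a n * f (x + n)%N) ^+ 2 =
    \sum_(0 <= n < L) \sum_(0 <= n' < L) G n n'.
  under eq_bigr => x _ do rewrite -{1}[b]add0n big_addn addKn cmodulus_sqr_sum.
  rewrite exchange_big /=; apply: eq_bigr => n _.
  rewrite exchange_big /=; apply: eq_bigr => n' _.
  rewrite /G mulr_sumr Re_sum; apply: eq_bigr => x _.
  rewrite !(addnC _ b); have -> : conjc (a (b + n')%N * f (x + (b + n'))%N) =
    conjc (a (b + n')%N) * conjc (f (x + (b + n'))%N) by exact: rmorphM.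
  by congr complex.Re; ring.
have Re_conj (z : R[i]) : complex.Re (conjc z) = complex.Re z by case: z.
apply: le_trans (sum_symmetric_le L _ _) _.
- move=> n n'; rewrite /G -[LHS]Re_conj; congr complex.Re.
  rewrite rmorphM/= [X in X * _]rmorphM /= conjcK rmorph_sum /= [conjc _ * _]mulrC.
  congr (_ * _); apply: eq_bigr => x _.
  by rewrite [LHS]rmorphM /= conjcK mulrC.
- move=> n; rewrite /G mulr_sumr Re_sum; apply: sumr_ge0 => x _.
  have -> : a (b + n)%N * conjc (a (b + n)%N) *
      (f (x + (b + n))%N * conjc (f (x + (b + n))%N)) =
      (a (b + n)%N * f (x + (b + n))%N) * conjc (a (b + n)%N * f (x + (b + n))%N).
    have -> : conjc (a (b + n)%N * f (x + (b + n))%N) =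
      conjc (a (b + n)%N) * conjc (f (x + (b + n))%N) by exact: rmorphM.
    by ring.
  by rewrite -cmodulus_sqr exprn_ge0 ?cmodulus_ge0.
have L2 : (2 ^ j = 2 ^ kap * L)%N by rewrite /L /cell mulnC -expnD subnK.
have bLj : (b + L <= 2 ^ j.+1)%N := bL.
(* Lags below $2^j/8^\kappa$ get the trivial bound, the others [decorrelated]. With $L =
   2^{j-\kappa}$ both groups contribute $O(2^{-4\kappa})$. *)
apply: (@le_trans _ _ (2 * \sum_(0 <= h < L) Phi *
   ((if (h * 8 ^ kap < 2 ^ j)%N then L%:R / (2 ^+ j) ^+ 2 else 0) +
     C / (2 ^+ j * 8 ^+ kap)))).
  rewrite ler_pM2l//; apply: ler_sum_nat_cond => h /andP[_ hL] _.
  have -> : \sum_(0 <= n < L - h) G n (n + h)%N =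
    complex.Re ((\sum_(b <= n < b + L - h) a n * conjc (a (n + h)%N)) * A h).
    have -> : (b + L - h = L - h + b)%N by rewrite addnBAC ?(ltnW hL)// addnC.
    rewrite big_nat_shift mulr_suml Re_sum.
    apply: eq_big_nat => n /andP[_ nLh]; rewrite /G [(b + (n + h))%N]addnA autoc.
      by rewrite (addnC n b).
    by apply: leq_trans bLj; rewrite ltn_add2l (leq_trans nLh)// leq_subr.
  apply: (le_trans (normr_Re_le _)); rewrite cmodulusM mulrC.
  apply: ler_pM; rewrite ?cmodulus_ge0//.
  have B0 : 0 <= C / (2 ^+ j * 8 ^+ kap) by rewrite divr_ge0 ?mulr_ge0 ?exprn_ge0.
  case: ltnP => hj; last first.
    rewrite add0r; apply: a_corr => //; last by rewrite hj orbT.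
      by rewrite (leq_trans _ bLj)// leq_subr.
    by rewrite (leq_trans jb)// leq_addr.
  rewrite ler_wpDr//; apply: (le_trans (cmodulus_sum _ _ _)).
  apply: (@le_trans _ _ (\sum_(b <= n < b + L) ((2 ^+ j) ^+ 2)^-1)); last first.
    by rewrite sumr_const_nat addKn -[_ *+ L]mulr_natl.
  apply: (@le_trans _ _ (\sum_(b <= n < b + L - h) ((2 ^+ j) ^+ 2)^-1)); last first.
    by apply: sum_nat_subinterval; rewrite ?leq_subr// => n; rewrite invr_ge0 !exprn_ge0.
  apply: ler_sum_nat_cond => n /andP[bn _] _.
  have jn : (2 ^ j <= n)%N := leq_trans jb bn.
  have small m : (2 ^ j <= m)%N -> cm (a m) <= (2 ^+ j)^-1.
    move=> jm; have m0 : (0 < m)%N by apply: leq_trans jm; rewrite expn_gt0.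
    apply: (le_trans (a_le m0)).
    by rewrite lef_pV2 ?posrE ?ltr0n// -natrX ler_nat.
  rewrite cmodulusM cmodulus_conj expr2 invfM.
  by apply: ler_pM; rewrite ?cmodulus_ge0 ?small// (leq_trans jn)// leq_addr.
rewrite -mulr_sumr big_split /=.
have Lpos : (0 < L)%N := cell_gt0 _ _.
have LE : L%:R = 2 ^+ j / 2 ^+ kap :> R.
  by rewrite -[2 ^+ j]natrX L2 natrM natrX mulrC mulKf// gt_eqF.
have s1 : \sum_(0 <= h < L) (if (h * 8 ^ kap < 2 ^ j)%N then L%:R / (2 ^+ j) ^+ 2 else 0)
    <= ((2 ^+ kap) ^+ 4)^-1 :> R.
  pose M := (2 ^ (j - 3 * kap))%N.
  have ME : (2 ^ j = M * 8 ^ kap)%N.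
    by rewrite -[8%N]/(2 ^ 3)%N -expnM -expnD subnK.
  apply: (@le_trans _ _ (\sum_(0 <= h < M) L%:R / (2 ^+ j) ^+ 2)).
    apply: (@le_trans _ _ (\sum_(0 <= h < maxn L M)
        (if (h * 8 ^ kap < 2 ^ j)%N then L%:R / (2 ^+ j) ^+ 2 else 0))).
      apply: sum_nat_subinterval => //; last by rewrite leq_maxl.
      by move=> h; case: ifP => // _; rewrite divr_ge0 ?exprn_ge0.
    rewrite (@big_nat_supp _ _ 0 M) ?leq_maxr//.
      by apply: ler_sum => h _; case: ifP => // _; rewrite divr_ge0 ?exprn_ge0.
    by move=> h _; rewrite /= ME ltn_pmul2r ?expn_gt0// => /negbTE ->.
  rewrite sumr_const_nat subn0 -[_ *+ M]mulr_natl.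
  have MR : M%:R = 2 ^+ j / (2 ^+ kap) ^+ 3 :> R.
    rewrite -[2 ^+ j]natrX ME natrM -[8%N]/(2 ^ 3)%N -expnM mulnC expnM natrX natrX.
    by rewrite mulfK// expf_neq0// gt_eqF.
  rewrite MR LE le_eqVlt; apply/orP; left; apply/eqP.
  by field; rewrite !gt_eqF.
have s2 : \sum_(0 <= h < L) C / (2 ^+ j * 8 ^+ kap) = C / (2 ^+ kap) ^+ 4 :> R.
  rewrite sumr_const_nat subn0 -[_ *+ L]mulr_natl LE.
  have -> : 8 ^+ kap = (2 ^+ kap) ^+ 3 :> R.
    by rewrite -exprM mulnC exprM; congr (_ ^+ _); rewrite -natrX.
  by field; rewrite !gt_eqF.
rewrite s2; have -> : 2 * (1 + C) / (2 ^+ kap) ^+ 4 * Phi =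
    2 * (Phi * (((2 ^+ kap) ^+ 4)^-1 + C / (2 ^+ kap) ^+ 4)) by ring.
by rewrite ler_pM2l// ler_wpM2l// lerD2r.
Qed.

(** A sum starting at [N] is an incomplete piece around [N], bounded by its mass, and complete
    pieces, treated by Cauchy-Schwarz over $2^\kappa$ of them. Neither bound refers to [N]. *)
Lemma block_max_split (f : nat -> R[i]) j x :
  block_max f j x ^+ 2 <=
    2 * 2 ^+ (j %/ e) * (\sum_(0 <= v < 2 ^ (j %/ e))
      cm (\sum_(2 ^ j + v * cell (j %/ e) j <= n < 2 ^ j + v.+1 * cell (j %/ e) j)
        a n * f (x + n)%N) ^+ 2) +
    2 * (\sum_(0 <= v < 2 ^ (j %/ e))
      ((2 ^+ j)^-1 *
       \sum_(2 ^ j + v * cell (j %/ e) j <= n < 2 ^ j + v.+1 * cell (j %/ e) j)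
        cm (f (x + n)%N)) ^+ 2).
Proof.
set kap := (j %/ e)%N; set L := cell kap j.
pose F v := cm (\sum_(2 ^ j + v * L <= n < 2 ^ j + v.+1 * L) a n * f (x + n)%N).
pose P v := (2 ^+ j)^-1 * \sum_(2 ^ j + v * L <= n < 2 ^ j + v.+1 * L) cm (f (x + n)%N).
have F0 v : 0 <= F v by exact: cmodulus_ge0.
have p0 : 0 <= (2 ^+ j)^-1 :> R by rewrite invr_ge0 exprn_ge0.
have P0 v : 0 <= P v.
  by rewrite mulr_ge0// sumr_ge0// => n _; exact: cmodulus_ge0.
have kj : (kap <= j)%N := leq_div _ _.
have L2 : (2 ^ j = 2 ^ kap * L)%N by rewrite /L /cell mulnC -expnD subnK.
have Lpos : (0 < L)%N := cell_gt0 _ _.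
have j2 : (2 ^ j.+1 = 2 ^ j + 2 ^ kap * L)%N by rewrite -L2 expnS mul2n addnn.
rewrite -/(F _) -/(P _).
set SF := \sum_(0 <= v < 2 ^ kap) F v ^+ 2; set SP := \sum_(0 <= v < 2 ^ kap) P v ^+ 2.
have SF0 : 0 <= SF by apply: sumr_ge0 => v _; rewrite exprn_ge0.
have SP0 : 0 <= SP by apply: sumr_ge0 => v _; rewrite exprn_ge0.
have tailE d M : (M + d = 2 ^ kap)%N ->
    cm (\sum_(2 ^ j + M * L <= n < 2 ^ j.+1) a n * f (x + n)%N) <=
    \sum_(M <= v < 2 ^ kap) F v.
  elim: d M => [|d IHd] M; first by rewrite addn0 => ->; rewrite -j2 !big_geq// cmodulus0.
  rewrite addnS -addSn => hM; have Mk : (M < 2 ^ kap)%N by rewrite -hM ltnS leq_addr.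
  rewrite (big_cat_nat (n := (2 ^ j + M.+1 * L)%N))/=; last 2 first.
  - by rewrite leq_add2l leq_mul2r leqnSn orbT.
  - by rewrite j2 leq_add2l leq_mul2r Mk orbT.
  rewrite (big_ltn Mk) (le_trans (cmodulusD _ _))// lerD2l; exact: IHd.
have bound N : (2 ^ j <= N < 2 ^ j.+1)%N ->
    cm (\sum_(N <= n < 2 ^ j.+1) a n * f (x + n)%N) ^+ 2 <=
    2 * 2 ^+ kap * SF + 2 * SP.
  move=> /andP[jN Nj]; pose v := ((N - 2 ^ j) %/ L)%N.
  have v1 : (2 ^ j + v * L <= N)%N by rewrite -{1}(subnKC jN) leq_add2l leq_trunc_div.
  have v2 : (N < 2 ^ j + v.+1 * L)%N by rewrite -ltn_subLR// ltn_ceil.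
  have vk : (v < 2 ^ kap)%N by rewrite ltn_divLR// ltn_subLR// -j2.
  have vk' : (2 ^ j + v.+1 * L <= 2 ^ j.+1)%N by rewrite j2 leq_add2l leq_mul2r vk orbT.
  have h1 : cm (\sum_(N <= n < 2 ^ j.+1) a n * f (x + n)%N) <=
      P v + \sum_(0 <= v < 2 ^ kap) F v.
    rewrite (big_cat_nat (n := (2 ^ j + v.+1 * L)%N)) ?(ltnW v2)//=.
    apply: (le_trans (cmodulusD _ _)); apply: lerD; last first.
      apply: le_trans (tailE (2 ^ kap - v.+1)%N _ _) _; first by rewrite subnKC.
      exact: sum_nat_subinterval.
    apply: (le_trans (cmodulus_sum _ _ _)); rewrite /P mulr_sumr.
    apply: (@le_trans _ _ (\sum_(N <= n < 2 ^ j + v.+1 * L) (2 ^+ j)^-1 * cm (f (x + n)%N))).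
      apply: ler_sum_nat_cond => n /andP[Nn _] _; rewrite cmodulusM ler_wpM2r ?cmodulus_ge0//.
      have jn := leq_trans jN Nn; have n0 : (0 < n)%N by apply: leq_trans jn; rewrite expn_gt0.
      apply: (le_trans (a_le n0)).
      by rewrite lef_pV2 ?posrE ?ltr0n ?exprn_gt0// -natrX ler_nat.
    by apply: sum_nat_subinterval => // n; rewrite mulr_ge0 ?cmodulus_ge0.
  have h2 : P v ^+ 2 <= SP.
    rewrite /SP (bigD1_seq v) ?mem_index_iota ?iota_uniq//= lerDl sumr_ge0// => i _.
    by rewrite exprn_ge0.
  have h3 := sum_sqr_le (index_iota 0 (2 ^ kap)) F.
  rewrite size_iota subn0 natrX -/SF in h3.
  have h4 : 0 <= \sum_(0 <= v < 2 ^ kap) F v by apply: sumr_ge0.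
  have c0 := cmodulus_ge0 (\sum_(N <= n < 2 ^ j.+1) a n * f (x + n)%N).
  move: h1 h2 h3 h4 c0 (P0 v); move: (cm _) (P v) (\sum_(_ <= _ < _) F _) => c pv sf.
  move=> h1 h2 h3 h4 c0 p1; have := sqr_ge0 (pv - sf).
  have : c ^+ 2 <= (pv + sf) ^+ 2 by rewrite lerXn2r ?nnegrE// addr_ge0.
  by clear - h2 h3; nra.
have K0 : 0 <= 2 * 2 ^+ kap * SF + 2 * SP by rewrite addr_ge0 ?mulr_ge0 ?exprn_ge0.
have : block_max f j x <= Num.sqrt (2 * 2 ^+ kap * SF + 2 * SP).
  apply: block_max_le; first exact: sqrtr_ge0.
  move=> N hN; rewrite -[leLHS]ger0_norm ?cmodulus_ge0// -sqrtr_sqr.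
  by apply: ler_wsqrtr; exact: bound.
move=> h; rewrite -[leRHS](sqr_sqrtr K0).
by rewrite lerXn2r ?nnegrE ?block_max_ge0 ?sqrtr_ge0.
Qed.

(** The complete pieces contribute $2^{2\kappa} O(2^{-4\kappa})$. The incomplete ones contribute $2
    \cdot 2^\kappa (2^{-\kappa})^2$ and determine the gain. *)
Lemma block_max_l2 (f : nat -> R[i]) (W j : nat) :
  (forall y, (y < 2 ^ j.+1)%N || (W <= y)%N -> f y = 0) ->
  \sum_(0 <= x < W) block_max f j x ^+ 2 <=
    (6 + 4 * C) / 2 ^+ (j %/ e) * \sum_(0 <= y < W) cm (f y) ^+ 2.
Proof.
move=> fW; set Phi := \sum_(0 <= y < W) cm (f y) ^+ 2; set kap := (j %/ e)%N.
have P2 n : 0 < 2 ^+ n :> R by rewrite exprn_gt0.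
have Phi0 : 0 <= Phi by apply: sumr_ge0 => y _; rewrite exprn_ge0 ?cmodulus_ge0.
set L := cell kap j.
have kj : (kap <= j)%N := leq_div _ _.
have L2 : (2 ^ j = 2 ^ kap * L)%N by rewrite /L /cell mulnC -expnD subnK.
have Lpos : (0 < L)%N := cell_gt0 _ _.
have LE : L%:R = 2 ^+ j / 2 ^+ kap :> R.
  by rewrite -[2 ^+ j]natrX L2 natrM natrX mulrC mulKf// gt_eqF.
apply: (le_trans (ler_sum _ (fun x _ => block_max_split f j x))).
rewrite big_split /= -!mulr_sumr -/kap -/L.
rewrite exchange_big /= [X in _ + 2 * X]exchange_big /=.
have b1 v : (v < 2 ^ kap)%N -> (2 ^ j + v.+1 * L <= 2 ^ j.+1)%N.
  by move=> vk; rewrite expnS mul2n -addnn leq_add2l L2 leq_mul2r vk orbT.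
have h1 : \sum_(0 <= v < 2 ^ kap) \sum_(0 <= x < W)
    cm (\sum_(2 ^ j + v * L <= n < 2 ^ j + v.+1 * L) a n * f (x + n)%N) ^+ 2 <=
    2 ^+ kap * (2 * (1 + C) / (2 ^+ kap) ^+ 4 * Phi).
  apply: (@le_trans _ _ (\sum_(0 <= v < 2 ^ kap) 2 * (1 + C) / (2 ^+ kap) ^+ 4 * Phi)).
    apply: ler_sum_nat_cond => v /andP[_ vk] _.
    rewrite mulSnr addnA; apply: interval_sum_l2 => //; first by rewrite leq_addr.
    by rewrite -addnA -mulSnr b1.
  by rewrite sumr_const_nat subn0 -[_ *+ _]mulr_natl natrX.
have h2 : \sum_(0 <= v < 2 ^ kap) \sum_(0 <= x < W)
    ((2 ^+ j)^-1 * \sum_(2 ^ j + v * L <= n < 2 ^ j + v.+1 * L) cm (f (x + n)%N)) ^+ 2 <=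
    2 ^+ kap * (((2 ^+ j)^-1 * L%:R) ^+ 2 * Phi).
  apply: (@le_trans _ _ (\sum_(0 <= v < 2 ^ kap) ((2 ^+ j)^-1 * L%:R) ^+ 2 * Phi)).
    apply: ler_sum => v _.
    apply: (@le_trans _ _ (\sum_(0 <= x < W) (2 ^+ j)^-1 ^+ 2 * (L%:R *
       \sum_(2 ^ j + v * L <= n < 2 ^ j + v.+1 * L) cm (f (x + n)%N) ^+ 2))).
      apply: ler_sum => x _; rewrite exprMn ler_wpM2l ?exprn_ge0 ?invr_ge0 ?exprn_ge0//.
      apply: (le_trans (sum_sqr_le _ _)).
      by rewrite size_iota subnDl -mulnBl subSnn mul1n.
    rewrite -mulr_sumr exprMn -[leRHS]mulrA ler_wpM2l ?exprn_ge0 ?invr_ge0 ?exprn_ge0//.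
    rewrite -mulr_sumr expr2 -[leRHS]mulrA ler_wpM2l// exchange_big /=.
    apply: (@le_trans _ _ (\sum_(2 ^ j + v * L <= n < 2 ^ j + v.+1 * L) Phi)).
      apply: ler_sum => n _; rewrite -(big_nat_shift (fun y => cm (f y) ^+ 2)).
      apply: (@sum_le_supp _ W _ _ (fun y => cm (f y) ^+ 2)) => y.
        by rewrite exprn_ge0 ?cmodulus_ge0.
      by move=> Wy; rewrite fW ?cmodulus0 ?expr0n// Wy orbT.
    by rewrite sumr_const_nat subnDl -mulnBl subSnn mul1n -[_ *+ _]mulr_natl.
  by rewrite sumr_const_nat subn0 -[_ *+ _]mulr_natl natrX.
have q0 : 0 <= 2 * 2 ^+ kap :> R by rewrite mulr_ge0 ?ltW.
apply: (le_trans (lerD (ler_wpM2l q0 h1) (ler_wpM2l (ler0n R 2) h2))).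
have -> : 2 * 2 ^+ kap * (2 ^+ kap * (2 * (1 + C) / (2 ^+ kap) ^+ 4 * Phi)) +
   2 * (2 ^+ kap * (((2 ^+ j)^-1 * L%:R) ^+ 2 * Phi)) =
   (4 * (1 + C) / 2 ^+ kap + 2) / 2 ^+ kap * Phi.
  by rewrite LE; field; rewrite !gt_eqF.
rewrite ler_wpM2r// ler_wpM2r ?invr_ge0 ?exprn_ge0//.
have : 4 * (1 + C) / 2 ^+ kap <= 4 * (1 + C).
  by rewrite ler_pdivrMr// ler_peMr ?mulr_ge0 ?addr_ge0// exprn_ege1// ler1n.
move=> h; have -> : 6 + 4 * C = 4 * (1 + C) + 2 by ring.
by rewrite lerD2r.
Qed.

End BlockSquare.

(** * Interpolation between the sup, l2 and l1 bounds *)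

Section Interpolation.
Variable R : realType.
Local Notation cm := (@cmodulus R).

Lemma sum_geometric_below (s t0 v : R) (H : nat) : 0 < s -> 0 < t0 ->
  \sum_(0 <= l < H | t0 * 2 ^+ l < v) (t0 * 2 ^+ l) `^ s <=
    (1 - 2 `^ (- s))^-1 * v `^ s.
Proof.
move=> s0 t00; set c := (1 - _)^-1.
have q0 : 0 < 2 `^ (- s) :> R by rewrite powR_gt0.
have q1 : 2 `^ (- s) < 1 :> R.
  rewrite powRN invf_lt1 ?powR_gt0//.
  have := @gt0_ltr_powR R s s0 1 2; rewrite powR1; apply => //;
    by rewrite ?inE ?nnegrE ?ltr1n.
have c0 : 0 < c by rewrite invr_gt0 subr_gt0.
have cE : c * 2 `^ (- s) + 1 = c.
  by rewrite /c; field; rewrite subr_eq0 gt_eqF.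
have tpos l : 0 < t0 * 2 ^+ l by rewrite mulr_gt0 ?exprn_gt0.
have full h : \sum_(0 <= l < h.+1) (t0 * 2 ^+ l) `^ s <= c * (t0 * 2 ^+ h) `^ s.
  elim: h => [|h IHh].
    rewrite big_nat1 expr0 mulr1 ler_peMl ?powR_ge0//.
    by rewrite -cE lerDr mulr_ge0 ?ltW.
  rewrite big_nat_recr//= (le_trans (lerD IHh (lexx _)))//.
  have -> : t0 * 2 ^+ h = 2^-1 * (t0 * 2 ^+ h.+1).
    by rewrite exprS; field.
  rewrite (@powRM _ 2^-1 (t0 * 2 ^+ h.+1)) ?invr_ge0 ?(ltW (tpos _))//.
  have -> : 2^-1 `^ s = 2 `^ (- s) :> R.
    by rewrite -powR_inv1// -powRrM mulN1r.
  by rewrite mulrA -{2}[_ `^ s]mul1r -mulrDl cE.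
elim: H => [|H IHH]; first by rewrite big_geq// mulr_ge0 ?powR_ge0 ?ltW.
have [vt|tv] := leP v (t0 * 2 ^+ H).
  by rewrite big_mkcond big_nat_recr//= ltNge vt /= addr0 -big_mkcond.
apply: (@le_trans _ _ (\sum_(0 <= l < H.+1) (t0 * 2 ^+ l) `^ s)).
  rewrite [leLHS]big_mkcond /=; apply: ler_sum => l _.
  by case: ifP => // _; rewrite powR_ge0.
apply: (le_trans (full H)); rewrite ler_pM2l//.
have := @ge0_ler_powR R s (ltW s0) (t0 * 2 ^+ H) v; rewrite !nnegrE; apply.
- exact/ltW.
- by rewrite ltW// (lt_trans (tpos H)).
- exact: ltW.
Qed.

Lemma dyadic_level (t0 b : R) (H : nat) : t0 < b -> b <= t0 * 2 ^+ H ->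
  exists2 l, (l < H)%N & t0 * 2 ^+ l < b <= 2 * (t0 * 2 ^+ l).
Proof.
move=> tb; elim: H => [|H IHH]; first by rewrite expr0 mulr1 leNgt tb.
have [/IHH[l lH hl] _|h1 h2] := leP b (t0 * 2 ^+ H); first by exists l => //; exact: ltnW.
by exists H => //; rewrite h1/= mulrCA -exprS.
Qed.

(** Either [bm] is at least $t/4$, and is used squared, or [bb] exceeds $t/2$, and is used
    linearly. *)
Lemma level_split (p1 p2 p t bm bb : R) : 0 < t -> 0 <= p1 -> 0 <= p2 ->
  0 <= bm -> 0 <= bb -> p = p1 * t -> p = p2 * t ^+ 2 ->
  t < t / 4 + (bm + bb) -> p <= 16 * p2 * bm ^+ 2 + 4 * p1 * bb.
Proof.
move=> t0 p10 p20 bm0 bb0 e1 e2 h; have [h2|h2] := leP (t / 4) bm.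
  have h3 : t ^+ 2 <= 16 * bm ^+ 2 by nra.
  have := ler_wpM2l p20 h3; have : 0 <= p1 * bb by rewrite mulr_ge0.
  by rewrite e2; lra.
have h3 : t <= 4 * bb by lra.
have := ler_wpM2l p10 h3.
have : 0 <= p2 * bm ^+ 2 by rewrite mulr_ge0 ?exprn_ge0.
by rewrite e1; lra.
Qed.

Definition interpolation_constant (r : R) : R :=
  2 `^ r * (16 * 4 `^ r * (1 - 2 `^ (- r))^-1 + 4 * (1 - 2 `^ (- (r - 1)))^-1).

Lemma interpolation_constant_ge0 r : 1 < r -> 0 <= interpolation_constant r.
Proof.
move=> r1; have lt1 (s : R) : 0 < s -> 2 `^ (- s) <= 1.
  by move=> s0; rewrite -[leRHS](powRr0 2) ler_powR ?ler1n// oppr_le0 ltW.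
rewrite /interpolation_constant mulr_ge0 ?powR_ge0// addr_ge0//.
  by rewrite !mulr_ge0 ?powR_ge0// invr_ge0 subr_ge0 lt1//; lra.
by rewrite mulr_ge0// invr_ge0 subr_ge0 lt1//; lra.
Qed.

(* At height [t] the function is split into its parts of size at most [t / 4],
   between [t / 4] and [gam * t], and above [gam * t], on which the sup, l2 and
   l1 bounds are used respectively. *)
Lemma interpolation (B : (nat -> R[i]) -> nat -> R) (Z : pred nat) (V : nat)
    (r theta gam : R) (f : nat -> R[i]) :
  1 < r -> 0 <= theta -> 1 <= gam ->
  (forall g x, 0 <= B g x) ->
  (forall g h x, B (fun y => g y + h y) x <= B g x + B h x) ->
  (forall g x t, (forall y, cm (g y) <= t) -> B g x <= t) ->
  (forall g, (forall y, Z y -> g y = 0) ->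
    \sum_(0 <= x < V) B g x ^+ 2 <= theta * \sum_(0 <= y < V) cm (g y) ^+ 2) ->
  (forall g, (forall y, Z y -> g y = 0) ->
    \sum_(0 <= x < V) B g x <= \sum_(0 <= y < V) cm (g y)) ->
  (forall y, (V <= y)%N -> f y = 0) -> (forall y, Z y -> f y = 0) ->
  \sum_(0 <= x < V) (B f x) `^ r <=
    interpolation_constant r * (theta * gam ^+ 2 + gam `^ (1 - r)) *
    \sum_(0 <= y < V) (cm (f y)) `^ r.
Proof.
move=> r1 th0 gam1 B0 Badd Binf B2 B1 fV fZ.
have r0 : 0 < r by lra.
have r10 : 0 < r - 1 by rewrite subr_gt0.
have gam0 : 0 < gam by lra.
set Psi := \sum_(0 <= y < V) (cm (f y)) `^ r.
have Psi0 : 0 <= Psi by apply: sumr_ge0 => y _; rewrite powR_ge0.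
apply/ler_addgt0Pr => eps eps0.
(* Values of [B f] up to [t0] contribute at most [eps] in total. As [B f] is bounded by [U],
   finitely many dyadic heights $t_0 2^l$ remain. *)
pose t0 := (eps / V.+1%:R) `^ r^-1.
have t00 : 0 < t0 by rewrite /t0 powR_gt0// divr_gt0.
have t0r : V%:R * t0 `^ r <= eps.
  rewrite /t0 -powRrM mulVf ?gt_eqF// powRr1; last by rewrite divr_ge0 ?ltW.
  rewrite mulrCA ler_piMr ?(ltW eps0)// ler_pdivrMr ?ltr0n// mul1r ler_nat//.
pose U := \sum_(0 <= y < V) cm (f y).
have fU y : cm (f y) <= U.
  have [Vy|yV] := leqP V y.
    by rewrite fV// cmodulus0 sumr_ge0// => z _; exact: cmodulus_ge0.
  rewrite /U (bigD1_seq y) ?mem_index_iota ?iota_uniq//= lerDl sumr_ge0// => z _.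
  exact: cmodulus_ge0.
pose H := (Num.truncn (U / t0)).+1.
have UH : U <= t0 * 2 ^+ H.
  rewrite mulrC -ler_pdivrMr// (le_trans (ltW (truncnS_gt _)))// -natrX ler_nat.
  by rewrite ltnW// ltn_expl.
pose t l := t0 * 2 ^+ l.
have tpos l : 0 < t l by rewrite mulr_gt0 ?exprn_gt0.
pose fs l y := if cm (f y) <= t l / 4 then f y else 0.
pose fm l y := if t l / 4 < cm (f y) <= gam * t l then f y else 0.
pose fb l y := if gam * t l < cm (f y) then f y else 0.
have fE l : f = fun y => fs l y + (fm l y + fb l y).
  apply/funext => y; rewrite /fs /fm /fb; case: leP => h1 /=.
    have hg : cm (f y) <= gam * t l.
      apply: (le_trans h1); rewrite ler_pdivrMr// [_ * 4]mulrC mulrA.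
      by rewrite ler_peMl ?(ltW (tpos l))//; move: gam1; clear; lra.
    by rewrite (ltNge (gam * t l)) hg /= !addr0.
  by case: leP => h2; rewrite ?addr0 ?add0r.
have pointwise x : (B f x) `^ r <= t0 `^ r + 2 `^ r * \sum_(0 <= l < H)
    (16 * (t l) `^ (r - 2) * B (fm l) x ^+ 2 + 4 * (t l) `^ (r - 1) * B (fb l) x).
  have terms0 l : 0 <= 16 * (t l) `^ (r - 2) * B (fm l) x ^+ 2 +
      4 * (t l) `^ (r - 1) * B (fb l) x.
    by rewrite addr_ge0 ?mulr_ge0 ?powR_ge0 ?exprn_ge0.
  have mono (u w : R) : 0 <= u -> u <= w -> u `^ r <= w `^ r.
    move=> u0 uw; have := @ge0_ler_powR R r (ltW r0) u w; rewrite !nnegrE; apply => //.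
    exact: le_trans uw.
  have [bt|tb] := leP (B f x) t0.
    rewrite (le_trans (mono _ _ (B0 f x) bt))// lerDl mulr_ge0 ?powR_ge0//.
    by apply: sumr_ge0.
  have bH : B f x <= t0 * 2 ^+ H by apply: le_trans UH; exact: Binf.
  have [l lH /andP[tl bl]] := dyadic_level tb bH; rewrite -/(t l) in tl bl.
  apply: (le_trans (mono _ _ (B0 f x) bl)); rewrite powRM ?(ltW (tpos l))//.
  rewrite ler_wpDl ?powR_ge0// ler_wpM2l ?powR_ge0//.
  rewrite (bigD1_seq l) ?mem_index_iota ?iota_uniq//=.
  apply: (@le_trans _ _ (16 * (t l) `^ (r - 2) * B (fm l) x ^+ 2 +
      4 * (t l) `^ (r - 1) * B (fb l) x)); last by rewrite lerDl sumr_ge0.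
  have e1 : (t l) `^ r = (t l) `^ (r - 1) * t l by rewrite mulrC mulr_powRB1// ltW.
  have e2 : (t l) `^ r = (t l) `^ (r - 2) * t l ^+ 2.
    rewrite -powR_mulrn ?(ltW (tpos l))// -powRD ?subrK//.
    by rewrite (gt_eqF (tpos l)) implybT.
  have h1 : t l < t l / 4 + (B (fm l) x + B (fb l) x).
    apply: (lt_le_trans tl); rewrite {1}(fE l).
    apply: (le_trans (Badd _ _ _)); apply: lerD; last exact: Badd.
    by apply: Binf => y; rewrite /fs; case: ifP => // _; rewrite cmodulus0 divr_ge0 ?ltW.
  exact: (level_split (tpos l) (powR_ge0 _ _) (powR_ge0 _ _) (B0 _ _) (B0 _ _) e1 e2 h1).
apply: (le_trans (ler_sum _ (fun x _ => pointwise x))).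
rewrite big_split /= sumr_const_nat subn0 -[_ *+ V]mulr_natl addrC.
apply: lerD => //; rewrite -mulr_sumr exchange_big /= /interpolation_constant -!mulrA.
rewrite ler_wpM2l ?powR_ge0//.
set cr := (1 - 2 `^ (- r))^-1; set cr1 := (1 - 2 `^ (- (r - 1)))^-1.
have cr0 : 0 <= cr.
  by rewrite invr_ge0 subr_ge0 -[leRHS](powRr0 2) ler_powR ?ler1n// oppr_le0 ltW.
have cr10 : 0 <= cr1.
  by rewrite invr_ge0 subr_ge0 -[leRHS](powRr0 2) ler_powR ?ler1n// oppr_le0 subr_ge0 ltW.
(* For fixed [y] only heights with $t_l < 4|f(y)|$ occur, and the sum of $t_l^r$ over them is at
   most a multiple of $(4|f(y)|)^r$. *)
have main_m : \sum_(0 <= l < H) 16 * (t l) `^ (r - 2) * \sum_(0 <= x < V) B (fm l) x ^+ 2 <=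
    16 * 4 `^ r * cr * (theta * gam ^+ 2) * Psi.
  apply: (@le_trans _ _ (\sum_(0 <= l < H) \sum_(0 <= y < V)
      16 * theta * gam ^+ 2 * (if t l < 4 * cm (f y) then (t l) `^ r else 0))).
    apply: ler_sum => l _.
    apply: (@le_trans _ _ (16 * (t l) `^ (r - 2) * (theta * \sum_(0 <= y < V) cm (fm l y) ^+ 2))).
      rewrite ler_wpM2l ?mulr_ge0 ?powR_ge0//; apply: B2 => y Zy.
      by rewrite /fm fZ//; case: ifP.
    rewrite mulrA mulr_sumr; apply: ler_sum => y _; rewrite /fm.
    case: ifP => [/andP[h1 h2]|_]; last first.
      rewrite cmodulus0 expr0n mulr0 !mulr_ge0 ?exprn_ge0 ?(ltW gam0)//.
      by case: ifP => // _; rewrite powR_ge0.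
    have -> : t l < 4 * cm (f y) by rewrite mulrC -ltr_pdivrMr.
    have e2 : (t l) `^ r = (t l) `^ (r - 2) * t l ^+ 2.
      rewrite -powR_mulrn ?(ltW (tpos l))// -powRD ?subrK//.
      by rewrite (gt_eqF (tpos l)) implybT.
    have h3 : cm (f y) ^+ 2 <= (gam * t l) ^+ 2.
      by rewrite lerXn2r ?nnegrE ?cmodulus_ge0// mulr_ge0 ?ltW.
    rewrite e2; have -> : 16 * theta * gam ^+ 2 * (t l `^ (r - 2) * t l ^+ 2) =
      16 * t l `^ (r - 2) * theta * (gam * t l) ^+ 2 by ring.
    by rewrite ler_wpM2l// !mulr_ge0 ?powR_ge0.
  rewrite exchange_big /= /Psi mulr_sumr; apply: ler_sum => y _.
  rewrite -mulr_sumr -big_mkcond /=.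
  have h := @sum_geometric_below r t0 (4 * cm (f y)) H r0 t00.
  have k0 : 0 <= 16 * theta * gam ^+ 2 by rewrite !mulr_ge0 ?exprn_ge0 ?(ltW gam0).
  apply: (le_trans (ler_wpM2l k0 h)); rewrite powRM ?cmodulus_ge0// -/cr.
  rewrite le_eqVlt; apply/orP; left; apply/eqP; ring.
(* Here $t_l < |f(y)|/\gamma$; the exponent $r - 1 > 0$ keeps the sum geometric and produces
   $\gamma^{1-r}$. *)
have main_b : \sum_(0 <= l < H) 4 * (t l) `^ (r - 1) * \sum_(0 <= x < V) B (fb l) x <=
    4 * cr1 * gam `^ (1 - r) * Psi.
  apply: (@le_trans _ _ (\sum_(0 <= l < H) \sum_(0 <= y < V)
      4 * cm (f y) * (if t l < cm (f y) / gam then (t l) `^ (r - 1) else 0))).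
    apply: ler_sum => l _.
    apply: (@le_trans _ _ (4 * (t l) `^ (r - 1) * \sum_(0 <= y < V) cm (fb l y))).
      rewrite ler_wpM2l ?mulr_ge0 ?powR_ge0//; apply: B1 => y Zy.
      by rewrite /fb fZ//; case: ifP.
    rewrite mulr_sumr; apply: ler_sum => y _; rewrite /fb.
    rewrite ltr_pdivlMr// [t l * gam]mulrC; case: ifP => _; last by rewrite cmodulus0 !mulr0.
    by rewrite mulrAC.
  rewrite exchange_big /= /Psi mulr_sumr; apply: ler_sum => y _.
  rewrite -mulr_sumr -big_mkcond /=.
  have h := @sum_geometric_below (r - 1) t0 (cm (f y) / gam) H r10 t00.
  have k0 : 0 <= 4 * cm (f y) by rewrite mulr_ge0 ?cmodulus_ge0.
  apply: (le_trans (ler_wpM2l k0 h)); rewrite -/cr1 powRM ?cmodulus_ge0 ?invr_ge0 ?(ltW gam0)//.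
  have -> : gam^-1 `^ (r - 1) = gam `^ (1 - r).
    by rewrite -powR_inv1 ?(ltW gam0)// -powRrM mulN1r opprB.
  rewrite -[in leRHS](mulr_powRB1 (cmodulus_ge0 (f y)) r0).
  rewrite le_eqVlt; apply/orP; left; apply/eqP; ring.
rewrite (eq_bigr (fun l => 16 * (t l) `^ (r - 2) * \sum_(0 <= x < V) B (fm l) x ^+ 2 +
  4 * (t l) `^ (r - 1) * \sum_(0 <= x < V) B (fb l) x)); last first.
  by move=> l _; rewrite big_split /= -!mulr_sumr.
rewrite big_split /=; apply: (le_trans (lerD main_m main_b)).
have p1 : 0 <= 16 * 4 `^ r * cr * gam `^ (1 - r) * Psi.
  by rewrite !mulr_ge0 ?powR_ge0.
have p2 : 0 <= 4 * cr1 * (theta * gam ^+ 2) * Psi.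
  by rewrite !mulr_ge0 ?exprn_ge0 ?(ltW gam0).
have -> : (16 * (4 `^ r * cr) + 4 * cr1) * ((theta * gam ^+ 2 + gam `^ (1 - r)) * Psi) =
  16 * 4 `^ r * cr * (theta * gam ^+ 2) * Psi + 4 * cr1 * gam `^ (1 - r) * Psi +
  (16 * 4 `^ r * cr * gam `^ (1 - r) * Psi + 4 * cr1 * (theta * gam ^+ 2) * Psi) by ring.
by rewrite lerDl addr_ge0.
Qed.

End Interpolation.

(** * Summation of the block maxima in l^r *)

Section StrongType.
Variables (R : realType) (a : nat -> R[i]) (e : nat) (C : R).
Local Notation cm := (@cmodulus R).
Hypothesis C0 : 0 <= C.
Hypothesis e2 : (2 < e)%N.
Hypothesis a_le : forall n, (0 < n)%N -> cm (a n) <= n%:R^-1.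
Hypothesis a_corr : decorrelated a e C.

Lemma block_max_le_avg (f : nat -> R[i]) j x :
  block_max a f j x <= (2 ^+ j)^-1 * \sum_(2 ^ j <= n < 2 ^ j.+1) cm (f (x + n)%N).
Proof.
have p0 : 0 <= (2 ^+ j)^-1 :> R by rewrite invr_ge0 exprn_ge0.
apply: block_max_le.
  by rewrite mulr_ge0// sumr_ge0// => n _; exact: cmodulus_ge0.
move=> N /andP[jN Nj]; apply: (le_trans (cmodulus_sum _ _ _)).
rewrite mulr_sumr.
apply: (@le_trans _ _ (\sum_(N <= n < 2 ^ j.+1) (2 ^+ j)^-1 * cm (f (x + n)%N))).
  apply: ler_sum_nat_cond => n /andP[Nn _] _; rewrite cmodulusM ler_wpM2r ?cmodulus_ge0//.
  have jn := leq_trans jN Nn; have n0 : (0 < n)%N by apply: leq_trans jn; rewrite expn_gt0.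
  apply: (le_trans (a_le n0)).
  by rewrite lef_pV2 ?posrE ?ltr0n ?exprn_gt0// -natrX ler_nat.
by apply: sum_nat_subinterval => // n; rewrite mulr_ge0 ?cmodulus_ge0.
Qed.

Lemma block_max_sup (f : nat -> R[i]) j x (t : R) :
  (forall y, cm (f y) <= t) -> block_max a f j x <= t.
Proof.
move=> ft; apply: (le_trans (block_max_le_avg _ _ _)).
apply: (@le_trans _ _ ((2 ^+ j)^-1 * \sum_(2 ^ j <= n < 2 ^ j.+1) t)).
  by rewrite ler_wpM2l ?invr_ge0 ?exprn_ge0//; apply: ler_sum.
rewrite sumr_const_nat expnS mul2n -addnn addnK -[X in _ * X]mulr_natl natrX mulrA.
by rewrite mulVf ?mul1r// expf_neq0.
Qed.

Lemma block_max_l1 (f : nat -> R[i]) j W : (forall y, (W <= y)%N -> f y = 0) ->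
  \sum_(0 <= x < W) block_max a f j x <= \sum_(0 <= y < W) cm (f y).
Proof.
move=> fW; apply: (le_trans (ler_sum _ (fun x _ => block_max_le_avg f j x))).
rewrite -mulr_sumr exchange_big /=.
apply: (@le_trans _ _ ((2 ^+ j)^-1 *
    \sum_(2 ^ j <= n < 2 ^ j.+1) \sum_(0 <= y < W) cm (f y))).
  rewrite ler_wpM2l ?invr_ge0 ?exprn_ge0//; apply: ler_sum => n _.
  rewrite -(big_nat_shift (fun y => cm (f y))); apply: sum_le_supp => y.
    exact: cmodulus_ge0.
  by move=> Wy; rewrite fW// cmodulus0.
rewrite sumr_const_nat expnS mul2n -addnn addnK -[X in _ * X]mulr_natl natrX mulrA.
by rewrite mulVf ?mul1r// expf_neq0.
Qed.

Lemma block_maxD (f g : nat -> R[i]) j x :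
  block_max a (fun y => f y + g y) j x <= block_max a f j x + block_max a g j x.
Proof.
apply: block_max_le; first by rewrite addr_ge0 ?block_max_ge0.
move=> N /andP[jN Nj]; under eq_bigr do rewrite mulrDr.
rewrite big_split /= (le_trans (cmodulusD _ _))//.
by apply: lerD; apply: block_max_ge; rewrite jN ltnW.
Qed.

Lemma sum_expr_div (s : R) (D J : nat) : 0 <= s -> s < 1 -> (0 < D)%N ->
  \sum_(0 <= j < J) s ^+ (j %/ D) <= D%:R / (1 - s).
Proof.
move=> s0 s1 D0; have d0 : 0 < 1 - s by rewrite subr_gt0.
apply: (@le_trans _ _ (\sum_(0 <= j < J * D) (fun q => s ^+ q) (j %/ D)%N)).
  apply: sum_nat_subinterval => //; last by rewrite leq_pmulr.
  by move=> n; rewrite exprn_ge0.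
rewrite sum_divn_range// -[_ *+ D]mulr_natl ler_wpM2l//.
suff H : \sum_(0 <= q < J) s ^+ q = (1 - s ^+ J) / (1 - s).
  by rewrite H -[leRHS]mul1r ler_wpM2r ?invr_ge0 ?(ltW d0)// gerBl exprn_ge0.
elim: J => [|J IHJ]; first by rewrite big_geq// expr0 subrr mul0r.
by rewrite big_nat_recr//= IHJ exprS; field; rewrite gt_eqF.
Qed.

Lemma strong_type_nat (r : R) : 1 < r -> exists2 K : R, 0 <= K &
  forall (f : nat -> R[i]) (W J : nat),
  (forall y, (W <= y)%N -> f y = 0) ->
  (forall y, (y < 2 ^ J)%N -> f y = 0) ->
  \sum_(0 <= x < W) (\sum_(0 <= j < J) block_max a f j x) `^ r <=
    K * \sum_(0 <= y < W) (cm (f y)) `^ r.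
Proof.
move=> r1; have r0 : 0 < r := lt_trans ltr01 r1.
(* With $\theta$ of order $2^{-\kappa}$, $\nu = \lfloor \kappa/4 \rfloor$ and $\gamma = 2^\nu$,
   interpolation yields $2^{2\nu-\kappa} \le 2^{-\nu}$ and $\gamma^{1-r} = (2^{1-r})^\nu$: a decay
   $\rho^\nu$. *)
pose rho : R := Num.max 2^-1 (2 `^ (1 - r)).
have p1 : 2 `^ (1 - r) < 1 :> R.
  rewrite -opprB powRN invf_lt1 ?powR_gt0//.
  have := @gt0_ltr_powR R (r - 1) _ 1 2; rewrite subr_gt0 powR1; apply => //;
    by rewrite ?inE ?nnegrE ?ltr1n.
have rho0 : 0 < rho by rewrite /rho lt_max invr_gt0 ltr0n.
have rho1 : rho < 1 by rewrite /rho gt_max p1 andbT invf_lt1// ltr1n.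
(* Of $\rho = \sigma^2$, one factor is spent on the weights of the pointwise bound below, and the
   other makes the sum over [j] converge. *)
pose sig := Num.sqrt rho.
have sig0 : 0 < sig by rewrite sqrtr_gt0.
have sig2 : sig ^+ 2 = rho by rewrite sqr_sqrtr// ltW.
have sig1 : sig < 1 by rewrite -(ltr_pXn2r (n := 2)) ?nnegrE ?(ltW sig0)// sig2 expr1n.
pose vt := sig `^ r^-1.
have vt0 : 0 < vt by rewrite powR_gt0.
have vtr : vt `^ r = sig by rewrite /vt -powRrM mulVf ?gt_eqF// powRr1// ltW.
have vt1 : vt < 1.
  rewrite ltNge; apply/negP => h; have := sig1; rewrite -vtr ltNge => /negP; apply.
  have := @ge0_ler_powR R r (ltW r0) 1 vt; rewrite powR1; apply => //;
    by rewrite nnegrE ?ltW.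
pose D := (e * 4)%N; have D0 : (0 < D)%N by rewrite muln_gt0 (leq_trans _ e2).
pose Kr := interpolation_constant r * (7 + 4 * C).
have Kr0 : 0 <= Kr.
  apply: mulr_ge0; first exact: interpolation_constant_ge0.
  by rewrite addr_ge0 ?mulr_ge0.
pose K := (D%:R / (1 - vt)) `^ r * (Kr * (D%:R / (1 - sig))).
have q0 : 0 <= D%:R / (1 - sig) by rewrite divr_ge0// subr_ge0 ltW.
exists K.
  by apply: mulr_ge0; [exact: powR_ge0|exact: mulr_ge0].
move=> f W J fW fJ; set Psi := \sum_(0 <= y < W) (cm (f y)) `^ r.
have Psi0 : 0 <= Psi by apply: sumr_ge0 => y _; rewrite powR_ge0.
have block j : (j < J)%N -> \sum_(0 <= x < W) (block_max a f j x) `^ r <=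
    Kr * rho ^+ (j %/ D) * Psi.
  move=> jJ; pose kap := (j %/ e)%N; pose nu := (kap %/ 4)%N.
  have nuE : (j %/ D = nu)%N by rewrite /D divnMA.
  pose theta := (6 + 4 * C) / 2 ^+ kap; pose gam : R := 2 ^+ nu.
  have th0 : 0 <= theta by rewrite divr_ge0 ?exprn_ge0 ?addr_ge0 ?mulr_ge0.
  have gam1 : 1 <= gam by rewrite exprn_ege1// ler1n.
  (* The square estimate asks for vanishing on this set, a property that the truncations of [f] in
     height inherit. *)
  pose Z y := (y < 2 ^ j.+1)%N || (W <= y)%N.
  have fZ y : Z y -> f y = 0.
    case/orP => [h|/fW//]; apply: fJ; apply: (leq_trans h).
    by rewrite leq_exp2l.
  apply: (le_trans (@interpolation R (fun f => block_max a f j) Z W r theta gam f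
      r1 th0 gam1 _ _ _ _ _ fW fZ)).
  - by move=> g x; exact: block_max_ge0.
  - by move=> g h x; exact: block_maxD.
  - by move=> g x t gt; exact: block_max_sup.
  - by move=> g gZ; apply: block_max_l2 => //.
  - by move=> g gZ; apply: block_max_l1 => y Wy; apply: gZ; rewrite /Z Wy orbT.
  rewrite ler_wpM2r// /Kr -[leRHS]mulrA ler_wpM2l ?interpolation_constant_ge0//.
  rewrite nuE; have -> : (7 + 4 * C) * rho ^+ nu = (6 + 4 * C) * rho ^+ nu + rho ^+ nu.
    by ring.
  apply: lerD.
    apply: (@le_trans _ _ ((6 + 4 * C) * (2^-1) ^+ nu)); last first.
      rewrite ler_wpM2l ?addr_ge0 ?mulr_ge0// lerXn2r ?nnegrE ?invr_ge0 ?(ltW rho0)//.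
      by rewrite le_max lexx.
    rewrite /theta -mulrA ler_wpM2l ?addr_ge0 ?mulr_ge0//.
    rewrite exprVn ler_pdivrMl ?exprn_gt0// ler_pdivlMr ?exprn_gt0//.
    rewrite /gam -exprM -exprD ler_weXn2l ?ler1n//.
    have : (nu * 4 <= kap)%N by rewrite leq_trunc_div.
    by clear; lia.
  rewrite /gam -(powR_mulrn nu (ler0n R 2)) -powRrM mulrC powRrM.
  rewrite powR_mulrn ?powR_ge0// lerXn2r ?nnegrE ?powR_ge0 ?(ltW rho0)//.
  by rewrite le_max lexx orbT.
(* Each block maximum is at most $(\sigma^{\lfloor j/D \rfloor} Q)^{1/r}$, and these bounds have a
   geometric sum; this takes the place of the triangle inequality in l^r. *)
have pointwise x : (\sum_(0 <= j < J) block_max a f j x) `^ r <=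
    (D%:R / (1 - vt)) `^ r *
    \sum_(0 <= j < J) (block_max a f j x) `^ r / sig ^+ (j %/ D).
  set Q := \sum_(0 <= j < J) _ / _.
  have tm0 j : 0 <= (block_max a f j x) `^ r / sig ^+ (j %/ D).
    by rewrite divr_ge0 ?powR_ge0 ?exprn_ge0 ?ltW.
  have Q0 : 0 <= Q by apply: sumr_ge0.
  have mono (s u w : R) : 0 <= s -> 0 <= u -> u <= w -> u `^ s <= w `^ s.
    move=> s0 u0 uw; have := @ge0_ler_powR R s s0 u w; rewrite !nnegrE; apply => //.
    exact: le_trans uw.
  have bj j : (j < J)%N -> block_max a f j x <= vt ^+ (j %/ D) * Q `^ r^-1.
    move=> jJ; have b0 := block_max_ge0 a f j x.
    have h : (block_max a f j x) `^ r <= sig ^+ (j %/ D) * Q.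
      rewrite mulrC -ler_pdivrMr ?exprn_gt0//.
      by rewrite /Q (bigD1_seq j) ?mem_index_iota ?iota_uniq//= lerDl sumr_ge0.
    have ri0 : 0 <= r^-1 by rewrite invr_ge0 ltW.
    have := mono r^-1 _ _ ri0 (powR_ge0 _ _) h.
    rewrite -powRrM mulfV ?gt_eqF// powRr1//.
    rewrite powRM ?exprn_ge0 ?(ltW sig0)//.
    have -> : (sig ^+ (j %/ D)) `^ r^-1 = vt ^+ (j %/ D).
      by rewrite -(powR_mulrn _ (ltW sig0)) powRAC powR_mulrn ?powR_ge0.
    by [].
  have s0 : 0 <= \sum_(0 <= j < J) block_max a f j x.
    by apply: sumr_ge0 => j _; exact: block_max_ge0.
  have h : \sum_(0 <= j < J) block_max a f j x <= D%:R / (1 - vt) * Q `^ r^-1.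
    apply: (@le_trans _ _ (\sum_(0 <= j < J) vt ^+ (j %/ D) * Q `^ r^-1)).
      by apply: ler_sum_nat_cond => j /andP[_ jJ] _; exact: bj.
    by rewrite -mulr_suml ler_wpM2r ?powR_ge0// sum_expr_div// ltW.
  apply: (le_trans (mono r _ _ (ltW r0) s0 h)).
  rewrite powRM ?powR_ge0 ?divr_ge0 ?subr_ge0 ?(ltW vt1)//.
  by rewrite -(powRrM Q) mulVf ?gt_eqF// powRr1.
apply: (le_trans (ler_sum _ (fun x _ => pointwise x))).
rewrite -mulr_sumr /K -[leRHS]mulrA ler_wpM2l ?powR_ge0// exchange_big /=.
apply: (@le_trans _ _ (\sum_(0 <= j < J) Kr * Psi * sig ^+ (j %/ D))).
  apply: ler_sum_nat_cond => j /andP[_ jJ] _; rewrite -mulr_suml.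
  rewrite ler_pdivrMr ?exprn_gt0//; apply: (le_trans (block j jJ)).
  rewrite -sig2 -exprM mulnC exprM expr2.
  by rewrite le_eqVlt; apply/orP; left; apply/eqP; ring.
rewrite -mulr_sumr; apply: (@le_trans _ _ (Kr * Psi * (D%:R / (1 - sig)))).
  apply: ler_wpM2l; first exact: mulr_ge0.
  by apply: sum_expr_div => //; exact: ltW.
by rewrite le_eqVlt; apply/orP; left; apply/eqP; ring.
Qed.

End StrongType.

(** * Transference and convergence *)

Section Transference.
Context d (X : measurableType d) (R : realType).
Variables (mu : {measure set X -> \bar R}) (tau : int -> X -> X).
Hypothesis htau : measure_preserving_Zaction mu tau.

Lemma integral_Zaction (k : int) (g : X -> \bar R) :
  measurable_fun setT g -> (forall x, 0 <= g x)%E ->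
  (\int[mu]_x g (tau k x) = \int[mu]_x g x)%E.
Proof.
move=> mg g0; have mk := Zact_measurable htau k.
have := ge0_integral_pushforward mk mu measurableT mg (fun x _ => g0 x).
rewrite preimage_setT => <-.
by apply: eq_measure_integral => A mA _; exact: (Zact_preserving htau).
Qed.

Lemma integral_orbit_sum (g : X -> R) (W : nat) :
  measurable_fun setT g -> (forall x, 0 <= g x) ->
  (\int[mu]_x (\sum_(0 <= k < W) g (tau k%:Z x))%:E =
    W%:R%:E * \int[mu]_x (g x)%:E)%E.
Proof.
move=> mg g0.
have mgk k : measurable_fun setT (fun x => (g (tau k%:Z x))%:E).
  apply/measurable_EFinP; apply: (measurableT_comp mg).
  exact: (Zact_measurable htau).
under eq_integral do rewrite -sumEFin.
rewrite ge0_integral_sum//; last by move=> k x _; rewrite lee_fin.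
under eq_bigr => k _.
  rewrite (@integral_Zaction k%:Z (fun x => (g x)%:E)).
  over.
- exact/measurable_EFinP.
- by move=> x; rewrite lee_fin.
rewrite big_const_nat subn0; elim: W => [|W IH] /=; first by rewrite mul0e.
rewrite IH -natr1 EFinD ge0_muleDl ?lee_fin// mul1e.
by rewrite addeC.
Qed.

(** Integrating the orbit inequality and using invariance gives $W \int \varphi \le c (W + L) \int
    \psi$; a large [W] makes [L] negligible. *)
Lemma transference (phi psi : X -> R) (L : nat) (c : R) :
  measurable_fun setT phi -> measurable_fun setT psi ->
  (forall x, 0 <= phi x) -> (forall x, 0 <= psi x) -> 0 <= c ->
  (\int[mu]_x (psi x)%:E < +oo)%E ->
  (forall x W, \sum_(0 <= k < W) phi (tau k%:Z x) <=
    c * \sum_(0 <= k < W + L) psi (tau k%:Z x)) ->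
  (\int[mu]_x (phi x)%:E <= c%:E * \int[mu]_x (psi x)%:E)%E.
Proof.
move=> mphi mpsi phi0 psi0 c0 psioo H.
have msum (g : X -> R) (W : nat) : measurable_fun setT g ->
    measurable_fun setT (fun x => \sum_(0 <= k < W) g (tau k%:Z x)).
  move=> mg; apply: measurable_sum => k; apply: (measurableT_comp mg).
  exact: (Zact_measurable htau).
have B0 : (0 <= \int[mu]_x (psi x)%:E)%E.
  by apply: integral_ge0 => x _; rewrite lee_fin.
have A0 : (0 <= \int[mu]_x (phi x)%:E)%E.
  by apply: integral_ge0 => x _; rewrite lee_fin.
have key W : (W%:R%:E * \int[mu]_x (phi x)%:E <=
    c%:E * ((W + L)%:R%:E * \int[mu]_x (psi x)%:E))%E.
  rewrite -!integral_orbit_sum// -ge0_integralZl_EFin//.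
  - apply: ge0_le_integral => //.
    + by move=> x _; rewrite lee_fin sumr_ge0.
    + exact/measurable_EFinP/msum.
    + by apply/measurable_EFinP/measurable_funM => //; exact: msum.
    + by move=> x _; rewrite -EFinM lee_fin.
  - by move=> x _; rewrite lee_fin sumr_ge0.
  - exact/measurable_EFinP/msum.
have Bfin : (\int[mu]_x (psi x)%:E)%E \is a fin_num by rewrite ge0_fin_numE.
(* The case [W = 1] already gives finiteness, so the limit in [W] can be taken among real
   numbers. *)
have Afin : (\int[mu]_x (phi x)%:E)%E \is a fin_num.
  rewrite ge0_fin_numE//; have := key 1%N; rewrite mul1e => /le_lt_trans; apply.
  by rewrite -(fineK Bfin) -!EFinM ltry.
move: key; rewrite -(fineK Bfin) -(fineK Afin) => key.
set A := fine _ in key *; set B := fine _ in key *.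
rewrite -EFinM lee_fin; apply/ler_addgt0Pr => eps eps0.
have B0' : 0 <= B by rewrite fine_ge0.
pose n := (Num.truncn (c * L%:R * B / eps)).+1.
have hn : c * L%:R * B <= eps * n%:R.
  by rewrite [leRHS]mulrC -ler_pdivrMr// ltW// truncnS_gt.
have := key n; rewrite -!EFinM lee_fin natrD => hk.
have n0 : 0 < n%:R :> R by rewrite ltr0n.
rewrite -(ler_pM2l n0) (le_trans hk)//.
have -> : c * ((n%:R + L%:R) * B) = n%:R * (c * B) + c * L%:R * B by ring.
by rewrite mulrDr lerD2l [leRHS]mulrC.
Qed.

End Transference.

(** * Measurability of complex-valued functions *)

Section ComplexMeasurable.
Context d (X : measurableType d) (R : realType).
Implicit Types f g : X -> R[i].

Definition cmeasurable f :=
  measurable_fun setT (fun x => complex.Re (f x)) /\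
  measurable_fun setT (fun x => complex.Im (f x)).

Lemma cmeasurable_cmodulus f :
  cmeasurable f -> measurable_fun setT (fun x => cmodulus (f x)).
Proof.
move=> [mr mi].
rewrite (_ : (fun x => _) =
  (fun x => Num.sqrt (complex.Re (f x) ^+ 2 + complex.Im (f x) ^+ 2))); last first.
  by apply/funext => x; rewrite cmodulus_normc; case: (f x).
apply: (measurableT_comp (continuous_measurable_fun (@sqrt_continuous R))).
by apply: measurable_funD; apply: measurable_funX.
Qed.

Lemma cmeasurable_sum (I : Type) (s : seq I) (F : I -> X -> R[i]) :
  (forall i, cmeasurable (F i)) -> cmeasurable (fun x => \sum_(i <- s) F i x).
Proof.
move=> mF; split.
- under eq_fun do rewrite Re_sum.
  by apply: measurable_sum => i; exact: (mF i).1.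
- under eq_fun do rewrite Im_sum.
  by apply: measurable_sum => i; exact: (mF i).2.
Qed.

Lemma cmeasurableZ (z : R[i]) f : cmeasurable f -> cmeasurable (fun x => z * f x).
Proof.
move=> [mr mi]; case: z => a b; split.
- rewrite (_ : (fun x => _) =
    (fun x => a * complex.Re (f x) - b * complex.Im (f x))); last first.
    by apply/funext => x; case: (f x).
  by apply: measurable_funB; apply: measurable_funM.
- rewrite (_ : (fun x => _) =
    (fun x => a * complex.Im (f x) + b * complex.Re (f x))); last first.
    by apply/funext => x; case: (f x).
  by apply: measurable_funD; apply: measurable_funM.
Qed.

Lemma cmeasurable_comp f (t : X -> X) :
  measurable_fun setT t -> cmeasurable f -> cmeasurable (f \o t).
Proof.
by move=> mt [mr mi]; split; [exact: (measurableT_comp mr)|exact: (measurableT_comp mi)].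
Qed.

End ComplexMeasurable.

Lemma measurable_bigmaxr d (X : measurableType d) (R : realType) (I : Type)
    (s : seq I) (P : pred I) (F : I -> X -> R) :
  (forall i, measurable_fun setT (F i)) ->
  measurable_fun setT (fun x => \big[Num.max/0]_(i <- s | P i) F i x).
Proof.
move=> mF; elim: s => [|i s IH]; first by under eq_fun do rewrite big_nil; exact: measurable_cst.
under eq_fun do rewrite big_cons.
by case: (P i) => //; exact: measurable_maxr.
Qed.

Lemma measurable_superlevel d (X : measurableType d) (R : realType) (g : X -> R) (t : R) :
  measurable_fun setT g -> measurable [set x | t < g x].
Proof.
move=> /measurable_EFinP mg; rewrite -[X in measurable X]setTI.
exact: (emeasurable_fun_o_infty measurableT mg t%:E).
Qed.

(** * Maximal inequalities for finite sums along orbits *)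

Section Orbit.
Context d (X : measurableType d) (R : realType).
Variables (mu : {measure set X -> \bar R}) (tau : int -> X -> X).
Hypothesis htau : measure_preserving_Zaction mu tau.
Variable a : nat -> R[i].
Local Notation cm := (@cmodulus R).
Implicit Types f : X -> R[i].

Definition orbit f x (y : nat) : R[i] := f (tau y%:Z x).

Definition orbit_sum f x N K : R[i] := \sum_(N <= n < K) a n * orbit f x n.

Definition orbit_variation f J x : R := \sum_(0 <= j < J) block_max a (orbit f x) j 0.

Definition exceed f (lam : R) J : set X :=
  [set x | exists2 N, (0 < N)%N & lam < cm (orbit_sum f x N (2 ^ J))].

Lemma orbit_shift f x (k n : nat) : orbit f (tau k%:Z x) n = orbit f x (k + n)%N.
Proof. by rewrite /orbit -(ZactD htau) addrC. Qed.

Lemma cmeasurable_orbit_sum f N K :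
  cmeasurable f -> cmeasurable (fun x => orbit_sum f x N K).
Proof.
move=> mf; apply: cmeasurable_sum => n; apply: cmeasurableZ.
exact/(cmeasurable_comp (Zact_measurable htau _)).
Qed.

Lemma measurable_exceed f lam J : cmeasurable f -> measurable (exceed f lam J).
Proof.
move=> mf.
have -> : exceed f lam J =
    \bigcup_(N in [set N | (0 < N)%N]) [set x | lam < cm (orbit_sum f x N (2 ^ J))].
  by apply/seteqP; split => x /= [N hN h]; exists N.
apply: bigcup_measurable => N _.
apply: measurable_superlevel.
exact/cmeasurable_cmodulus/cmeasurable_orbit_sum.
Qed.

Lemma block_max_ext (f g : nat -> R[i]) j x y :
  (forall n, (n < 2 ^ j.+1)%N -> f (x + n)%N = g (y + n)%N) ->
  block_max a f j x = block_max a g j y.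
Proof.
move=> fg; apply: eq_bigr => N _; congr (cm _).
by apply: eq_big_nat => n /andP[_ hn]; rewrite fg.
Qed.

Lemma measurable_block_max f j :
  cmeasurable f -> measurable_fun setT (fun x => block_max a (orbit f x) j 0).
Proof.
move=> mf; apply: measurable_bigmaxr => N.
exact: (cmeasurable_cmodulus (cmeasurable_orbit_sum N (2 ^ j.+1) mf)).
Qed.

Lemma measurable_orbit_variation f J :
  cmeasurable f -> measurable_fun setT (orbit_variation f J).
Proof. by move=> mf; apply: measurable_sum => j; exact: measurable_block_max. Qed.

Lemma orbit_variation_ge0 f J x : 0 <= orbit_variation f J x.
Proof. by apply: sumr_ge0 => j _; exact: block_max_ge0. Qed.

Lemma weak_type_orbit (A : R) : 0 <= A ->
  (forall (f : nat -> R[i]) (W J : nat) (lam : R), 0 < lam ->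
    (forall y, (W <= y)%N -> f y = 0) ->
    exists2 E : pred nat,
      \sum_(0 <= x < W) (E x)%:R <= A / lam * \sum_(0 <= y < W) cm (f y) &
      forall x N, (x < W)%N -> ~~ E x -> (0 < N)%N ->
        cm (\sum_(N <= n < 2 ^ J) a n * f (x + n)%N) <= lam) ->
  forall f lam J, cmeasurable f -> (\int[mu]_x (cm (f x))%:E < +oo)%E -> 0 < lam ->
  (mu (exceed f lam J) <= (A / lam)%:E * \int[mu]_x (cm (f x))%:E)%E.
Proof.
move=> A0 weak f lam J mf foo lam0.
have mE := measurable_exceed lam J mf.
rewrite -[X in mu X]setIT -integral_indic//.
apply: (transference htau (L := 2 ^ J)) => //.
- exact: cmeasurable_cmodulus.
- by move=> x; exact: cmodulus_ge0.
- by rewrite divr_ge0// ltW.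
(* From the base points [k < W], sums up to $2^J$ see only this segment of the orbit. *)
move=> x W; pose g y := if (y < W + 2 ^ J)%N then orbit f x y else 0.
have [|E hE1 hE2] := weak g (W + 2 ^ J)%N J lam lam0.
  by move=> y hy; rewrite /g ltnNge hy.
have -> : \sum_(0 <= k < W + 2 ^ J) cm (f (tau k%:Z x)) =
    \sum_(0 <= k < W + 2 ^ J) cm (g k).
  by apply: eq_big_nat => k /andP[_ hk]; rewrite /g hk.
apply: le_trans hE1.
rewrite (@big_cat_nat _ _ _ W 0 (W + 2 ^ J))//= ?leq_addr//.
rewrite -[leLHS]addr0 lerD ?sumr_ge0//.
apply: ler_sum_nat => k /andP[_ hk].
rewrite indicE; case: (boolP (E k)) => Ek; first by case: (_ \in _).
rewrite lern0 eqb0 notin_setE => -[N N0]; apply/negP; rewrite -leNgt.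
have := hE2 k N (ltn_addr _ hk) Ek N0; congr (cm _ <= _).
apply: eq_big_nat => n /andP[_ hn].
by rewrite orbit_shift /g (leq_trans (_ : k + n < W + n)%N) ?ltn_add2r// leq_add2l ltnW.
Qed.

Lemma strong_type_orbit (r K : R) : 0 < r -> 0 <= K ->
  (forall (f : nat -> R[i]) (W J : nat),
    (forall y, (W <= y)%N -> f y = 0) ->
    (forall y, (y < 2 ^ J)%N -> f y = 0) ->
    \sum_(0 <= x < W) (\sum_(0 <= j < J) block_max a f j x) `^ r <=
      K * \sum_(0 <= y < W) (cm (f y)) `^ r) ->
  forall f J, cmeasurable f -> (\int[mu]_x (cm (f x) `^ r)%:E < +oo)%E ->
  (\int[mu]_x (orbit_variation f J x `^ r)%:E <=
    K%:E * \int[mu]_x (cm (f x) `^ r)%:E)%E.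
Proof.
move=> r0 K0 strong f J mf foo.
have mpow (h : X -> R) : measurable_fun setT h ->
    measurable_fun setT (fun x => h x `^ r).
  by move=> mh; exact: (measurableT_comp (measurable_powR _)).
apply: (transference htau (L := 2 ^ J)) => //.
- exact/mpow/measurable_orbit_variation.
- exact/mpow/cmeasurable_cmodulus.
- by move=> x; exact: powR_ge0.
- by move=> x; exact: powR_ge0.
move=> x W; pose L := (2 ^ J)%N.
(* The orbit segment is moved to start at [L], since the inequality on the integers asks for
   functions vanishing below $2^J$. *)
pose g y := if (L <= y < L + (W + L))%N then orbit f x (y - L) else 0.
have gE k : (k < W + L)%N -> g (L + k)%N = orbit f x k.
  by move=> hk; rewrite /g leq_addr ltn_add2l hk addKn.
have split_sum (F : nat -> R) : \sum_(0 <= x < L + (W + L)) F x =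
    \sum_(0 <= x < L) F x + \sum_(0 <= k < W + L) F (L + k)%N.
  rewrite (@big_cat_nat _ _ _ L)//= ?leq_addr//; congr (_ + _).
  by rewrite addnC big_nat_shift; apply: eq_bigr => k _; rewrite addnC.
have := strong g (L + (W + L))%N J; rewrite !split_sum.
rewrite [X in _ * (X + _)]big_nat [X in _ * (X + _)]big1 ?add0r; last first.
  by move=> y /andP[_ hy]; rewrite /g leqNgt hy/= cmodulus0 powR0// gt_eqF.
have -> : \sum_(0 <= k < W + L) cm (g (L + k)%N) `^ r =
    \sum_(0 <= k < W + L) cm (f (tau k%:Z x)) `^ r.
  by apply: eq_big_nat => k /andP[_ hk]; rewrite gE.
move=> h; apply: le_trans (h _ _) => {h}; last 2 first.
- by move=> y hy; rewrite /g [(y < _)%N]ltnNge hy andbF.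
- by move=> y hy; rewrite /g leqNgt hy.
rewrite -[leLHS]add0r lerD ?sumr_ge0//; first by move=> *; exact: powR_ge0.
apply: (@le_trans _ _ (\sum_(0 <= k < W)
    (\sum_(0 <= j < J) block_max a g j (L + k)) `^ r)); last first.
  rewrite [leRHS](@big_cat_nat _ _ _ W)//= ?leq_addr// -[leLHS]addr0 lerD//.
  by rewrite sumr_ge0// => *; exact: powR_ge0.
apply: ler_sum_nat => k /andP[_ hk].
rewrite le_eqVlt; apply/orP; left; apply/eqP; congr (_ `^ r).
apply: eq_big_nat => j /andP[_ hj]; apply: block_max_ext => n hn.
rewrite add0n orbit_shift -addnA gE// (leq_trans (_ : k + n < W + n)%N) ?ltn_add2r//.
by rewrite leq_add2l (leq_trans (ltnW hn))// leq_exp2l.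
Qed.

End Orbit.

(** * Convergence in [R[i]] *)

Section ComplexCvg.
Variable R : realType.
Local Notation cm := (@cmodulus R).

Lemma normcE (z : R[i]) : `|z| = (cm z)%:C%C.
Proof. by []. Qed.

(** A positive element of the partially ordered [R[i]] is real, so complex radii reduce to real
    ones. *)
Lemma ltcR (x : R) (e : R[i]) : 0 < e -> (x%:C%C < e) = (x < complex.Re e).
Proof. by rewrite !ltcE /= => /andP[/eqP -> _]; rewrite eqxx. Qed.

Lemma normr_Im_le (z : R[i]) : `|complex.Im z| <= cm z.
Proof.
case: z => a b; rewrite cmodulus_normc /= -sqrtr_sqr ler_wsqrtr//.
by rewrite lerDr sqr_ge0.
Qed.

Lemma cmodulus_le_ReIm (z : R[i]) : cm z <= `|complex.Re z| + `|complex.Im z|.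
Proof.
case: z => a b /=; rewrite -(cmodulus_real a).
have -> : `|b| = cm (0 +i* b)%C by rewrite cmodulus_normc /= expr0n add0r sqrtr_sqr.
have -> : (a +i* b)%C = (a +i* 0)%C + (0 +i* b)%C.
  by apply/eqP; rewrite eq_complex /= addr0 add0r !eqxx.
exact: cmodulusD.
Qed.

Lemma ccvgP (u : nat -> R[i]^o) (l : R[i]^o) :
  u n @[n --> \oo] --> l <->
  forall eps : R, 0 < eps -> exists m, forall n, (m <= n)%N -> cm (l - u n) < eps.
Proof.
split.
- move=> /cvgrPdist_lt h eps eps0.
  have e0 : 0 < eps%:C%C :> R[i] by rewrite ltcE /= eqxx.
  have [m _ hm] := h _ e0; exists m => n /hm /=.
  by rewrite normcE ltcR.
- move=> h; apply/cvgrPdist_lt => e e0.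
  have /h [m hm] : 0 < complex.Re e by move: e0; rewrite ltcE => /andP[].
  by exists m => // n /hm /=; rewrite normcE ltcR.
Qed.

Lemma cvg_of_cauchy (u : nat -> R) :
  (forall eps : R, 0 < eps -> exists m, forall n, (m <= n)%N -> `|u n - u m| <= eps) ->
  cvgn u.
Proof.
move=> h; apply/cauchy_cvgP/cauchy_exP => e e0.
have [|m hm] := h (e / 2); first by rewrite divr_gt0.
exists (u m); exists m => // n /hm /= hn.
rewrite -ball_normE /= distrC; apply: (le_lt_trans hn).
by rewrite ltr_pdivrMr// ltr_pMr// ltr1n.
Qed.

Lemma ccauchyP (u : nat -> R[i]^o) :
  cvgn u <->
  forall eps : R, 0 < eps -> exists m, forall n, (m <= n)%N -> cm (u n - u m) <= eps.
Proof.
split.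
- move=> /ccvgP h eps eps0; have [|m hm] := h (eps / 2); first by rewrite divr_gt0.
  exists m => n hn.
  have -> : u n - u m = (limn u - u m) - (limn u - u n).
    by rewrite opprB [RHS]addrC addrA subrK.
  rewrite (le_trans (cmodulusB _ _))// [leRHS](splitr eps).
  by rewrite lerD// ltW// hm.
- move=> h.
  have cr : cvgn (fun n => complex.Re (u n)).
    apply: cvg_of_cauchy => eps /h [m hm]; exists m => n /hm; apply: le_trans.
    by apply: le_trans (normr_Re_le _); case: (u n) => ? ?; case: (u m).
  have ci : cvgn (fun n => complex.Im (u n)).
    apply: cvg_of_cauchy => eps /h [m hm]; exists m => n /hm; apply: le_trans.
    by apply: le_trans (normr_Im_le _); case: (u n) => ? ?; case: (u m).
  apply/cvg_ex; exists (limn (fun n => complex.Re (u n)) +i*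
     limn (fun n => complex.Im (u n)))%C; apply/ccvgP => eps eps0.
  have e2 : 0 < eps / 2 by rewrite divr_gt0.
  have [m1 _ h1] := (cvgrPdist_lt _ _).1 cr _ e2.
  have [m2 _ h2] := (cvgrPdist_lt _ _).1 ci _ e2.
  exists (maxn m1 m2) => n; rewrite geq_max => /andP[/h1 /= n1 /h2 /= n2].
  rewrite (le_lt_trans (cmodulus_le_ReIm _))// [ltRHS]splitr ltrD//.
  + by move: n1; case: (u n) => ? ?.
  + by move: n2; case: (u n) => ? ?.
Qed.

End ComplexCvg.

(** * Convergent tails and their maximal function *)

Section Tails.
Context d (X : measurableType d) (R : realType).
Variables (mu : {measure set X -> \bar R}) (tau : int -> X -> X).
Hypothesis htau : measure_preserving_Zaction mu tau.
Variable a : nat -> R[i].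
Local Notation cm := (@cmodulus R).
Local Notation orbit := (orbit tau).
Local Notation orbit_sum := (orbit_sum tau a).
Local Notation orbit_variation := (orbit_variation tau a).
Local Notation exceed := (exceed tau a).
Implicit Types f : X -> R[i].

Definition orbit_partial f x N (K : nat) : R[i]^o := orbit_sum f x N K.

Definition orbit_tail f x N : R[i] := limn (orbit_partial f x N).

Definition orbit_max f x : \bar R :=
  ereal_sup [set (cm (orbit_tail f x N))%:E | N in [set N | (1 <= N)%N]].

Definition steady f (eps : R) x :=
  exists2 m, (0 < m)%N & forall K, (m <= K)%N -> cm (orbit_sum f x m K) <= eps.

(** The Cauchy criterion in a form that does not mention the start [N] of the tail; its countable
    quantifiers make the convergence set measurable. *)
Definition cauchy_orbit f x := forall l : nat, steady f l.+1%:R^-1 x.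

Lemma orbit_sum_cat f x N K L : (N <= K <= L)%N ->
  orbit_sum f x N L = orbit_sum f x N K + orbit_sum f x K L.
Proof. by move=> /andP[NK KL]; rewrite /orbit_sum (@big_cat_nat _ _ _ K). Qed.

Lemma orbit_sumB f x N K L : (N <= K <= L)%N ->
  orbit_sum f x K L = orbit_sum f x N L - orbit_sum f x N K.
Proof. by move=> NKL; rewrite (orbit_sum_cat f x NKL) addrC addKr. Qed.

Lemma invS_le (eps : R) : 0 < eps -> exists l : nat, l.+1%:R^-1 <= eps.
Proof.
move=> e0; exists (Num.truncn eps^-1).
by rewrite invf_ple ?posrE// ltW// truncnS_gt.
Qed.

Lemma orbit_partial_cvgP f x N : cvgn (orbit_partial f x N) <-> cauchy_orbit f x.
Proof.
rewrite ccauchyP; split.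
- move=> h l; have [|m hm] := h (l.+1%:R^-1 / 2); first by rewrite divr_gt0.
  exists (maxn m (maxn N 1)); first by rewrite !leq_max !orbT.
  set b := maxn _ _ => K bK.
  have mb : (m <= b)%N by rewrite leq_maxl.
  have Nb : (N <= b)%N by rewrite !leq_max leqnn orbT.
  rewrite (@orbit_sumB _ _ N) ?Nb//.
  have -> : orbit_sum f x N K - orbit_sum f x N b =
     (orbit_sum f x N K - orbit_sum f x N m) - (orbit_sum f x N b - orbit_sum f x N m).
    by rewrite opprB addrA subrK.
  rewrite (le_trans (cmodulusB _ _))// [leRHS]splitr lerD//; apply: hm => //.
  exact: leq_trans bK.
- move=> h eps eps0; have [|l hl] := @invS_le (eps / 2); first by rewrite divr_gt0.
  have [m m0 hm] := h l; exists (maxn m N) => K.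
  set b := maxn _ _ => bK.
  have mb : (m <= b)%N by rewrite leq_maxl.
  have Nb : (N <= b)%N by rewrite leq_maxr.
  rewrite /orbit_partial -orbit_sumB ?Nb// (@orbit_sumB _ _ m) ?mb//.
  rewrite (le_trans (cmodulusB _ _))// [leRHS]splitr lerD//; apply: le_trans hl; apply: hm => //.
  exact: leq_trans bK.
Qed.

Lemma measurable_steady f eps : cmeasurable f -> measurable [set x | steady f eps x].
Proof.
move=> mf.
have -> : [set x | steady f eps x] = \bigcup_(m in [set m | (0 < m)%N])
    \bigcap_(K in [set K | (m <= K)%N]) ~` [set x | eps < cm (orbit_sum f x m K)].
  apply/seteqP; split => x /= [m m0 hm]; exists m => // K /hm.
    by rewrite leNgt => /negP.
  by move=> /= /negP; rewrite -leNgt.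
apply: bigcup_measurable => m _.
apply: bigcap_measurableType => K _; apply: measurableC; apply: measurable_superlevel.
exact: (cmeasurable_cmodulus (cmeasurable_orbit_sum htau _ _ _ mf)).
Qed.

Lemma measurable_cauchy_orbit f :
  cmeasurable f -> measurable [set x | cauchy_orbit f x].
Proof.
move=> mf.
have -> : [set x | cauchy_orbit f x] = \bigcap_l [set x | steady f l.+1%:R^-1 x].
  by apply/seteqP; split => x /= h l; [move=> _|]; exact: h.
by apply: bigcapT_measurable => l; exact: measurable_steady.
Qed.

(** The limit of a divergent sequence is the default point 0. Thus [orbit_max] vanishes off the
    convergence set, and it can be estimated at every point. *)
Lemma orbit_tail_dvg f x N : ~ cauchy_orbit f x -> orbit_tail f x N = 0.
Proof. by move=> h; rewrite /orbit_tail (dvgP (F := _ @ _)) ?orbit_partial_cvgP. Qed.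

Lemma orbit_tail_cvg f x N (eps : R) : cauchy_orbit f x -> 0 < eps ->
  exists m, forall n, (m <= n)%N -> cm (orbit_tail f x N - orbit_sum f x N n) < eps.
Proof. by move=> /(orbit_partial_cvgP _ _ N)/ccvgP h /h. Qed.

Lemma measurable_orbit_tail f N :
  cmeasurable f -> measurable_fun setT (fun x => cm (orbit_tail f x N)).
Proof.
move=> mf.
(* The indicator makes the approximations converge everywhere, to the default value 0 off the
   convergence set. *)
pose h n x := cm (orbit_sum f x N n) * \1_[set x | cauchy_orbit f x] x.
apply: (measurable_fun_cvg (h := h)).
- move=> n; apply: measurable_funM.
    exact: (cmeasurable_cmodulus (cmeasurable_orbit_sum htau _ _ _ mf)).
  exact/measurable_indic/measurable_cauchy_orbit.
- move=> x _; rewrite /h indicE.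
  have [hx|hx] := pselect (cauchy_orbit f x).
  + rewrite mem_set//.
    apply/cvgrPdist_lt => eps eps0; have [m hm] := orbit_tail_cvg N hx eps0.
    exists m => // n /hm /=; rewrite mulr1; apply: le_lt_trans.
    rewrite ler_norml; apply/andP; split.
      rewrite lerNl opprB lerBlDr -(cmodulusN (_ - _)) opprB.
      rewrite (le_trans _ (cmodulusD _ _))// ?subrK//.
    rewrite lerBlDr (le_trans _ (cmodulusD _ _))// ?subrK//.
  + rewrite memNset// orbit_tail_dvg// cmodulus0.
    under eq_cvg do rewrite mulr0.
    exact: cvg_cst.
Qed.

Lemma measurable_orbit_max f : cmeasurable f -> measurable_fun setT (orbit_max f).
Proof.
move=> mf.
have := measurable_fun_esups (D := setT) (f := fun N x => (cm (orbit_tail f x N))%:E).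
move=> /(_ _ 1%N); apply => N.
exact/measurable_EFinP/measurable_orbit_tail.
Qed.

(** Only the block containing [N] is cut, and [block_max] controls every cut. *)
Lemma cmodulus_orbit_sum_le f x i N J : (2 ^ i <= N)%N ->
  cm (orbit_sum f x N (2 ^ J)) <= \sum_(i <= j < J) block_max a (orbit f x) j 0.
Proof.
move=> iN.
have empty K : (K <= N)%N -> cm (orbit_sum f x N K) = 0.
  by move=> KN; rewrite /orbit_sum big_geq// cmodulus0.
have s0 k l : 0 <= \sum_(k <= j < l) block_max a (orbit f x) j 0.
  by apply: sumr_ge0 => *; exact: block_max_ge0.
elim: J => [|J IH]; first by rewrite empty// (leq_trans _ iN)// leq_exp2l.
have [NJ|JN] := leqP (2 ^ J.+1) N; first by rewrite empty.
have iJ : (i <= J)%N by rewrite -ltnS -(ltn_exp2l i _ (isT : 1 < 2)%N) (leq_ltn_trans iN).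
have blk M : (2 ^ J <= M <= 2 ^ J.+1)%N ->
    cm (orbit_sum f x M (2 ^ J.+1)) <= block_max a (orbit f x) J 0.
  by move=> hM; have := block_max_ge a (orbit f x) 0 hM.
rewrite big_nat_recr//=.
have [NJ|{}JN'] := leqP N (2 ^ J).
  rewrite (@orbit_sum_cat _ _ _ (2 ^ J)) ?NJ ?leq_exp2l ?leqnSn//.
  by rewrite (le_trans (cmodulusD _ _))// lerD// blk// leqnn leq_exp2l// leqnSn.
by rewrite -[leLHS]add0r lerD// blk// (ltnW JN) ltnW.
Qed.

Lemma bounded_variation_cauchy_orbit f x (h : R) :
  (forall J, orbit_variation f J x <= h) -> cauchy_orbit f x.
Proof.
move=> hV; pose V J := orbit_variation f J x.
have ndV : nondecreasing_seq V.
  apply/nondecreasing_seqP => J; rewrite /V /orbit_variation big_nat_recr//= lerDl.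
  exact: block_max_ge0.
have cV : cvgn V.
  by apply: nondecreasing_is_cvgn => //; exists h => _ [J _ <-]; exact: hV.
move=> l; have e0 : 0 < l.+1%:R^-1 / 2 :> R by rewrite divr_gt0.
have [i _ hi] := (cvgrPdist_lt _ _).1 cV _ e0.
exists (2 ^ i)%N => [|K iK]; first by rewrite expn_gt0.
have small N : (2 ^ i <= N)%N -> forall J, (i <= J)%N ->
    cm (orbit_sum f x N (2 ^ J)) <= l.+1%:R^-1 / 2.
  move=> iN J iJ; rewrite (le_trans (cmodulus_orbit_sum_le _ _ _ iN))//.
  have -> : \sum_(i <= j < J) block_max a (orbit f x) j 0 = V J - V i.
    by rewrite /V /orbit_variation (@big_cat_nat _ _ _ i 0 J)//= addrAC subrr add0r.
  have VJ : V J <= limn V by exact: nondecreasing_cvgn_le.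
  have := hi i (leqnn i) => /=; rewrite ger0_norm ?subr_ge0; last exact: nondecreasing_cvgn_le.
  by move=> /ltW; apply: le_trans; rewrite lerB.
have KK : (K <= 2 ^ K)%N by rewrite ltnW// ltn_expl.
have iK' : (i <= K)%N by rewrite (leq_trans _ iK)// ltnW// ltn_expl.
(* Block maxima control sums that end at a power of 2, so an arbitrary end [K] is reached by a
   difference. *)
have -> : orbit_sum f x (2 ^ i) K = orbit_sum f x (2 ^ i) (2 ^ K) - orbit_sum f x K (2 ^ K).
  by rewrite (@orbit_sum_cat _ _ (2 ^ i) K (2 ^ K)) ?iK// addrK.
by rewrite (le_trans (cmodulusB _ _))// [leRHS]splitr lerD// small.
Qed.

Lemma cmodulus_orbit_tail_le f x N (h : R) : (0 < N)%N ->
  (forall J, orbit_variation f J x <= h) -> cm (orbit_tail f x N) <= h.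
Proof.
move=> N0 hV; have cx := bounded_variation_cauchy_orbit hV.
apply/ler_addgt0Pr => eps eps0; have [m hm] := orbit_tail_cvg N cx eps0.
have /ltW t1 := hm (2 ^ m)%N (ltnW (ltn_expl _ (isT : 1 < 2)%N)).
rewrite addrC -[orbit_tail _ _ _](subrK (orbit_sum f x N (2 ^ m))).
rewrite (le_trans (cmodulusD _ _))// lerD// (le_trans _ (hV m))//.
exact: (@cmodulus_orbit_sum_le _ _ 0).
Qed.

(** A tail larger than [lam > 0] is not the default value 0, so the series converges and its partial
    sums up to $2^J$ exceed [lam] for all large [J]. *)
Lemma orbit_max_gt f x (lam : R) : 0 < lam -> (lam%:E < orbit_max f x)%E ->
  exists J0, forall J, (J0 <= J)%N -> exceed f lam J x.
Proof.
move=> lam0 /ereal_sup_gt[_ [N /= N0 <-]]; rewrite lte_fin => hN.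
have [cx|cx] := pselect (cauchy_orbit f x); last first.
  by move: hN; rewrite orbit_tail_dvg// cmodulus0 ltNge ltW.
have [|m hm] := @orbit_tail_cvg f x N (cm (orbit_tail f x N) - lam) cx.
  by rewrite subr_gt0.
exists m => J mJ; exists N => //.
have := hm (2 ^ J)%N (leq_trans mJ (ltnW (ltn_expl _ (isT : 1 < 2)%N))).
have := cmodulusD (orbit_tail f x N - orbit_sum f x N (2 ^ J)) (orbit_sum f x N (2 ^ J)).
rewrite subrK => h1 h2; rewrite -(ltrD2l (cm (orbit_tail f x N) - lam)) subrK.
by rewrite (le_lt_trans h1)// ltrD2r.
Qed.

End Tails.

(** * Strong type bound and the convergence it implies *)

Section MaximalBounds.
Context d (X : measurableType d) (R : realType).
Variables (mu : {measure set X -> \bar R}) (tau : int -> X -> X).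
Hypothesis htau : measure_preserving_Zaction mu tau.
Variable a : nat -> R[i].
Local Notation cm := (@cmodulus R).
Local Notation orbit_sum := (orbit_sum tau a).
Local Notation orbit_variation := (orbit_variation tau a).
Local Notation orbit_max := (orbit_max tau a).
Local Notation orbit_tail := (orbit_tail tau a).
Local Notation cauchy_orbit := (cauchy_orbit tau a).
Local Notation steady := (steady tau a).
Local Notation exceed := (exceed tau a).
Implicit Types f : X -> R[i].

Lemma orbit_max_ge0 f x : (0 <= orbit_max f x)%E.
Proof.
apply: le_trans (_ : ((cm (orbit_tail f x 1))%:E <= _)%E).
  by rewrite lee_fin cmodulus_ge0.
by apply: ereal_sup_ubound; exists 1%N.
Qed.

Lemma cLnorm_powR (r : R) f : r != 0 ->
  (cLnorm mu r f `^ r = \int[mu]_x (cm (f x) `^ r)%:E)%E.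
Proof.
move=> r0; rewrite /cLnorm (poweR_Lnorm _ _ r0); apply: eq_integral => x _.
by rewrite gee0_abs ?lee_fin ?cmodulus_ge0.
Qed.

Definition variation_limit (r : R) f x : \bar R :=
  limn (fun J => (orbit_variation f J x `^ r)%:E).

Lemma nondecreasing_orbit_variation (r : R) f x : 0 <= r ->
  {homo (fun J => (orbit_variation f J x `^ r)%:E) : n m / (n <= m)%N >-> (n <= m)%E}.
Proof.
move=> r0 n m nm; rewrite lee_fin ge0_ler_powR ?nnegrE ?orbit_variation_ge0//.
rewrite /orbit_variation (@big_cat_nat _ _ _ n 0 m)//= lerDl.
by apply: sumr_ge0 => *; exact: block_max_ge0.
Qed.

Lemma orbit_variation_le_limit (r h : R) f x J : 0 < r ->
  variation_limit r f x = h%:E -> orbit_variation f J x <= h `^ r^-1.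
Proof.
move=> r0 hE.
have : ((orbit_variation f J x `^ r)%:E <= h%:E)%E.
  rewrite -hE /variation_limit.
  rewrite (cvg_lim _ (ereal_nondecreasing_cvgn (nondecreasing_orbit_variation f x (ltW r0))))//.
  by apply: ereal_sup_ubound; exists J.
rewrite lee_fin => hJ.
have V0 := orbit_variation_ge0 tau a f J x.
rewrite -[leLHS]powRr1// -(mulfV (lt0r_neq0 r0)) powRrM.
rewrite ge0_ler_powR ?invr_ge0 ?nnegrE ?powR_ge0 ?(ltW r0)//.
by rewrite (le_trans _ hJ) ?powR_ge0.
Qed.

Lemma variation_limit_ge0 (r : R) f x : 0 < r -> (0 <= variation_limit r f x)%E.
Proof.
move=> r0; apply: lime_ge.
  exact/ereal_nondecreasing_is_cvgn/nondecreasing_orbit_variation/ltW.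
by apply: nearW => J; rewrite lee_fin powR_ge0.
Qed.

Lemma orbit_max_powR_le (r : R) f x : 0 < r ->
  (orbit_max f x `^ r <= variation_limit r f x)%E.
Proof.
move=> r0; have := variation_limit_ge0 f x r0.
case hE : variation_limit => [h| |]//; last by move=> _; rewrite leey.
rewrite lee_fin => h0.
have le1 : (orbit_max f x <= (h `^ r^-1)%:E)%E.
  apply: ub_ereal_sup => _ [N /= N0 <-]; rewrite lee_fin.
  by apply: cmodulus_orbit_tail_le => // J; exact: orbit_variation_le_limit hE.
have -> : h%:E = ((h `^ r^-1)%:E `^ r)%E.
  by rewrite poweR_EFin -powRrM mulVf ?gt_eqF// powRr1.
apply: gt0_ler_poweR; rewrite ?in_itv /= ?orbit_max_ge0 ?leey ?lee_fin ?powR_ge0//.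
exact: ltW.
Qed.

Lemma measurable_variation_limit (r : R) f : 0 < r -> cmeasurable f ->
  measurable_fun setT (variation_limit r f).
Proof.
move=> r0 mf; apply: (emeasurable_fun_cvg (fun J x => (orbit_variation f J x `^ r)%:E)).
- move=> J; apply/measurable_EFinP/(measurableT_comp (measurable_powR _)).
  exact: (measurable_orbit_variation htau).
- move=> x _; exact/ereal_nondecreasing_is_cvgn/nondecreasing_orbit_variation/ltW.
Qed.

Section Strong.
Variables r K : R.
Hypotheses (r0 : 0 < r) (K0 : 0 <= K).
Hypothesis strong : forall f J, cmeasurable f ->
  (\int[mu]_x (cm (f x) `^ r)%:E < +oo)%E ->
  (\int[mu]_x (orbit_variation f J x `^ r)%:E <=
    K%:E * \int[mu]_x (cm (f x) `^ r)%:E)%E.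

Lemma integral_variation_limit f : cmeasurable f ->
  (\int[mu]_x (cm (f x) `^ r)%:E < +oo)%E ->
  (\int[mu]_x variation_limit r f x <= K%:E * \int[mu]_x (cm (f x) `^ r)%:E)%E.
Proof.
move=> mf foo.
have mV J : measurable_fun setT (fun x => (orbit_variation f J x `^ r)%:E).
  apply/measurable_EFinP/(measurableT_comp (measurable_powR _)).
  exact: (measurable_orbit_variation htau).
have hc : (\int[mu]_x (orbit_variation f J x `^ r)%:E)%E @[J --> \oo] -->
    (\int[mu]_x variation_limit r f x)%E.
  apply: (cvg_monotone_convergence measurableT mV).
  - by move=> J x _; rewrite lee_fin powR_ge0.
  - by move=> x _; apply: nondecreasing_orbit_variation; exact: ltW.
by apply: (cvge_le _ hc); apply: nearW => J; exact: strong.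
Qed.

(** The limit of the variations is integrable, hence finite almost everywhere, and bounded variation
    forces convergence. *)
Lemma ae_cauchy_orbit f : cmeasurable f ->
  (\int[mu]_x (cm (f x) `^ r)%:E < +oo)%E -> {ae mu, forall x, cauchy_orbit f x}.
Proof.
move=> mf foo.
have int : mu.-integrable setT (variation_limit r f).
  apply/integrableP; split; first exact: measurable_variation_limit.
  under eq_integral do rewrite gee0_abs ?variation_limit_ge0//.
  apply: (le_lt_trans (integral_variation_limit mf foo)).
  have f0 : (0 <= \int[mu]_x (cm (f x) `^ r)%:E)%E.
    by apply: integral_ge0 => x _; rewrite lee_fin powR_ge0.
  by move: foo; rewrite -ge0_fin_numE// => /fineK <-; rewrite -EFinM ltry.
apply: filterS (integrable_ae measurableT int) => x /(_ I).
case hE : variation_limit => [h| |]// _.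
by apply: bounded_variation_cauchy_orbit => J; exact: orbit_variation_le_limit hE.
Qed.

Lemma orbit_max_strong f : cmeasurable f -> (cLnorm mu r f < +oo)%E ->
  (Lnorm mu r%:E (orbit_max f) <= (K `^ r^-1)%:E * cLnorm mu r f)%E.
Proof.
move=> mf fr; have rn0 : r != 0 by rewrite gt_eqF.
have foo : (\int[mu]_x (cm (f x) `^ r)%:E < +oo)%E.
  by rewrite -cLnorm_powR// poweR_lty.
have f0 : (0 <= cLnorm mu r f)%E by exact: Lnorm_ge0.
rewrite -[leLHS]poweRe1 ?Lnorm_ge0// -(mulfV rn0) poweRrM poweR_Lnorm//.
rewrite -[X in (_ <= _ * X)%E]poweRe1// -(mulfV rn0) poweRrM cLnorm_powR//.
rewrite -poweR_EFin -poweRM ?lee_fin//; last first.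
  by apply: integral_ge0 => x _; rewrite lee_fin powR_ge0.
have h : (\int[mu]_x (`|orbit_max f x| `^ r) <= K%:E * \int[mu]_x (cm (f x) `^ r)%:E)%E.
  apply: le_trans (integral_variation_limit mf foo).
  apply: ge0_le_integral => //.
  - by move=> x _; exact: poweR_ge0.
  - apply: (measurableT_comp (measurable_poweR _)); apply: measurableT_comp => //.
    exact: (measurable_orbit_max htau).
  - exact: measurable_variation_limit.
  - by move=> x _; rewrite gee0_abs ?orbit_max_ge0// orbit_max_powR_le.
apply: gt0_ler_poweR => //; rewrite ?in_itv /= ?leey ?andbT ?invr_ge0 ?(ltW r0)//.
- by apply: integral_ge0 => x _; exact: poweR_ge0.
- by rewrite (le_trans _ h)//; apply: integral_ge0 => x _; exact: poweR_ge0.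
Qed.

End Strong.

(** The inner intersections increase with [J0], and each is contained in [E J0]; continuity from
    below concludes. *)
Lemma measure_eventually_le (E : nat -> set X) (B : \bar R) :
  (forall J, measurable (E J)) -> (forall J, (mu (E J) <= B)%E) ->
  measurable (\bigcup_J0 \bigcap_(J in [set J | (J0 <= J)%N]) E J) /\
  (mu (\bigcup_J0 \bigcap_(J in [set J | (J0 <= J)%N]) E J) <= B)%E.
Proof.
move=> mE EB.
have mF J0 : measurable (\bigcap_(J in [set J | (J0 <= J)%N]) E J).
  by apply: bigcap_measurableType => J _.
have mU := bigcupT_measurable _ mF; split=> //.
have nd : {homo (fun J0 => \bigcap_(J in [set J | (J0 <= J)%N]) E J) :
    n m / (n <= m)%N >-> (n <= m)%O}.
  by move=> n m nm; apply/subsetPset => x hx J /= mJ; apply: hx; exact: leq_trans mJ.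
apply: (cvge_le _ (nondecreasing_cvg_mu mF mU nd)); apply: nearW => J0.
by apply: le_trans (EB J0); rewrite le_measure ?inE//; apply: bigcap_inf => /=.
Qed.

End MaximalBounds.

(** * Weak type bound, and convergence for integrable functions *)

Section WeakBounds.
Context d (X : measurableType d) (R : realType).
Variables (mu : {measure set X -> \bar R}) (tau : int -> X -> X).
Hypothesis htau : measure_preserving_Zaction mu tau.
Variables (a : nat -> R[i]) (A : R).
Local Notation cm := (@cmodulus R).
Local Notation orbit_sum := (orbit_sum tau a).
Local Notation orbit_max := (orbit_max tau a).
Local Notation cauchy_orbit := (cauchy_orbit tau a).
Local Notation steady := (steady tau a).
Local Notation exceed := (exceed tau a).
Implicit Types f : X -> R[i].

Hypothesis weak : forall f lam J, cmeasurable f ->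
  (\int[mu]_x (cm (f x))%:E < +oo)%E -> 0 < lam ->
  (mu (exceed f lam J) <= (A / lam)%:E * \int[mu]_x (cm (f x))%:E)%E.

Definition eventually_exceed f lam : set X :=
  \bigcup_J0 \bigcap_(J in [set J | (J0 <= J)%N]) exceed f lam J.

Lemma measure_eventually_exceed f lam : cmeasurable f ->
  (\int[mu]_x (cm (f x))%:E < +oo)%E -> 0 < lam ->
  measurable (eventually_exceed f lam) /\
  (mu (eventually_exceed f lam) <= (A / lam)%:E * \int[mu]_x (cm (f x))%:E)%E.
Proof.
move=> mf foo lam0; apply: measure_eventually_le => J; last exact: weak.
exact: (measurable_exceed htau).
Qed.

Lemma cLnorm1 f : cLnorm mu 1 f = (\int[mu]_x (cm (f x))%:E)%E.
Proof.
rewrite /cLnorm Lnorm1; apply: eq_integral => x _.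
by rewrite gee0_abs ?lee_fin ?cmodulus_ge0.
Qed.

Lemma orbit_max_weak f : cmeasurable f -> (cLnorm mu 1 f < +oo)%E ->
  (weak_L1_quasinorm mu (orbit_max f) <= A%:E * cLnorm mu 1 f)%E.
Proof.
rewrite cLnorm1 => mf foo; apply: ub_ereal_sup => _ [lam /= lam0 <-].
have [mE hE] := measure_eventually_exceed mf foo lam0.
have hsub : (mu [set x | (lam%:E < orbit_max f x)%E] <= mu (eventually_exceed f lam))%E.
  rewrite le_measure ?inE//.
  - rewrite -[X in measurable X]setTI; apply: emeasurable_fun_o_infty => //.
    exact: (measurable_orbit_max htau).
  - by move=> x /= /(orbit_max_gt lam0)[J0 hJ0]; exists J0.
have -> : A%:E = (lam%:E * (A / lam)%:E)%E.
  by rewrite -EFinM mulrC divfK ?gt_eqF.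
rewrite -muleA lee_wpmul2l ?lee_fin ?(ltW lam0)//.
exact: le_trans hsub hE.
Qed.

Lemma cmeasurable_indic (S : set X) f : measurable S -> cmeasurable f ->
  cmeasurable (fun x => (\1_S x)%:C%C * f x).
Proof.
move=> mS [mr mi]; split.
- rewrite (_ : (fun x => _) = (fun x => \1_S x * complex.Re (f x))).
    by apply: measurable_funM => //; exact: measurable_indic.
  by apply/funext => x; case: (f x) => u v /=; rewrite mul0r subr0.
- rewrite (_ : (fun x => _) = (fun x => \1_S x * complex.Im (f x))).
    by apply: measurable_funM => //; exact: measurable_indic.
  by apply/funext => x; case: (f x) => u v /=; rewrite mul0r addr0.
Qed.

Lemma cmodulus_indic (S : set X) f x :
  cm ((\1_S x)%:C%C * f x) = \1_S x * cm (f x).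
Proof. by rewrite cmodulusM cmodulus_real ger0_norm. Qed.

(** Off [eventually_exceed] there are arbitrarily large [J] for which all sums of [f2] ending at
    $2^J$ are at most $\varepsilon/4$. A sum ending at [K] is a difference of two of these; with
    $\varepsilon/4$ for [f1] the total is $3\varepsilon/4$. *)
Lemma steadyD (f f1 f2 : X -> R[i]) (eps : R) x : 0 < eps ->
  (forall x, f x = f1 x + f2 x) -> cauchy_orbit f1 x ->
  ~ eventually_exceed f2 (eps / 4) x -> steady f eps x.
Proof.
move=> eps0 ff hc hE.
have e4 : 0 < eps / 4 by rewrite divr_gt0.
have [l hl] := invS_le e4; have [m m0 hm] := hc l.
exists m => // K mK.
have -> : orbit_sum f x m K = orbit_sum f1 x m K + orbit_sum f2 x m K.
  rewrite /orbit_sum -big_split/=; apply: eq_bigr => n _.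
  by rewrite /orbit ff mulrDr.
have {}hE : exists2 J, (K <= J)%N & ~ exceed f2 (eps / 4) J x.
  apply: contrapT => h; apply: hE; exists K => // J /= KJ.
  by apply: contrapT => hJ; apply: h; exists J.
have [J KJ hJ] := hE.
have bnd N : (0 < N)%N -> cm (orbit_sum f2 x N (2 ^ J)) <= eps / 4.
  by move=> N0; rewrite leNgt; apply/negP => h; apply: hJ; exists N.
have K2 : (K <= 2 ^ J)%N.
  by rewrite (leq_trans KJ)// ltnW// ltn_expl.
have -> : orbit_sum f2 x m K = orbit_sum f2 x m (2 ^ J) - orbit_sum f2 x K (2 ^ J).
  by rewrite (@orbit_sum_cat _ _ _ _ _ _ _ m K (2 ^ J)) ?mK// addrK.
have h1 := le_trans (hm K mK) hl; have h2 := bnd m m0.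
have h3 := bnd K (leq_trans m0 mK).
have t1 := cmodulusD (orbit_sum f1 x m K)
  (orbit_sum f2 x m (2 ^ J) - orbit_sum f2 x K (2 ^ J)).
have t2 := cmodulusB (orbit_sum f2 x m (2 ^ J)) (orbit_sum f2 x K (2 ^ J)).
by move: h1 h2 h3 t1 t2 eps0; lra.
Qed.

Lemma ae_cauchy_orbit1 : (forall f, cmeasurable f ->
    (\int[mu]_x (cm (f x) `^ 2)%:E < +oo)%E -> {ae mu, forall x, cauchy_orbit f x}) ->
  forall f, cmeasurable f -> (\int[mu]_x (cm (f x))%:E < +oo)%E ->
  {ae mu, forall x, cauchy_orbit f x}.
Proof.
move=> ae2 f mf foo; apply: ae_foralln => l.
have mcm := cmeasurable_cmodulus mf.
set eps : R := l.+1%:R^-1; have eps0 : 0 < eps by rewrite invr_gt0.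
have e4 : 0 < eps / 4 by rewrite divr_gt0.
(* The part of [f] below height [M] satisfies $|f_1|^2 \le M|f|$ and falls under the square
   integrable case; the remaining part tends to 0 in the mean. *)
pose T (M : nat) := [set x | M%:R < cm (f x)].
have mT M : measurable (T M) by exact: measurable_superlevel.
pose f1 M x := (\1_(~` T M) x)%:C%C * f x; pose f2 M x := (\1_(T M) x)%:C%C * f x.
have mf1 M : cmeasurable (f1 M) by apply: cmeasurable_indic => //; exact: measurableC.
have mf2 M : cmeasurable (f2 M) by exact: cmeasurable_indic.
have ffM M x : f x = f1 M x + f2 M x.
  rewrite /f1 /f2 !indicE; case: (pselect (T M x)) => h.
    by rewrite (mem_set h) memNset ?mul0r ?add0r ?mul1r//=; apply.
  by rewrite (memNset h) mem_set// mul0r addr0 mul1r.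
have cmf2 M x : cm (f2 M x) = \1_(T M) x * cm (f x) by exact: cmodulus_indic.
have f2le M x : cm (f2 M x) <= cm (f x).
  by rewrite cmf2 -[leRHS]mul1r ler_wpM2r ?cmodulus_ge0// indicE; case: (_ \in _).
have f2oo M : (\int[mu]_x (cm (f2 M x))%:E < +oo)%E.
  apply: le_lt_trans foo; apply: ge0_le_integral => //.
  - by move=> x _; rewrite lee_fin cmodulus_ge0.
  - exact/measurable_EFinP/cmeasurable_cmodulus.
  - exact/measurable_EFinP.
  - by move=> x _; rewrite lee_fin.
have f1oo M : (\int[mu]_x (cm (f1 M x) `^ 2)%:E < +oo)%E.
  apply: (@le_lt_trans _ _ (M%:R%:E * \int[mu]_x (cm (f x))%:E)%E); last first.
    have f0 : (0 <= \int[mu]_x (cm (f x))%:E)%E.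
      by apply: integral_ge0 => x _; rewrite lee_fin cmodulus_ge0.
    by move: foo; rewrite -ge0_fin_numE// => /fineK <-; rewrite -EFinM ltry.
  rewrite -ge0_integralZl_EFin//; last 2 first.
  - by move=> x _; rewrite lee_fin cmodulus_ge0.
  - exact/measurable_EFinP.
  apply: ge0_le_integral => //.
  - by move=> x _; rewrite lee_fin powR_ge0.
  - apply/measurable_EFinP/(measurableT_comp (measurable_powR _)).
    exact: cmeasurable_cmodulus.
  - by apply/measurable_EFinP/measurable_funM.
  - move=> x _; rewrite -EFinM lee_fin powR_mulrn ?cmodulus_ge0// cmodulus_indic indicE.
    case: (pselect (T M x)) => h.
      have nT : ~ (~` T M) x by apply.
      rewrite (memNset nT) mul0r expr0n/=.
      by rewrite mulr_ge0 ?cmodulus_ge0.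
    rewrite mem_set// mul1r expr2 ler_wpM2r ?cmodulus_ge0//.
    by move: h => /negP; rewrite -leNgt.
have cvg0 : (\int[mu]_x (cm (f2 M x))%:E)%E @[M --> \oo] --> 0%E.
  have [|||||_ _ hc] := @dominated_convergence _ X R mu setT measurableT
    (fun M x => (cm (f2 M x))%:E) (cst 0%E) (fun x => (cm (f x))%:E).
  - by move=> M; exact/measurable_EFinP/cmeasurable_cmodulus.
  - exact: measurable_cst.
  - apply: nearW => x _; apply: cvg_near_cst.
    exists (Num.truncn (cm (f x))).+1 => // M /= hM.
    rewrite cmf2 indicE memNset ?mul0r//= => /lt_trans-/(_ _ (truncnS_gt _)).
    by rewrite ltr_nat ltnNge hM.
  - apply/integrableP; split; first exact/measurable_EFinP.
    by under eq_integral do rewrite gee0_abs ?lee_fin ?cmodulus_ge0//.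
  - by apply: nearW => x M _; rewrite gee0_abs ?lee_fin ?cmodulus_ge0.
  - by move: hc; rewrite integral0.
have mB : measurable (~` [set x | steady f eps x]).
  by apply: measurableC; exact: (measurable_steady htau).
(* The left-hand side does not depend on [M], so letting [M] grow shows that the set is null. *)
have B_le M : (mu (~` [set x | steady f eps x]) <=
    (A / (eps / 4))%:E * \int[mu]_x (cm (f2 M x))%:E)%E.
  have [mE hE] := measure_eventually_exceed (mf2 M) (f2oo M) e4.
  apply: le_trans hE.
  have mN : measurable (~` [set x | cauchy_orbit (f1 M) x]).
    by apply: measurableC; exact: (measurable_cauchy_orbit htau).
  have N0 : mu (~` [set x | cauchy_orbit (f1 M) x]) = 0%E.
    by apply/negligibleP => //; exact: ae2.
  rewrite -[leRHS]add0e -N0.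
  apply: le_trans (measureU2 _ mN mE); rewrite le_measure ?inE//.
    exact: measurableU.
  move=> x /= hx; apply: contrapT => /not_orP[/contrapT h1 h2]; apply: hx.
  exact: (steadyD eps0 (ffM M) h1 h2).
have : (mu (~` [set x | steady f eps x]) <= (A / (eps / 4))%:E * 0)%E.
  by apply: (cvge_ge _ (cvgeZl _ cvg0)) => //; exact: nearW.
rewrite mule0 => B0; apply/negligibleP => //.
by apply/eqP; rewrite eq_le B0 measure_ge0.
Qed.

End WeakBounds.

(** The first clause makes the limits inside [hilbert_max] genuine almost everywhere, so that the
    two bounds are not about default values of [limn]. *)
Theorem theorem1p7 (R : realType) :
  exists2 eta0 : R -> nat -> R,
    (forall (delta : R) (m : nat), 0 < delta < 2^-1 -> (1 <= m)%N ->
       0 < eta0 delta m) &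
    forall (p : R -> R), admissible eta0 p ->
    forall (d : measure_display) (X : measurableType d)
      (mu : {sigma_finite_measure set X -> \bar R}) (tau : int -> X -> X),
      non_atomic mu -> measure_preserving_Zaction mu tau ->
      [/\ forall (r : R) (f : X -> R[i]), 1 <= r -> cLfun mu r f ->
            {ae mu, forall x, hilbert_tails_cvg p tau f x},
          forall r : R, 1 < r -> bounded_on_Lr mu r (hilbert_max p tau) &
          bounded_L1_weak_L1 mu (hilbert_max p tau)].
Proof.
(* The exponents in [correlation_phase] involve at most $3\eta$, whatever [m] is, so a threshold
   linear in [d] serves for all [m]. *)
exists (fun d _ => d / 16).
  by move=> delta m /andP[d0 _] _; rewrite divr_gt0.
move=> p hp d X mu tau _ htau.
have [e [C [e2 C0 hcorr]]] := modulation_decorrelated hp.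
have ale := @cmodulus_modulation R p.
have ale' n : (0 < n)%N -> cmodulus (modulation p n) <= n%:R^-1 by move=> /ale ->.
have e0 : (0 < e)%N by apply: leq_trans e2.
pose A : R := 64 * weak_constant e C.
have A0 : 0 <= A by rewrite /A /weak_constant; rewrite ?(mulr_ge0, addr_ge0).
have weak : forall (f : X -> R[i]) (lam : R) J, cmeasurable f ->
    (\int[mu]_x (cmodulus (f x))%:E < +oo)%E -> 0 < lam ->
    (mu (exceed tau (modulation p) f lam J) <=
      (A / lam)%:E * \int[mu]_x (cmodulus (f x))%:E)%E.
  apply: weak_type_orbit => // f W J lam lam0 fW.
  exact: (weak_type_nat C0 e0 ale' hcorr).
have strong (r : R) : 1 < r -> exists2 K : R, 0 <= K &
    forall (f : X -> R[i]) J, cmeasurable f ->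
    (\int[mu]_x (cmodulus (f x) `^ r)%:E < +oo)%E ->
    (\int[mu]_x (orbit_variation tau (modulation p) f J x `^ r)%:E <=
      K%:E * \int[mu]_x (cmodulus (f x) `^ r)%:E)%E.
  move=> r1; have r0 : 0 < r by rewrite (lt_trans _ r1).
  have [K K0 hK] := strong_type_nat C0 e2 ale' hcorr r1.
  by exists K => //; exact: (strong_type_orbit htau r0 K0 hK).
have ae_cvg (r : R) (f : X -> R[i]) : 1 < r -> cmeasurable f ->
    (\int[mu]_x (cmodulus (f x) `^ r)%:E < +oo)%E ->
    {ae mu, forall x, cauchy_orbit tau (modulation p) f x}.
  move=> r1 mf foo; have r0 : 0 < r by rewrite (lt_trans _ r1).
  have [K K0 hK] := strong r r1.
  exact: (ae_cauchy_orbit htau r0 hK).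
split.
- move=> r f r1 [mr mi foo].
  have mf : cmeasurable f by split.
  have ae : {ae mu, forall x, cauchy_orbit tau (modulation p) f x}.
    move: r1; rewrite le_eqVlt => /orP[/eqP r1|r1].
      move: foo; rewrite -r1 cLnorm1 => foo.
      apply: (ae_cauchy_orbit1 htau weak) => // g mg goo.
      by apply: (ae_cvg 2) => //; rewrite ltr1n.
    have rn0 : r != 0 by rewrite gt_eqF// (lt_trans _ r1).
    by apply: (ae_cvg r) => //; rewrite -cLnorm_powR// poweR_lty.
  apply: filterS ae => x hx N _.
  (* [hilbert_partial_sum] and [orbit_partial] for [modulation p] unfold to the same sum. *)
  exact/(orbit_partial_cvgP tau (modulation p) f x N).
- move=> r r1; have r0 : 0 < r by rewrite (lt_trans _ r1).
  have [K K0 hK] := strong r r1; exists (K `^ r^-1) => f [mr mi foo].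
  have mf : cmeasurable f by split.
  split; first exact: (measurable_orbit_max htau (modulation p) mf).
  exact: (orbit_max_strong htau r0 K0 hK mf foo).
- exists A => f [mr mi foo]; have mf : cmeasurable f by split.
  split; first exact: (measurable_orbit_max htau (modulation p) mf).
  exact: (orbit_max_weak htau weak mf foo).
Qed.
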